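(* Let $(A,\sigma)$ be a co-quasi-triangular dual quasi-Hopf algebra. Then there is a Hopf algebra $\underline A$ in the braided category $\mathcal M^A$ of right $A$-comodules, given as follows: $\underline A=A$ as a vector space, with right $A$-coaction $\rho_{\underline A}(a)=a_2\otimes S(a_1)a_3$, multiplication $$a\,\underline\cdot\, b=\varphi(S(a_1),a_{10},S(b_1)b_{12})\,f(b_6,a_3)\,\sigma(a_8,S(b_3))\,\varphi^{-1}(S(a_2),S(b_5),a_6b_9)\,\sigma(a_4,b_7)\,\varphi^{-1}(a_9,S(b_2),b_{11})\,\varphi(S(b_4),a_7,b_{10})\,a_5b_8,$$ unit the unit $1$ of $A$, comultiplication $$\underline\Delta(a)=\varphi^{-1}(S(a_1),a_5,S(a_7))\,\beta(a_6)\,\varphi(S(a_2)a_4,S(a_8),a_{10})\,a_3\otimes a_9,$$ counit $\underline\varepsilon=\alpha$, and antipode $$\underline S(a)=p_L(S^2(a_7),S(a_1))\,\sigma^{-1}(S^2(a_6)S(a_2),S(a_8))\,\varphi(S^2(a_5)S(a_3),S(a_9),a_{11})\,\alpha(a_{10})\,S(a_4),$$ for all $a,b\in A$.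
   Context: Everything is over a field $k$; summations are understood and iterated coproducts are written $a_1\otimes a_2\otimes a_3\otimes\cdots$. **Dual quasi-Hopf algebras.** A dual quasi-bialgebra is a coassociative counital coalgebra $(A,\Delta,\varepsilon)$ with coalgebra maps $A\otimes A\to A$, $a\otimes b\mapsto ab$, and $k\to A$, $1\mapsto 1$, and a convolution invertible $\varphi\in(A\otimes A\otimes A)^*$ with $a_1(b_1c_1)\varphi(a_2,b_2,c_2)=\varphi(a_1,b_1,c_1)(a_2b_2)c_2$, $1a=a1=a$, $\varphi(a_1,b_1,c_1d_1)\varphi(a_2b_2,c_2,d_2)=\varphi(b_1,c_1,d_1)\varphi(a_1,b_2c_2,d_2)\varphi(a_2,b_3,c_3)$, $\varphi(a,1,b)=\varepsilon(a)\varepsilon(b)$. It is a dual quasi-Hopf algebra if there are a coalgebra anti-endomorphism $S$ of $A$ and $\alpha,\beta\in A^*$ with $S(a_1)\alpha(a_2)a_3=\alpha(a)1$, $a_1\beta(a_2)S(a_3)=\beta(a)1$, $\varphi(a_1,S(a_3),a_5)\beta(a_2)\alpha(a_4)=\varphi^{-1}(S(a_1),a_3,S(a_5))\alpha(a_2)\beta(a_4)=\varepsilon(a)$; normalized so that $\alpha(1)=\beta(1)=1$. ($\varphi^{-1}$ is the convolution inverse.) **Twist.** $\gamma(a,b)=\varphi(S(b_2),S(a_2),a_4)\alpha(a_3)\varphi^{-1}(S(b_1)S(a_1),a_5,b_4)\alpha(b_3)$ and $f(a,b)=\varphi^{-1}(S(b_1)S(a_1),a_3b_3,S(a_5b_5))\beta(a_4b_4)\gamma(a_2,b_2)$.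 **Co-quasi-triangular (CQT).** $(A,\sigma)$ is CQT if $\sigma:A\otimes A\to k$ is bilinear with $\sigma(ab,c)=\varphi(c_1,a_1,b_1)\sigma(a_2,c_2)\varphi^{-1}(a_3,c_3,b_2)\sigma(b_3,c_4)\varphi(a_4,b_4,c_5)$, $\sigma(a,bc)=\varphi^{-1}(b_1,c_1,a_1)\sigma(a_2,c_2)\varphi(b_2,a_3,c_3)\sigma(a_4,b_3)\varphi^{-1}(a_5,b_4,c_4)$, $\sigma(a_1,b_1)a_2b_2=b_1a_1\sigma(a_2,b_2)$, $\sigma(a,1)=\sigma(1,a)=\varepsilon(a)$. Then $\sigma$ is convolution invertible (inverse $\sigma^{-1}$) and $S$ is bijective. Put $p_L(a,b)=\varphi(S^{-1}(a_3),a_1,b)\,\beta(S^{-1}(a_2))$. **The braided category $\mathcal M^A$.** Objects: right $A$-comodules, $m\mapsto m_{(0)}\otimes m_{(1)}$. Tensor product $M\otimes N$ with coaction $m\otimes n\mapsto m_{(0)}\otimes n_{(0)}\otimes m_{(1)}n_{(1)}$; unit object $k$ with usual unit constraints; associativity $(M\otimes N)\otimes P\to M\otimes(N\otimes P)$, $(m\otimes n)\otimes p\mapsto\varphi(m_{(1)},n_{(1)},p_{(1)})\,m_{(0)}\otimes(n_{(0)}\otimes p_{(0)})$; braiding $c_{M,N}(m\otimes n)=\sigma(m_{(1)},n_{(1)})\,n_{(0)}\otimes m_{(0)}$. A Hopf algebra in a braided category is an algebra and coalgebra in the category (associativity and coassociativity up to the associativity constraint) whose comultiplication and counit are algebra morphisms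 ($B\otimes B$ having the product built from the braiding), with an antipode morphism satisfying the usual axioms; all structure maps are morphisms of the category. *)

(* Defs.v *)
From HB Require Import structures.
From mathcomp Require Import all_boot all_algebra.
From mathcomp Require Import boolp.

Set Implicit Arguments.
Unset Strict Implicit.
Unset Printing Implicit Defensive.

Import GRing.Theory.
Local Open Scope ring_scope.
Local Open Scope quotient_scope.

Reserved Notation "V \ox W" (at level 40, left associativity).
Reserved Notation "\tsum_ ( x , y <- t ) E"
  (at level 41, x name, y name, t at level 80, E at level 41).
Reserved Notation "\sw[ n ]_ ( x .. y <- a ) E"
  (at level 41, n at level 10, x binder, y binder, a at level 80,
   E at level 41).

(* A list [:: (v1, w1); ..; (vn, wn)] stands for the formal sum of the pairs  *)
(* (vi, wi); tens_eq is the congruence imposing commutativity of the sum and  *)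
(* bilinearity of the pairs.                                                  *)
Inductive tens_eq (k : fieldType) (V W : lmodType k) :
    seq (V * W) -> seq (V * W) -> Prop :=
| tens_refl s : tens_eq s s
| tens_sym s t : tens_eq s t -> tens_eq t s
| tens_trans s t u : tens_eq s t -> tens_eq t u -> tens_eq s u
| tens_catC s t : tens_eq (s ++ t) (t ++ s)
| tens_cat s s' t : tens_eq s s' -> tens_eq (s ++ t) (s' ++ t)
| tens_zero w : tens_eq [:: (0, w)] [::]
| tens_addl v v' w : tens_eq [:: (v + v', w)] [:: (v, w); (v', w)]
| tens_addr v w w' : tens_eq [:: (v, w + w')] [:: (v, w); (v, w')]
| tens_scale c v w : tens_eq [:: (c *: v, w)] [:: (v, c *: w)].

Section TensorQuotient.
Variables (k : fieldType) (V W : lmodType k).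
Implicit Types (s t u : seq (V * W)).

Definition tens_eqb s t : bool := `[< tens_eq s t >].

Lemma tens_eqb_equiv : equiv_class_of tens_eqb.
Proof.
split=> [s|s t|t s u].
- exact/asboolP/tens_refl.
- by apply/asboolP/asboolP=> /tens_sym.
- by move=> /asboolP st /asboolP tu; apply/asboolP/(tens_trans st tu).
Qed.

Canonical tens_eqb_rel := EquivRelPack tens_eqb_equiv.

Definition tensor := {eq_quot tens_eqb_rel}.

HB.instance Definition _ := Choice.on tensor.
HB.instance Definition _ := EqQuotient.on tensor.

Lemma tens_piP s t : (\pi_tensor s = \pi_tensor t) <-> tens_eq s t.
Proof.
split=> [/eqmodP/asboolP //|st].
by apply/eqmodP/asboolP.
Qed.

Lemma tens_reprK s : tens_eq (repr (\pi_tensor s)) s.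
Proof. by apply/tens_piP; rewrite reprK. Qed.

Lemma tens_cat2 s s' t t' :
  tens_eq s s' -> tens_eq t t' -> tens_eq (s ++ t) (s' ++ t').
Proof.
move=> ss' tt'; apply: (tens_trans (tens_cat t ss')).
apply: (tens_trans (tens_catC _ _)).
by apply: (tens_trans (tens_cat s' tt')); apply: tens_catC.
Qed.

Definition scale_pair (c : k) (p : V * W) := (c *: p.1, p.2).

Lemma tens_map_scale c s t :
  tens_eq s t -> tens_eq (map (scale_pair c) s) (map (scale_pair c) t).
Proof.
elim=> {s t}.
- by move=> s; apply: tens_refl.
- by move=> s t _; apply: tens_sym.
- by move=> s t u _ st _; apply: tens_trans.
- by move=> s t; rewrite !map_cat; apply: tens_catC.
- by move=> s s' t _ ss'; rewrite !map_cat; apply: tens_cat.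
- by move=> w; rewrite /scale_pair /= scaler0; apply: tens_zero.
- by move=> v v' w; rewrite /scale_pair /= scalerDr; apply: tens_addl.
- by move=> v w w'; rewrite /scale_pair /=; apply: tens_addr.
- move=> d v w; rewrite /scale_pair /= scalerA mulrC -scalerA.
  exact: tens_scale.
Qed.

Definition tens0 : tensor := \pi_tensor [::].
Definition tens_add (x y : tensor) : tensor := \pi_tensor (repr x ++ repr y).
Definition tens_scl (c : k) (x : tensor) : tensor :=
  \pi_tensor (map (scale_pair c) (repr x)).
Definition tens_opp : tensor -> tensor := tens_scl (-1).

Lemma tens_addE s t :
  tens_add (\pi_tensor s) (\pi_tensor t) = \pi_tensor (s ++ t).
Proof. by apply/tens_piP/tens_cat2; apply: tens_reprK. Qed.

Lemma tens_sclE c s :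
  tens_scl c (\pi_tensor s) = \pi_tensor (map (scale_pair c) s).
Proof. exact/tens_piP/tens_map_scale/tens_reprK. Qed.

Lemma tens_pi_ind (P : tensor -> Prop) :
  (forall s, P (\pi_tensor s)) -> forall x, P x.
Proof. by move=> Ppi x; rewrite -[x]reprK. Qed.

Lemma tens_addA : associative tens_add.
Proof.
elim/tens_pi_ind=> s; elim/tens_pi_ind=> t; elim/tens_pi_ind=> u.
by rewrite !tens_addE catA.
Qed.

Lemma tens_addC : commutative tens_add.
Proof.
elim/tens_pi_ind=> s; elim/tens_pi_ind=> t.
by rewrite !tens_addE; apply/tens_piP/tens_catC.
Qed.

Lemma tens_add0 : left_id tens0 tens_add.
Proof. by elim/tens_pi_ind=> s; rewrite tens_addE. Qed.

Lemma tens_map_null s : tens_eq (map (scale_pair 0) s) [::].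
Proof.
elim: s => [|[v w] s IH]; first exact: tens_refl.
rewrite /scale_pair /= scale0r -cat1s -[[::]]cats0.
by apply: tens_cat2 => //; apply: tens_zero.
Qed.

Lemma tens_sclDl c d x : tens_scl (c + d) x = tens_add (tens_scl c x) (tens_scl d x).
Proof.
elim/tens_pi_ind: x => s; rewrite !tens_sclE tens_addE; apply/tens_piP.
elim: s => [|[v w] s IH]; first exact: tens_refl.
rewrite /= /scale_pair /= scalerDl -cat1s.
apply: (tens_trans (tens_cat2 (tens_addl _ _ _) IH)).
apply: (@tens_cat2 [:: _] [:: _]); first exact: tens_refl.
rewrite -cat1s -[_ :: map _ _]cat1s !catA.
by apply: tens_cat; apply: tens_catC.
Qed.

Lemma tens_addN : left_inverse tens0 tens_opp tens_add.
Proof.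
move=> x.
have {2}-> : x = tens_scl 1 x.
  elim/tens_pi_ind: x => s; rewrite tens_sclE; congr (\pi_tensor _).
  by rewrite -[LHS]map_id; apply/eq_map=> -[v w]; rewrite /scale_pair scale1r.
rewrite /tens_opp -tens_sclDl addNr.
elim/tens_pi_ind: x => s; rewrite tens_sclE.
exact/tens_piP/tens_map_null.
Qed.

HB.instance Definition _ :=
  GRing.isZmodule.Build tensor tens_addA tens_addC tens_add0 tens_addN.

Lemma tens_sclA c d x : tens_scl c (tens_scl d x) = tens_scl (c * d) x.
Proof.
elim/tens_pi_ind: x => s; rewrite !tens_sclE -map_comp; congr (\pi_tensor _).
by apply/eq_map=> -[v w]; rewrite /scale_pair /= scalerA.
Qed.

Lemma tens_scl1 : left_id 1 tens_scl.
Proof.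
elim/tens_pi_ind=> s; rewrite tens_sclE; congr (\pi_tensor _).
by rewrite -[RHS]map_id; apply/eq_map=> -[v w]; rewrite /scale_pair scale1r.
Qed.

Lemma tens_sclDr : right_distributive tens_scl +%R.
Proof.
move=> c; elim/tens_pi_ind=> s; elim/tens_pi_ind=> t.
rewrite [_ + _ in LHS]tens_addE !tens_sclE [RHS]tens_addE map_cat //.
Qed.

HB.instance Definition _ := GRing.Zmodule_isLmodule.Build k tensor
  tens_sclA tens_scl1 tens_sclDr (fun x c d => tens_sclDl c d x).

Definition otimes (v : V) (w : W) : tensor := \pi_tensor [:: (v, w)].

(* For F bilinear, tlift F is the linear map v (x) w |-> F v w; see tliftE    *)
(* and tlift_linear. The value does not depend on the representative.         *)
Definition tlift (U : zmodType) (F : V -> W -> U) (t : tensor) : U :=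
  \sum_(p <- repr t) F p.1 p.2.

Definition bilin (U : lmodType k) (F : V -> W -> U) : Prop :=
  (forall w, linear (F^~ w)) /\ (forall v, linear (F v)).

End TensorQuotient.

Notation "V \ox W" := (tensor V%type W%type) : type_scope.
Notation "v \ox w" := (otimes v w) : ring_scope.
Notation "\tsum_ ( x , y <- t ) E" := (tlift (fun x y => E) t) : ring_scope.

Section TensorTheory.
Variables (k : fieldType) (V W : lmodType k).

Lemma otimes_bilin : bilin (@otimes k V W).
Proof.
split=> [w c v v'|v c w w'].
- rewrite [_ *: _ in RHS]tens_sclE [RHS]tens_addE.
  exact/tens_piP/tens_addl.
- rewrite [_ *: _ in RHS]tens_sclE [RHS]tens_addE; apply/tens_piP.
  apply: (tens_trans (tens_addr _ _ _)); rewrite -cat1s.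
  by apply: tens_cat; apply/tens_sym/tens_scale.
Qed.

Lemma tens_pi_sum (s : seq (V * W)) :
  \pi_(tensor V W) s = \sum_(p <- s) p.1 \ox p.2.
Proof.
elim: s => [|[v w] s IH]; first by rewrite big_nil.
by rewrite big_cons -IH [RHS]tens_addE.
Qed.

Lemma tens_ind (P : V \ox W -> Prop) :
  P 0 -> (forall x y, P x -> P y -> P (x + y)) ->
  (forall v w, P (v \ox w)) -> forall x, P x.
Proof.
move=> P0 PD Pox; elim/tens_pi_ind=> s; rewrite tens_pi_sum.
by elim/big_ind: _.
Qed.

Variables (U : lmodType k) (F : V -> W -> U).
Hypothesis bilF : bilin F.

Let F0l w : F 0 w = 0.
Proof. by have /(_ w (-1) 0 0) := bilF.1; rewrite scaler0 addr0 scaleN1r addNr. Qed.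

Lemma tens_eq_sum (s t : seq (V * W)) :
  tens_eq s t -> \sum_(p <- s) F p.1 p.2 = \sum_(p <- t) F p.1 p.2.
Proof.
have FDl v v' w : F (v + v') w = F v w + F v' w.
  by have /(_ w 1 v v') := bilF.1; rewrite !scale1r.
have FDr v w w' : F v (w + w') = F v w + F v w'.
  by have /(_ v 1 w w') := bilF.2; rewrite !scale1r.
have F0r v : F v 0 = 0.
  by have /(_ v (-1) 0 0) := bilF.2; rewrite scaler0 addr0 scaleN1r addNr.
have FZl c v w : F (c *: v) w = c *: F v w.
  by have /(_ w c v 0) := bilF.1; rewrite !addr0 F0l addr0.
have FZr c v w : F v (c *: w) = c *: F v w.
  by have /(_ v c w 0) := bilF.2; rewrite !addr0 F0r addr0.
elim=> {s t}; rewrite ?big_cons ?big_nil //.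
- by move=> s t u _ -> _ ->.
- by move=> s t; rewrite !big_cat /= addrC.
- by move=> s s' t _; rewrite !big_cat /= => ->.
- by move=> w; rewrite !big_cons big_nil F0l addr0.
- by move=> v v' w; rewrite !big_cons big_nil /= FDl !addr0.
- by move=> v w w'; rewrite !big_cons big_nil /= FDr !addr0.
- by move=> c v w; rewrite !big_cons big_nil /= FZl FZr.
Qed.

Lemma tlift_pi s : tlift F (\pi_(tensor V W) s) = \sum_(p <- s) F p.1 p.2.
Proof. exact/tens_eq_sum/tens_reprK. Qed.

Lemma tliftE v w : tlift F (v \ox w) = F v w.
Proof. by rewrite tlift_pi big_cons big_nil addr0. Qed.

Lemma tlift_linear : linear (tlift F).
Proof.
move=> c; elim/tens_pi_ind=> s; elim/tens_pi_ind=> t.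
rewrite [_ *: _ in LHS]tens_sclE [_ + _ in LHS]tens_addE !tlift_pi big_cat /=.
congr (_ + _); rewrite big_map scaler_sumr; apply: eq_bigr => -[v w] _ /=.
by have /(_ w c v 0) := bilF.1; rewrite !addr0 F0l addr0.
Qed.

End TensorTheory.

Definition tmap (k : fieldType) (V W V' W' : lmodType k)
    (f : V -> V') (g : W -> W') (t : V \ox W) : V' \ox W' :=
  \tsum_(v, w <- t) f v \ox g w.

Record coalgebra (k : fieldType) := Coalgebra {
  coalg_sort :> lmodType k;
  Delta : {linear coalg_sort -> (coalg_sort \ox coalg_sort)%type};
  counit : {scalar coalg_sort};
  coalg_coassoc : forall a,
    \tsum_(a1, a2 <- Delta a) a1 \ox Delta a2
    = \tsum_(a1, a2 <- Delta a) \tsum_(b1, b2 <- Delta a1) b1 \ox (b2 \ox a2);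
  coalg_counitl : forall a, \tsum_(a1, a2 <- Delta a) counit a1 *: a2 = a;
  coalg_counitr : forall a, \tsum_(a1, a2 <- Delta a) counit a2 *: a1 = a
}.

Section Sweedler.
Variables (k : fieldType) (C : coalgebra k).

Fixpoint nfun (n : nat) (U : Type) : Type :=
  if n is m.+1 then C -> nfun m U else U.

Fixpoint sweedler (U : zmodType) (n : nat) : C -> nfun n.+1 U -> U :=
  if n is m.+1
  then fun a F => \tsum_(a1, a' <- Delta C a) @sweedler U m a' (F a1)
  else fun a F => F a.

End Sweedler.

(* \sw[n]_(a1 .. an <- a) E is the sum of E over a1 (x) .. (x) an, the n-leg  *)
(* iterated coproduct of a, for n > 0; E is meant to be multilinear in the ai.*)
Notation "\sw[ n ]_ ( x .. y <- a ) E" :=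
  (@sweedler _ _ _ n.-1 a (fun x => .. (fun y => E) ..)) : ring_scope.

Section DualQuasiHopfAxioms.
Variables (k : fieldType) (A : coalgebra k).
Variables (mul : {linear (A \ox A)%type -> A}) (one : A).
Variables (phi phiV : {scalar (A \ox A \ox A)%type}).

Local Notation "a ** b" := (mul (a \ox b)) (at level 38, left associativity).
Local Notation eps := (counit A).
Local Notation Phi a b c := (phi (a \ox b \ox c)).
Local Notation PhiV a b c := (phiV (a \ox b \ox c)).

Record dual_quasi_bialgebra : Prop := DualQuasiBialgebra {
  dqb_mul_Delta : forall a b, Delta A (a ** b) =
    \sw[2]_(a1 a2 <- a) \sw[2]_(b1 b2 <- b) (a1 ** b1) \ox (a2 ** b2);
  dqb_mul_counit : forall a b, eps (a ** b) = eps a * eps b;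
  dqb_one_Delta : Delta A one = one \ox one;
  dqb_one_counit : eps one = 1;
  dqb_phiV_r : forall a b c,
    \sw[2]_(a1 a2 <- a) \sw[2]_(b1 b2 <- b) \sw[2]_(c1 c2 <- c)
      Phi a1 b1 c1 * PhiV a2 b2 c2 = eps a * eps b * eps c;
  dqb_phiV_l : forall a b c,
    \sw[2]_(a1 a2 <- a) \sw[2]_(b1 b2 <- b) \sw[2]_(c1 c2 <- c)
      PhiV a1 b1 c1 * Phi a2 b2 c2 = eps a * eps b * eps c;
  dqb_assoc : forall a b c,
    \sw[2]_(a1 a2 <- a) \sw[2]_(b1 b2 <- b) \sw[2]_(c1 c2 <- c)
      Phi a2 b2 c2 *: (a1 ** (b1 ** c1))
    = \sw[2]_(a1 a2 <- a) \sw[2]_(b1 b2 <- b) \sw[2]_(c1 c2 <- c)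
      Phi a1 b1 c1 *: ((a2 ** b2) ** c2);
  dqb_mul1l : forall a, one ** a = a;
  dqb_mul1r : forall a, a ** one = a;
  dqb_cocycle : forall a b c d,
    \sw[2]_(a1 a2 <- a) \sw[2]_(b1 b2 <- b)
    \sw[2]_(c1 c2 <- c) \sw[2]_(d1 d2 <- d)
      Phi a1 b1 (c1 ** d1) * Phi (a2 ** b2) c2 d2
    = \sw[2]_(a1 a2 <- a) \sw[3]_(b1 b2 b3 <- b)
      \sw[3]_(c1 c2 c3 <- c) \sw[2]_(d1 d2 <- d)
      Phi b1 c1 d1 * Phi a1 (b2 ** c2) d2 * Phi a2 b3 c3;
  dqb_phi1 : forall a b, Phi a one b = eps a * eps b
}.

Variables (S : {linear A -> A}) (alpha beta : {scalar A}).

Record dual_quasi_Hopf : Prop := DualQuasiHopfAxioms {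
  dqh_bialg : dual_quasi_bialgebra;
  dqh_S_Delta : forall a, Delta A (S a) = \sw[2]_(a1 a2 <- a) S a2 \ox S a1;
  dqh_S_counit : forall a, eps (S a) = eps a;
  dqh_alpha_ax : forall a,
    \sw[3]_(a1 a2 a3 <- a) alpha a2 *: (S a1 ** a3) = alpha a *: one;
  dqh_beta_ax : forall a,
    \sw[3]_(a1 a2 a3 <- a) beta a2 *: (a1 ** S a3) = beta a *: one;
  dqh_zigzag1 : forall a,
    \sw[5]_(a1 a2 a3 a4 a5 <- a) Phi a1 (S a3) a5 * beta a2 * alpha a4 = eps a;
  dqh_zigzag2 : forall a,
    \sw[5]_(a1 a2 a3 a4 a5 <- a)
      PhiV (S a1) a3 (S a5) * alpha a2 * beta a4 = eps a;
  dqh_alpha1 : alpha one = 1;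
  dqh_beta1 : beta one = 1
}.

End DualQuasiHopfAxioms.

(* The convolution inverse of the reassociator is unique, so carrying it as a *)
(* field adds no structure.                                                   *)
Record dualQuasiHopf (k : fieldType) := DualQuasiHopf {
  dqh_coalg :> coalgebra k;
  dqh_mul : {linear (dqh_coalg \ox dqh_coalg)%type -> dqh_coalg};
  dqh_one : dqh_coalg;
  dqh_phi : {scalar (dqh_coalg \ox dqh_coalg \ox dqh_coalg)%type};
  dqh_phiV : {scalar (dqh_coalg \ox dqh_coalg \ox dqh_coalg)%type};
  dqh_S : {linear dqh_coalg -> dqh_coalg};
  dqh_alpha : {scalar dqh_coalg};
  dqh_beta : {scalar dqh_coalg};
  dqh_axioms : dual_quasi_Hopf dqh_mul dqh_one dqh_phi dqh_phiV
                               dqh_S dqh_alpha dqh_beta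
}.

Notation "a ** b" := (dqh_mul _ (a \ox b))
  (at level 38, left associativity) : ring_scope.

Section DualQuasiHopfTheory.
Variables (k : fieldType) (A : dualQuasiHopf k).
Implicit Types (sigma sigmaV : {scalar (A \ox A)%type}).

Local Notation eps := (counit A).
Local Notation one := (dqh_one A).
Local Notation S := (dqh_S A).
Local Notation alpha := (dqh_alpha A).
Local Notation beta := (dqh_beta A).
Local Notation Phi a b c := (dqh_phi A (a \ox b \ox c)).
Local Notation PhiV a b c := (dqh_phiV A (a \ox b \ox c)).

Definition gamma_form (a b : A) : k :=
  \sw[5]_(a1 a2 a3 a4 a5 <- a) \sw[4]_(b1 b2 b3 b4 <- b)
    Phi (S b2) (S a2) a4 * alpha a3 * PhiV (S b1 ** S a1) a5 b4 * alpha b3.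

Definition f_form (a b : A) : k :=
  \sw[5]_(a1 a2 a3 a4 a5 <- a) \sw[5]_(b1 b2 b3 b4 b5 <- b)
    PhiV (S b1 ** S a1) (a3 ** b3) (S (a5 ** b5))
    * beta (a4 ** b4) * gamma_form a2 b2.

Record co_quasi_triangular sigma : Prop := CoQuasiTriangular {
  cqt_mull : forall a b c,
    sigma ((a ** b) \ox c)
    = \sw[4]_(a1 a2 a3 a4 <- a) \sw[4]_(b1 b2 b3 b4 <- b)
      \sw[5]_(c1 c2 c3 c4 c5 <- c)
        Phi c1 a1 b1 * sigma (a2 \ox c2) * PhiV a3 c3 b2
        * sigma (b3 \ox c4) * Phi a4 b4 c5;
  cqt_mulr : forall a b c,
    sigma (a \ox (b ** c))
    = \sw[5]_(a1 a2 a3 a4 a5 <- a) \sw[4]_(b1 b2 b3 b4 <- b)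
      \sw[4]_(c1 c2 c3 c4 <- c)
        PhiV b1 c1 a1 * sigma (a2 \ox c2) * Phi b2 a3 c3
        * sigma (a4 \ox b3) * PhiV a5 b4 c4;
  cqt_comm : forall a b,
    \sw[2]_(a1 a2 <- a) \sw[2]_(b1 b2 <- b) sigma (a1 \ox b1) *: (a2 ** b2)
    = \sw[2]_(a1 a2 <- a) \sw[2]_(b1 b2 <- b) sigma (a2 \ox b2) *: (b1 ** a1);
  cqt_1r : forall a, sigma (a \ox one) = eps a;
  cqt_1l : forall a, sigma (one \ox a) = eps a
}.

Definition convolution_inverse sigma sigmaV : Prop :=
  (forall a b, \sw[2]_(a1 a2 <- a) \sw[2]_(b1 b2 <- b)
     sigma (a1 \ox b1) * sigmaV (a2 \ox b2) = eps a * eps b) /\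
  (forall a b, \sw[2]_(a1 a2 <- a) \sw[2]_(b1 b2 <- b)
     sigmaV (a1 \ox b1) * sigma (a2 \ox b2) = eps a * eps b).

(* SV stands for the inverse of the antipode.                                 *)
Definition pL (SV : A -> A) (a b : A) : k :=
  \sw[3]_(a1 a2 a3 <- a) Phi (SV a3) a1 b * beta (SV a2).

End DualQuasiHopfTheory.

Section Comodules.
Variables (k : fieldType) (A : dualQuasiHopf k).

(* The data of an object; the comodule axioms are stated by is_comodule.      *)
Record precomodule := Precomodule {
  pcom_sort :> lmodType k;
  coact : pcom_sort -> pcom_sort \ox A
}.

Record is_comodule (M : precomodule) : Prop := IsComodule {
  coact_linear : linear (@coact M);
  coact_coassoc : forall m : M,
    \tsum_(m0, m1 <- coact m) m0 \ox Delta A m1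
    = \tsum_(m0, m1 <- coact m) \tsum_(n0, n1 <- coact m0) n0 \ox (n1 \ox m1);
  coact_counit : forall m : M, \tsum_(m0, m1 <- coact m) counit A m1 *: m0 = m
}.

Definition is_comorphism (M N : precomodule) (f : M -> N) : Prop :=
  linear f /\ forall m, coact (f m) = tmap f id (coact m).

Definition com_unit : precomodule :=
  @Precomodule k^o (fun c => (c : k^o) \ox dqh_one A).

Definition com_tensor (M N : precomodule) : precomodule :=
  @Precomodule (M \ox N)%type (fun t =>
    \tsum_(m, n <- t) \tsum_(m0, m1 <- coact m) \tsum_(n0, n1 <- coact n)
      (m0 \ox n0) \ox (m1 ** n1)).

Definition com_assoc (M N P : precomodule) (t : (M \ox N) \ox P) :
    M \ox (N \ox P) :=
  \tsum_(mn, p <- t) \tsum_(m, n <- mn)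
  \tsum_(m0, m1 <- coact m) \tsum_(n0, n1 <- coact n) \tsum_(p0, p1 <- coact p)
    dqh_phi A (m1 \ox n1 \ox p1) *: (m0 \ox (n0 \ox p0)).

Definition com_assocV (M N P : precomodule) (t : M \ox (N \ox P)) :
    (M \ox N) \ox P :=
  \tsum_(m, np <- t) \tsum_(n, p <- np)
  \tsum_(m0, m1 <- coact m) \tsum_(n0, n1 <- coact n) \tsum_(p0, p1 <- coact p)
    dqh_phiV A (m1 \ox n1 \ox p1) *: ((m0 \ox n0) \ox p0).

Definition com_lunit (M : precomodule) (t : k^o \ox M) : M :=
  tlift (fun (c : k^o) (m : M) => (c : k) *: m) t.

Definition com_runit (M : precomodule) (t : M \ox k^o) : M :=
  tlift (fun (m : M) (c : k^o) => (c : k) *: m) t.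

Variable sigma : {scalar (A \ox A)%type}.

Definition com_braiding (M N : precomodule) (t : M \ox N) : N \ox M :=
  \tsum_(m, n <- t) \tsum_(m0, m1 <- coact m) \tsum_(n0, n1 <- coact n)
    sigma (m1 \ox n1) *: (n0 \ox m0).

Section BraidedHopf.
Variable B : precomodule.
Let B2 := com_tensor B B.

Variables (mB : B2 -> B) (uB : com_unit -> B).
Variables (DB : B -> B2) (eB : B -> com_unit) (SB : B -> B).

(* The product of the tensor square of B: the composite                       *)
(*   (BB)(BB) -> B(B(BB)) -> B((BB)B) -> B((BB)B) -> B(B(BB)) -> (BB)(BB)     *)
(* braiding the two inner factors, followed by mB (x) mB.                     *)
Definition mul_tensor_square (t : B2 \ox B2) : B2 :=
  let t1 : B \ox (B \ox B2) := @com_assoc B B B2 t in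
  let t2 : B \ox (B2 \ox B) := tmap id (@com_assocV B B B) t1 in
  let t3 : B \ox (B2 \ox B) := tmap id (tmap (@com_braiding B B) id) t2 in
  let t4 : B \ox (B \ox B2) := tmap id (@com_assoc B B B) t3 in
  let t5 : B2 \ox B2 := @com_assocV B B B2 t4 in
  tmap mB mB t5.

Record is_braided_Hopf_algebra : Prop := IsBraidedHopfAlgebra {
  bh_comodule : is_comodule B;
  bh_mul_mor : is_comorphism mB;
  bh_unit_mor : is_comorphism uB;
  bh_comul_mor : is_comorphism DB;
  bh_counit_mor : is_comorphism eB;
  bh_antipode_mor : is_comorphism SB;
  bh_mulA : forall t : B2 \ox B,
    mB (tmap mB id t) = mB (tmap id mB (@com_assoc B B B t));
  bh_mul1l : forall t : k^o \ox B, mB (tmap uB id t) = com_lunit t;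
  bh_mul1r : forall t : B \ox k^o, mB (tmap id uB t) = com_runit t;
  bh_coassoc : forall b,
    @com_assoc B B B (tmap DB id (DB b)) = tmap id DB (DB b);
  bh_counitl : forall b, com_lunit (tmap eB id (DB b)) = b;
  bh_counitr : forall b, com_runit (tmap id eB (DB b)) = b;
  bh_comul_mul : forall t : B2,
    DB (mB t) = mul_tensor_square (tmap DB DB t);
  bh_comul_unit : DB (uB 1) = uB 1 \ox uB 1;
  bh_counit_mul : forall t : B2, eB (mB t) = com_lunit (tmap eB eB t);
  bh_counit_unit : forall c, eB (uB c) = c;
  bh_antipodel : forall b, mB (tmap SB id (DB b)) = uB (eB b);
  bh_antipoder : forall b, mB (tmap id SB (DB b)) = uB (eB b)
}.

End BraidedHopf.
End Comodules.

Section Transmutation.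
Variables (k : fieldType) (A : dualQuasiHopf k).
Variable sigma : {scalar (A \ox A)%type}.

Local Notation S := (dqh_S A).
Local Notation alpha := (dqh_alpha A).
Local Notation beta := (dqh_beta A).
Local Notation Phi a b c := (dqh_phi A (a \ox b \ox c)).
Local Notation PhiV a b c := (dqh_phiV A (a \ox b \ox c)).

Definition und : precomodule A :=
  @Precomodule k A A (fun a => \sw[3]_(a1 a2 a3 <- a) a2 \ox (S a1 ** a3)).

Definition und_mulf (a b : A) : A :=
  \sw[10]_(a1 a2 a3 a4 a5 a6 a7 a8 a9 a10 <- a)
  \sw[12]_(b1 b2 b3 b4 b5 b6 b7 b8 b9 b10 b11 b12 <- b)
    (Phi (S a1) a10 (S b1 ** b12) * f_form b6 a3 * sigma (a8 \ox S b3)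
     * PhiV (S a2) (S b5) (a6 ** b9) * sigma (a4 \ox b7)
     * PhiV a9 (S b2) b11 * Phi (S b4) a7 b10) *: (a5 ** b8).

Definition und_mul (t : A \ox A) : A := tlift und_mulf t.

Definition und_unit (c : k^o) : A := (c : k) *: dqh_one A.

Definition und_comul (a : A) : A \ox A :=
  \sw[10]_(a1 a2 a3 a4 a5 a6 a7 a8 a9 a10 <- a)
    (PhiV (S a1) a5 (S a7) * beta a6 * Phi (S a2 ** a4) (S a8) a10)
    *: (a3 \ox a9).

Definition und_counit (a : A) : k^o := alpha a.

Definition und_antipode (SV : A -> A) (sigmaV : {scalar (A \ox A)%type})
    (a : A) : A :=
  \sw[11]_(a1 a2 a3 a4 a5 a6 a7 a8 a9 a10 a11 <- a)
    (pL SV (S (S a7)) (S a1) * sigmaV ((S (S a6) ** S a2) \ox S a8)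
     * Phi (S (S a5) ** S a3) (S a9) a11 * alpha a10) *: S a4.

End Transmutation.

(* Main.v *)
From HB Require Import structures.
From mathcomp Require Import all_boot all_algebra.
From mathcomp Require Import boolp classical_sets ring.
Require Import Defs.

Set Implicit Arguments.
Unset Strict Implicit.
Unset Printing Implicit Defensive.

Import GRing.Theory.
Local Open Scope ring_scope.

(** Let U be A with the coaction [a |-> a2 (x) S a1 a3]. The point is that U
    is the coend of [X' (x) X] over the finite-dimensional comodules X with
    their duals X'. If X has a basis e_i with coaction [e_j |-> sum_i e_i (x)
    c_ij], the map [inc : X' (x) X -> U] sending [e'_i (x) e_j] to c_ij is a
    morphism of comodules. Every comodule is locally finite
    ([comodule_localfin]), so A is spanned by such matrix coefficients
    ([fmat_span]), and a morphism out of a tensor product with a factor U is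
    determined by its composites with the maps [inc] ([coverC]).

    Through the duality between X and X', these composites amount to a
    coaction [delta : X -> X (x) U], natural in every comodule X ([cdelta]).
    On the coend side the structure maps of the theorem have short
    descriptions. The counit restricts to the evaluation [X' (x) X -> k]. The
    comultiplication inserts a coevaluation in the middle of [X' (x) X]. The
    product of the generators of X and of Y is the generator of [Y (x) X],
    after the factors have been braided into place and [X' (x) Y'] has been
    compared with the dual of [Y (x) X]. The antipode moves the U produced by
    delta on X' across X' with the inverse braiding, and evaluates.

    In these terms the Hopf algebra axioms say that delta is a coaction
    ([Dl_d], [eps_d]) and that it is multiplicative: acting on Y, then on X,
    and multiplying the two copies of U is acting on [Y (x) X] ([delta2_pr]).
    Each axiom becomes an equality of two natural families of morphisms on
    words such as [V (x) U (x) U], and such families are equal once they agree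
    after delta ([uniq1], [uniq2], [uniq3]). For instance, associativity holds
    because both bracketings compute delta on a threefold tensor product, and
    the antipode axioms are the naturality of delta with respect to an
    evaluation and a coevaluation.

    It remains to find the explicit formulas. On matrix coefficients a
    Sweedler sum is a sum over paths of indices ([sweedler_paths]), and a
    composite of structural morphisms applied to basis vectors is a sum over
    products of index sets ([push]). The identities [comulU_inc], [mulU_inc]
    and [antipodeU_inc] thus compare two finite sums, which become equal term
    by term after their indices have been matched. The twist f enters as the
    matrix of the comparison [X' (x) Y' -> (Y (x) X)'] ([thE]).

    Two facts complete the picture. The braiding of X with Y is invertible as
    soon as X has a dual ([rigid_brK]), and the matrix of its inverse gives a
    convolution inverse of sigma ([sigmaV_inv]). The Drinfeld morphism [X ->
    X''] is injective ([drinfeldK]), so that on coefficients the square of S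
    is conjugation by an invertible matrix ([S2_conj]); hence S is bijective
    ([antipode_bij]). *)

(** * Linear functionals on a vector space *)

Section Functionals.
Variables (k : fieldType) (V : lmodType k).

Definition subspace (W : V -> Prop) :=
  W 0 /\ forall a u v, W u -> W v -> W (a *: u + v).

(** A subspace that is maximal among those avoiding [v] has codimension one, by
    Zorn; the functional is the coordinate along [v]. *)
Lemma separating_functional (W : V -> Prop) (v : V) : subspace W -> ~ W v ->
  exists f : {scalar V}, f v = 1 /\ forall w, W w -> f w = 0.
Proof.
move=> sW nWv.
pose T := {M : V -> Prop | [/\ subspace M, (forall w, W w -> M w) & ~ M v]}.
pose R (A B : T) := `[< forall u, sval A u -> sval B u >].
have t0 : T by exists W.
have [M maxM] : exists M, premaximal R M.
  apply: (ZL_preorder t0) => [A|A B C /asboolP AB /asboolP BC|F totF].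
  - by apply/asboolP.
  - by apply/asboolP => u /AB /BC.
  have [F0|nF0] := EM (forall A, ~ F A).
    by exists t0 => A /F0.
  have [A0 FA0] : exists A, F A by apply/not_existsP => H; apply: nF0.
  pose N u := exists A, F A /\ sval A u.
  have PN : [/\ subspace N, (forall w, W w -> N w) & ~ N v].
    split; first split.
    - by exists A0; case: (svalP A0) => -[].
    - move=> a x y [A [FA Ax]] [B [FB By]].
      have [/asboolP AB|/asboolP BA] := totF _ _ FA FB.
        by exists B; split=> //; case: (svalP B) => -[_ BL] _ _; apply: BL => //;
          exact: AB.
      by exists A; split=> //; case: (svalP A) => -[_ BL] _ _; apply: BL => //; exact:
        BA.
    - by move=> w Ww; exists A0; split=> //; case: (svalP A0) => _ + _; apply.
    by move=> [A [_ Av]]; case: (svalP A).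
  exists (exist _ N PN) => A FA; apply/asboolP => u Au.
  by exists A.
have [[M0 ML] WM nMv] := svalP M.
have {}maxM (N : V -> Prop) : subspace N -> ~ N v ->
    (forall u, sval M u -> N u) -> forall u, N u -> sval M u.
  move=> sN nN MN; have PN : [/\ subspace N, (forall w, W w -> N w) & ~ N v].
    by split=> // w /WM; exact: MN.
  by have /asboolP := maxM (exist _ N PN) (asboolT MN).
move: (sval M) M0 ML WM nMv maxM => {t0 M R T} M M0 ML WM nMv maxM.
have MZ a u : M u -> M (a *: u).
  by move=> Mu; rewrite -[_ *: _]addr0; apply: ML.
have MB u w : M u -> M w -> M (u - w).
  by move=> Mu Mw; rewrite addrC -scaleN1r; apply: ML.
have MD u w : M u -> M w -> M (u + w).
  by move=> Mu Mw; rewrite -[u]scale1r; apply: ML.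
(* By maximality, the span of [M] and [u] contains [v] unless [u] is in [M]. *)
have dec u : exists a, M (u - a *: v).
  have [[a Mu]|H] := EM (exists a, M (u - a *: v)); first by exists a.
  exfalso; apply: H.
  pose N w := exists a m, M m /\ w = m + a *: u.
  have MN : forall w, M w -> N w by move=> w Mw; exists 0, w; rewrite scale0r addr0.
  have sN : subspace N.
    split; first exact: MN.
    move=> a _ _ [b [m [Mm ->]]] [c [n [Mn ->]]]; exists (a * b + c), (a *: m + n).
    by split; [exact: ML|rewrite scalerDr scalerA scalerDl addrACA].
  have [[a [m [Mm vE]]]|nNv] := EM (N v).
    have a0 : a != 0.
      by apply: contra_notN nMv => /eqP a0; rewrite vE a0 scale0r addr0.
    exists a^-1; rewrite vE scalerDr scalerA mulVf // scale1r opprD addrCA subrr addr0.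
    by rewrite -scaleN1r; apply/MZ/MZ.
  exists 0; rewrite scale0r subr0; apply: (maxM N) => //; exists 1, 0.
  by rewrite add0r scale1r.
have uniq u a b : M (u - a *: v) -> M (u - b *: v) -> a = b.
  move=> Ma Mb; apply/eqP; rewrite -subr_eq0; apply: contra_notT nMv => ab.
  have := MZ (a - b)^-1 _ (MB _ _ Mb Ma).
  have -> : u - b *: v - (u - a *: v) = (a - b) *: v.
    by rewrite scalerBl opprB addrC addrA subrK.
  by rewrite scalerA mulVf ?scale1r.
have [f fP] := choice dec.
have f_lin : scalar f.
  move=> a x y; apply: (uniq (a *: x + y)) => //.
  have -> : a *: x + y - (a * f x + f y) *: v
      = a *: (x - f x *: v) + (y - f y *: v).
    by rewrite scalerBr scalerA scalerDl opprD addrACA.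
  by apply: ML.
exists (HB.pack_for {scalar V} f (GRing.isLinear.Build k V k^o _ f f_lin)).
split=> /= [|w Ww]; apply: (uniq _ _ _ (fP _)).
  by rewrite scale1r subrr.
by rewrite scale0r subr0; exact: WM.
Qed.

Definition independent (I : finType) (x : I -> V) :=
  forall l : I -> k, \sum_i l i *: x i = 0 -> forall i, l i = 0.

(** Each vector of an independent family is separated from the span of the
    other ones. *)
Lemma dual_functionals (I : finType) (x : I -> V) : independent x ->
  exists f : I -> {scalar V}, forall i j, f i (x j) = (i == j)%:R.
Proof.
move=> ind; suff /choice[f fP] : forall i, exists f : {scalar V}, forall j, f (x j) =
  (i == j)%:R.
  by exists f.
move=> i; pose W u := exists l : I -> k, l i = 0 /\ u = \sum_j l j *: x j.
have sW : subspace W.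
  split; first by exists (fun=> 0); split=> //; rewrite big1 // => j; rewrite scale0r.
  move=> a _ _ [l [li ->]] [m [mi ->]]; exists (fun j => a * l j + m j).
  rewrite li mi mulr0 addr0; split=> //.
  rewrite scaler_sumr -big_split; apply: eq_bigr => j _ /=.
  by rewrite scalerDl scalerA.
have nW : ~ W (x i).
  move=> [l [li E]]; have := ind (fun j => l j - (j == i)%:R) _ i.
  rewrite li eqxx sub0r => H; have /eqP : - 1 = 0 :> k.
    apply: H; under eq_bigr do rewrite scalerBl.
    rewrite sumrB -E (bigD1 i) //= eqxx scale1r big1 ?addr0 ?subrr // => j /negPf->.
    by rewrite scale0r.
  by rewrite oppr_eq0 oner_eq0.
have [f [f1 fW]] := separating_functional sW nW.
exists f => j; have [<-//|ij] := eqVneq i j; apply: fW.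
exists (fun s => (s == j)%:R); rewrite (negPf ij); split=> //.
rewrite (bigD1 j) //= eqxx scale1r big1 ?addr0 // => s /negPf->.
by rewrite scale0r.
Qed.
End Functionals.

(** * Sweedler sums and matrix coefficients *)

(** Linearity as a predicate on bare functions: the maps below are built from
    \tsum_ and Sweedler sums, and bundling each of them would get in the way of
    rewriting. *)
Definition lin (k : fieldType) (V W : lmodType k) (f : V -> W) : Prop :=
  forall a x y, f (a *: x + y) = a *: f x + f y.

Section Lin.
Variables (k : fieldType).
Implicit Types (U V W : lmodType k).

Lemma lin_id V : lin (fun x : V => x). Proof. by []. Qed.
Lemma lin_comp U V W (f : V -> W) (g : U -> V) :
  lin f -> lin g -> lin (fun x => f (g x)).
Proof. by move=> lf lg a x y; rewrite lg lf. Qed.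
Lemma lin_scaler U V c (f : U -> V) : lin f -> lin (fun x => c *: f x).
Proof. by move=> lf a x y; rewrite lf scalerDr !scalerA mulrC. Qed.
Lemma lin_scalel U V (f : U -> k^o) (v : V) :
  lin f -> lin (fun x => (f x : k) *: v).
Proof. by move=> lf a x y; rewrite lf scalerDl scalerA. Qed.
Lemma lin_mull U (f : U -> k^o) (c : k) :
  lin f -> @lin _ U k^o (fun x => (f x : k) * c).
Proof. by move=> lf a x y; rewrite lf mulrDl; congr (_ + _); exact:
  (esym (mulrA _ _ _)). Qed.
Lemma lin_mulr U (f : U -> k^o) (c : k) :
  lin f -> @lin _ U k^o (fun x => c * (f x : k)).
Proof. by move=> lf a x y; rewrite lf mulrDr; congr (_ + _); exact: mulrCA. Qed.
Lemma lin_sum U V (I : Type) (r : seq I) (P : pred I) (f : I -> U -> V) :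
  (forall i, lin (f i)) -> lin (fun x => \sum_(i <- r | P i) f i x).
Proof.
move=> lf a x y; rewrite scaler_sumr -big_split; apply: eq_bigr => i _.
exact: lf.
Qed.
Lemma lin_linear U V (f : {linear U -> V}) : lin f.
Proof. exact: linearP. Qed.
Lemma lin_scalar U (f : {scalar U}) : @lin _ U k^o f.
Proof. exact: linearP. Qed.
Lemma lin_lcomp U V W (f : {linear V -> W}) (g : U -> V) :
  lin g -> lin (fun x => f (g x)).
Proof. by apply: lin_comp; apply: lin_linear. Qed.
Lemma lin_scomp U V (f : {scalar V}) (g : U -> V) :
  lin g -> @lin _ U k^o (fun x => f (g x)).
Proof. by apply: (@lin_comp _ _ k^o); apply: lin_scalar. Qed.
Lemma lin_compk U V (f : V -> k) (g : U -> V) :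
  @lin _ V k^o f -> lin g -> @lin _ U k^o (fun x => f (g x)).
Proof. exact: (@lin_comp U V k^o). Qed.
Lemma lin_otimesl U V W (f : U -> V) (w : W) : lin f -> lin (fun u => f u \ox w).
Proof. by move=> lf; apply: (lin_comp (f := fun v => v \ox w)) lf; apply:
  (otimes_bilin V W).1. Qed.
Lemma lin_otimesr U V W (f : U -> W) (v : V) : lin f -> lin (fun u => v \ox f u).
Proof. by move=> lf; apply: (lin_comp (f := fun w => v \ox w)) lf; apply:
  (otimes_bilin V W).2. Qed.
Lemma lin_tliftc (T : lmodType k) V W U (F : V -> W -> U) (g : T -> V \ox W) :
  bilin F -> lin g -> lin (fun x : T => tlift F (g x)).
Proof. by move=> bF; apply: lin_comp; apply: tlift_linear. Qed.
Lemma lin_tlift V W U (F : V -> W -> U) : bilin F -> lin (tlift F).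
Proof. exact: tlift_linear. Qed.
Lemma lin_tliftF (T : lmodType k) V W U (F : T -> V -> W -> U) (t : V \ox W) :
  (forall v w, lin (fun x : T => F x v w)) -> lin (fun x => tlift (F x) t).
Proof. by move=> lF; apply: lin_sum => p; apply: lF. Qed.
Lemma lin0 U V (f : U -> V) : lin f -> f 0 = 0.
Proof. by move=> lf; have := lf (-1) 0 0; rewrite scaler0 addr0 scaleN1r addNr. Qed.
Lemma linD U V (f : U -> V) x y : lin f -> f (x + y) = f x + f y.
Proof. by move=> lf; have := lf 1 x y; rewrite !scale1r. Qed.
Lemma linZ U V (f : U -> V) c x : lin f -> f (c *: x) = c *: f x.
Proof. by move=> lf; have := lf c x 0; rewrite !addr0 (lin0 lf) addr0. Qed.
Lemma lin_bigsum U V (f : U -> V) I r (P : pred I) (t : I -> U) : lin f ->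
  f (\sum_(i <- r | P i) t i) = \sum_(i <- r | P i) f (t i).
Proof.
move=> lf; elim/big_rec2: _ => [|i x y _ <-]; first exact: lin0.
exact: linD.
Qed.
Lemma tlift_sum V W U (F : V -> W -> U) I r (P : pred I) (t : I -> V \ox W) :
  bilin F -> tlift F (\sum_(i <- r | P i) t i) = \sum_(i <- r | P i) tlift F (t i).
Proof. by move=> bF; apply: lin_bigsum; apply: lin_tlift. Qed.
Lemma lin_tmap V W V' W' (f : V -> V') (g : W -> W') :
  lin f -> lin g -> lin (tmap f g).
Proof.
move=> lf lg; apply: lin_tlift; split=> ?.
  by apply: lin_otimesl.
by apply: lin_otimesr.
Qed.
Lemma tmapE V W V' W' (f : V -> V') (g : W -> W') v w :
  lin f -> lin g -> tmap f g (v \ox w) = f v \ox g w.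
Proof.
move=> lf lg; apply: tliftE; split=> ?.
  by apply: lin_otimesl.
by apply: lin_otimesr.
Qed.
End Lin.

Create HintDb lins.
#[export] Hint Resolve lin_linear lin_scalar : lins.
(** Linearity of an expression in a variable, by recursion on its syntax; a
    function of two arguments is treated through hints for each of them. *)
Ltac lin :=
  cbv beta;
  lazymatch goal with
  | |- bilin _ => split=> ?; lin
  | |- GRing.linear_for _ ?f => change (lin f); lin
  | |- lin (fun x => x) => apply: lin_id
  | |- lin (tmap _ _) => apply: lin_tmap; lin
  | |- lin (otimes _) => apply: lin_otimesr; apply: lin_id
  | |- lin (fun x => @?A x *: @?B x) =>
      lazymatch A with
      | (fun _ => ?a) => apply: lin_scaler; lin
      | _ => apply: lin_scalel; lin
      end
  | |- lin (fun x => @?A x * @?B x) =>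
      lazymatch A with
      | (fun _ => ?a) => apply: lin_mulr; lin
      | _ => apply: lin_mull; lin
      end
  | |- lin (fun x => otimes (@?A x) (@?B x)) =>
      lazymatch A with
      | (fun _ => ?a) => apply: lin_otimesr; lin
      | _ => apply: lin_otimesl; lin
      end
  | |- lin (fun x => \sum_(i <- _ | _) _) => apply: lin_sum => ?; lin
  | |- lin (fun x => tlift (@?F x) (@?t x)) =>
      lazymatch t with
      | (fun _ => ?a) => apply: lin_tliftF => ? ?; lin
      | _ => apply: lin_tliftc; lin
      end
  | |- lin (fun x => @GRing.Linear.sort _ _ _ _ _ (@?E x)) =>
      first [apply: lin_lcomp | apply: lin_scomp]; lin
  | |- lin (fun x => ?f (@?E x)) =>
      lazymatch E with
      | (fun x => x) => first [assumption | solve [eauto with lins]]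
      | (fun _ => ?b) =>
          lazymatch goal with
          | |- lin (fun x => ?g (@?H x) _) => lin2nd g H b
          end
      | _ => first [apply: (@lin_compk _ _ _ f E) | apply: (@lin_comp _ _ _ _ f E)]; lin
      end
  | |- lin _ => first [assumption | solve [eauto with lins]]
  end
with lin2nd g H b :=
  lazymatch H with
  | (fun x => x) => solve [eauto with lins]
  | _ => first [apply: (@lin_compk _ _ _ (fun z => g z b) H)
               | apply: (@lin_comp _ _ _ _ (fun z => g z b) H)];
      [solve [eauto with lins] | lin]
  end.

Section SweedlerLin.
Variables (k : fieldType) (C : coalgebra k).

(** [nlin] is linearity in one argument with the [n] legs left arbitrary;
    [mlin], linearity in each leg, is what makes a Sweedler sum meaningful. *)
Fixpoint nlin (V U : lmodType k) n : (V -> nfun C n U) -> Prop :=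
  if n is m.+1 then fun F => forall y, @nlin V U m (fun x => F x y)
  else fun F => lin F.
Fixpoint mlin (U : lmodType k) n : nfun C n U -> Prop :=
  if n is m.+1 then fun F => @nlin C U m F /\ forall x, @mlin U m (F x)
  else fun _ => True.

Lemma lin_sweedlerF (V U : lmodType k) n (F : V -> nfun C n.+1 U) :
  @nlin V U n.+1 F -> forall a, lin (fun x => @sweedler k C U n a (F x)).
Proof.
elim: n F => [|n IH] F lF a /=; first exact: lF.
by apply: lin_tliftF => v w; apply: (IH (fun x => F x v)) => y; apply: lF.
Qed.
Lemma lin_sweedler (U : lmodType k) n (F : nfun C n.+1 U) :
  mlin F -> lin (fun a => @sweedler k C U n a F).
Proof.
elim: n F => [|n IH] F [lF mF] /=; first exact: lF.
apply: lin_tliftc; last by lin.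
split=> [w|v]; first exact: lin_sweedlerF.
exact: IH.
Qed.

(** The coefficient matrices of comodules: for a comodule with a basis, these
    are the coaction axioms in coordinates. *)
Definition multmat (I : finType) (c : I -> I -> C) : Prop :=
  (forall i j, Delta C (c i j) = \sum_s c i s \ox c s j) /\
  (forall i j, counit C (c i j) = (i == j)%:R).

Fixpoint paths (I : finType) (c : I -> I -> C) (U : zmodType) n (i j : I) :
    nfun C n.+1 U -> U :=
  if n is m.+1 then fun F => \sum_s @paths I c U m s j (F (c i s))
  else fun F => F (c i j).

(** The iterated coproduct of a matrix coefficient runs over the paths from [i]
    to [j], one leg for each step. All identities between Sweedler sums below
    are proved on this side. *)
Lemma sweedler_paths (I : finType) (c : I -> I -> C) (U : lmodType k) n i j
    (F : nfun C n.+1 U) : multmat c -> mlin F ->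
  @sweedler k C U n (c i j) F = paths c i j F.
Proof.
move=> [mc _]; elim: n i j F => [|n IH] i j F [lF mF] //=.
rewrite mc tlift_sum; last first.
  split=> [w|v]; first exact: lin_sweedlerF.
  exact: lin_sweedler.
apply: eq_bigr => s _; rewrite tliftE ?IH //.
split=> [w|v]; first exact: lin_sweedlerF.
exact: lin_sweedler.
Qed.
Lemma sweedler_pathsk (I : finType) (c : I -> I -> C) n i j
    (F : nfun C n.+1 k) : multmat c -> @mlin k^o n.+1 F ->
  @sweedler k C k n (c i j) F = paths c i j F.
Proof. exact: (@sweedler_paths I c k^o). Qed.
End SweedlerLin.

Section Comodule.
Variables (k : fieldType) (A : dualQuasiHopf k).

Record mbasis (M : precomodule A) (I : finType) (c : I -> I -> A) (e : I -> M) :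
  Prop := MBasis {
  mb_mult : multmat c;
  mb_coact : forall j, coact (e j) = \sum_i e i \ox c i j }.

(** The families [e] only span: the image of a family with a coefficient matrix
    under a morphism again has that matrix, although it may fail to be
    independent. *)
Definition localfin (M : precomodule A) : Prop :=
  lin (@coact _ _ M) /\ forall m : M, exists (I : finType) (c : I -> I -> A)
    (e : I -> M)
    (l : I -> k), mbasis c e /\ m = \sum_i l i *: e i.

Lemma localfin_comodule M : localfin M -> is_comodule M.
Proof.
move=> [lM sM]; split=> // m; have [I [c [e [l [[[Dc ec] ce] ->]]]]] := sM m.
- have l1 : lin (fun x : M => \tsum_(m0, m1 <- coact x) m0 \ox Delta A m1).
    apply: lin_tliftc => //; lin.
  have l2 : lin (fun x : M => \tsum_(m0, m1 <- coact x)
      \tsum_(n0, n1 <- coact m0) n0 \ox (n1 \ox m1)).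
    apply: lin_tliftc => //; split=> [w|v]; last by lin.
    by apply: lin_tliftc => //; lin.
  rewrite (lin_bigsum _ _ _ l1) (lin_bigsum _ _ _ l2); apply: eq_bigr => i _.
  rewrite (linZ _ _ l1) (linZ _ _ l2); congr (_ *: _).
  have b1 : bilin (fun (m0 : M) (m1 : A) => m0 \ox Delta A m1) by lin.
  have b2 : bilin (fun (m0 : M) (m1 : A) =>
      \tsum_(n0, n1 <- coact m0) n0 \ox (n1 \ox m1)).
    by split=> [w|v]; [apply: lin_tliftc => //; lin|lin].
  rewrite ce !tlift_sum //.
  transitivity (\sum_s \sum_t e t \ox (c t s \ox c s i)); last first.
    apply: eq_bigr => s _; rewrite tliftE // ce tlift_sum; last by lin.
    by apply: eq_bigr => t _; rewrite tliftE //; lin.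
  rewrite exchange_big; apply: eq_bigr => s _.
  by rewrite tliftE // Dc (lin_bigsum (f := otimes (e s))) //; lin.
have l1 : lin (fun x : M => \tsum_(m0, m1 <- coact x) counit A m1 *: m0).
  by apply: lin_tliftc => //; lin.
rewrite (lin_bigsum _ _ _ l1); apply: eq_bigr => i _.
have b1 : bilin (fun (m0 : M) m1 => counit A m1 *: m0) by lin.
rewrite (linZ _ _ l1) ce (tlift_sum _ _ _ b1); congr (_ *: _).
under eq_bigr => s _ do rewrite (tliftE b1) ec.
rewrite (bigD1 i) //= eqxx scale1r big1 ?addr0 // => j /negPf->.
by rewrite scale0r.
Qed.
End Comodule.

Section ShortTensor.
Variables (k : fieldType) (V W : lmodType k).

Lemma tensor_expr (t : V \ox W) :
  exists n (x : 'I_n -> V) (y : 'I_n -> W), t = \sum_s x s \ox y s.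
Proof.
rewrite -[t]reprK tens_pi_sum; set r := repr t; clearbody r.
exists (size r), (fun s => (tnth (in_tuple r) s).1), (fun s => (tnth (in_tuple r) s).2).
by rewrite big_tnth.
Qed.

Lemma dependent_elim (U : lmodType k) n (y : 'I_n.+1 -> U) : ~ independent y ->
  exists t (l : 'I_n -> k), y t = \sum_s l s *: y (lift t s).
Proof.
move=> /existsNP[l /not_implyP[E /existsNP[t /eqP lt]]].
exists t, (fun s => - (l t)^-1 * l (lift t s)).
move: E; rewrite (bigD1_ord t) //= => /eqP; rewrite addr_eq0 => /eqP E.
rewrite -[y t]scale1r -(mulVf lt) -scalerA E scalerN -scaleNr scaler_sumr.
by apply: eq_bigr => s _; rewrite scalerA.
Qed.

(** In an expression with the least number of terms both families are
    independent, as a relation would let one term be absorbed into the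
    others. *)
Lemma short_tensor (t : V \ox W) :
  exists n (x : 'I_n -> V) (y : 'I_n -> W),
    [/\ t = \sum_s x s \ox y s, independent x & independent y].
Proof.
pose P n := exists (x : 'I_n -> V) (y : 'I_n -> W), t = \sum_s x s \ox y s.
have exP : exists n, `[< P n >].
  by have [n [x [y E]]] := tensor_expr t; exists n; apply/asboolP; exists x, y.
case: (ex_minnP exP) => n /asboolP[x [y E]] minn {exP}.
have {}minn m : n = m.+1 -> ~ P m.
  by move=> nm /asboolP /minn; rewrite nm ltnn.
exists n, x, y; split=> //; apply: contrapT => nind.
- case: n x y E minn nind => [|n] x y E minn nind.
    by apply: nind => l _ [].
  have [s0 [l El]] := dependent_elim nind; apply: (minn n) => //.
  exists (fun s => x (lift s0 s)), (fun s => y (lift s0 s) + l s *: y s0).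
  rewrite E (bigD1_ord s0) //= El.
  rewrite (lin_bigsum (f := fun v => v \ox y s0)); last by lin.
  rewrite addrC -big_split; apply: eq_bigr => s _ /=.
  rewrite (linD (f := otimes _)); last by lin.
  congr (_ + _); rewrite (linZ (f := otimes _)); last by lin.
  by rewrite (linZ (f := fun v => v \ox y s0)) //; lin.
case: n x y E minn nind => [|n] x y E minn nind.
  by apply: nind => l _ [].
have [s0 [l El]] := dependent_elim nind; apply: (minn n) => //.
exists (fun s => x (lift s0 s) + l s *: x s0), (fun s => y (lift s0 s)).
rewrite E (bigD1_ord s0) //= El.
rewrite (lin_bigsum (f := otimes (x s0))); last by lin.
rewrite addrC -big_split; apply: eq_bigr => s _ /=.
rewrite (linD (f := fun v => v \ox y (lift s0 s))); last by lin.
congr (_ + _); rewrite (linZ (f := otimes _)); last by lin.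
by rewrite (linZ (f := fun v => v \ox y (lift s0 s))) //; lin.
Qed.
End ShortTensor.

Section LocalFin.
Variables (k : fieldType) (A : dualQuasiHopf k).

(** Take a shortest expression [sum_s x_s (x) a_s] of the coaction of [m].
    Pairing coassociativity with functionals dual to the a_s shows that the x_s
    span a subcomodule, and pairing with functionals dual to the x_s that its
    coefficient matrix is multiplicative; the counit axiom puts [m] in the
    span. *)
Lemma comodule_localfin (M : precomodule A) : is_comodule M -> localfin M.
Proof.
move=> [lM caM cuM]; split=> // m.
have [n [x [a [E ix ia]]]] := short_tensor (coact m).
have [fx fxE] := dual_functionals ix; have [fa faE] := dual_functionals ia.
(* The coefficient c_st is the coproduct of a_s with the functional dual to a_t
   applied on the right. *)
pose g (f : {scalar A}) (w : A \ox A) : A := \tsum_(p, q <- w) f q *: p.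
have bg (f : {scalar A}) : bilin (fun p q : A => f q *: p) by lin.
have lg f : lin (g f) by apply: lin_tlift.
pose c s t := g (fa t) (Delta A (a s)).
pose G f (w : M \ox (A \ox A)) := \tsum_(m0, v <- w) m0 \ox g f v.
have bG f : bilin (fun (m0 : M) (v : A \ox A) => m0 \ox g f v).
  split=> [w|v]; first by lin.
  by apply: (lin_comp (f := otimes v)) => //; lin.
have lG f : lin (G f) by apply: lin_tlift.
have bR : bilin (fun (m0 : M) (m1 : A) => \tsum_(n0, n1 <- coact m0) n0 \ox
  (n1 \ox m1)).
  by split=> [w|v]; [apply: lin_tliftc => //; lin|lin].
have bL : bilin (fun (m0 : M) m1 => m0 \ox Delta A m1) by lin.
have bt (w : A) : bilin (fun (n0 : M) (n1 : A) => n0 \ox (n1 \ox w)) by lin.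
have cx t : coact (x t) = \sum_s x s \ox c s t.
  have := congr1 (G (fa t)) (caM m); rewrite E !tlift_sum //.
  rewrite !(lin_bigsum _ _ _ (lG _)).
  under eq_bigr => s _ do rewrite (tliftE bL) /G (tliftE (bG _)) -/(c s t).
  move=> ->; rewrite (bigD1 t) //= [X in _ + X]big1 ?addr0.
    rewrite (tliftE bR); have [l [u [v [Ex _ _]]]] := short_tensor (coact (x t)).
    rewrite Ex tlift_sum // (lin_bigsum _ _ _ (lG _)); apply: eq_bigr => s _.
    by rewrite (tliftE (bt _)) /G (tliftE (bG _)) /g (tliftE (bg _)) faE eqxx scale1r.
  move=> s st; rewrite (tliftE bR); have [l [u [v [Ex _ _]]]] := short_tensor
    (coact (x s)).
  rewrite Ex tlift_sum // (lin_bigsum _ _ _ (lG _)) big1 // => r _.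
  rewrite (tliftE (bt _)) /G (tliftE (bG _)) /g (tliftE (bg _)) faE eq_sym (negPf st).
  by rewrite scale0r (lin0 (f := otimes (u r))) //; lin.
have bc : bilin (fun (m0 : M) m1 => counit A m1 *: m0) by lin.
exists 'I_n, c, x, (fun s => counit A (a s)); split; last first.
  rewrite -[LHS]cuM E tlift_sum //; apply: eq_bigr => s _.
  by rewrite (tliftE bc).
split=> //; split=> s t.
  pose H (w : M \ox (A \ox A)) := \tsum_(m0, v <- w) fx s m0 *: v.
  have bH : bilin (fun (m0 : M) (v : A \ox A) => fx s m0 *: v) by lin.
  have lH : lin H by apply: lin_tlift.
  have HE m0 v : H (m0 \ox v) = fx s m0 *: v by apply: tliftE.
  have := congr1 H (caM (x t)); rewrite cx !tlift_sum // !(lin_bigsum _ _ _ lH).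
  rewrite (bigD1 s) //= (tliftE bL) HE fxE eqxx scale1r big1 ?addr0; last first.
    by move=> r /negPf rs; rewrite (tliftE bL) HE fxE eq_sym rs scale0r.
  move=> ->; apply: eq_bigr => r _; rewrite (tliftE bR) cx tlift_sum //.
  rewrite (lin_bigsum _ _ _ lH) (bigD1 s) //= (tliftE (bt _)) HE fxE eqxx.
  rewrite scale1r big1 ?addr0 // => q /negPf qs.
  by rewrite (tliftE (bt _)) HE fxE eq_sym qs scale0r.
have := congr1 (fx s) (cuM (x t)); rewrite cx tlift_sum // fxE => <-.
rewrite [RHS]linear_sum [RHS](bigD1 s) //= (tliftE bc) (linZ _ _ (lin_scalar (fx s)))
  fxE.
rewrite eqxx big1 ?addr0 => [|q /negPf qs]; first by rewrite [_ *: _]mulr1.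
rewrite (tliftE bc) (linZ _ _ (lin_scalar (fx s))) fxE eq_sym qs.
by rewrite [_ *: _]mulr0.
Qed.
End LocalFin.

(** * The axioms of a dual quasi-Hopf algebra on matrix coefficients *)

Ltac nlin_red :=
  lazymatch goal with
  | |- @nlin ?k ?C ?V ?U ?n ?F =>
      let m := eval compute in n in change (@nlin k C V U m F); cbn [nlin]
  end.
Ltac intros_lin := repeat (lazymatch goal with |- lin _ => fail | _ => intro end).
Ltac lin2 :=
  cbv beta;
  lazymatch goal with
  | |- lin (fun x => @sweedler _ _ _ _ _ _) =>
      apply: lin_sweedlerF; nlin_red; intros_lin; lin2
  | _ => lin
  end.
Ltac mlin :=
  lazymatch goal with
  | |- @mlin ?k ?C ?U ?n ?F =>
      let m := eval compute in n in
      lazymatch m with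
      | O => exact I
      | _ => change (@mlin k C U m F); split; [nlin_red; intros_lin; lin2 | intro; mlin]
      end
  end.
Ltac expand1 := (rewrite sweedler_paths || rewrite sweedler_pathsk);
  [cbn [paths]; try by [] | by [] | mlin].

Ltac expand_all := repeat first [progress expand1 | apply: eq_bigr => ? _].

Section Sums.
Variable R : nmodType.
Lemma sum_pair (I J : finType) (F : I * J -> R) :
  \sum_p F p = \sum_i \sum_j F (i, j).
Proof. by rewrite pair_bigA; apply: eq_bigr => -[]. Qed.
End Sums.

Section Scal.
Variables (k : fieldType) (R : lmodType k).
Lemma delta_sum (I : finType) (j : I) (F : I -> R) :
  \sum_i (i == j)%:R *: F i = F j.
Proof.
rewrite (bigD1 j) //= eqxx scale1r big1 ?addr0 // => i /negPf->.
by rewrite scale0r.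
Qed.
Lemma delta_sum' (I : finType) (j : I) (F : I -> R) :
  \sum_i (j == i)%:R *: F i = F j.
Proof. by under eq_bigr => i _ do rewrite eq_sym; exact: delta_sum. Qed.
(** A linear map applied to a sum over [X], when its values on the terms are
    sums over [Y]. Iterating this computes a composite of structural morphisms
    on a basis as one sum over a product of index types. *)
Lemma push (W : lmodType k) (f : R -> W) (X Y : finType) (a : X -> k) (t : X -> R)
    (b : X -> Y -> k) (u : X -> Y -> W) : lin f ->
  (forall x, f (t x) = \sum_y b x y *: u x y) ->
  f (\sum_x a x *: t x) = \sum_(p : X * Y) (a p.1 * b p.1 p.2) *: u p.1 p.2.
Proof.
move=> lf E; rewrite (lin_bigsum _ _ _ lf) sum_pair; apply: eq_bigr => x _.
rewrite (linZ _ _ lf) E scaler_sumr; apply: eq_bigr => y _; exact: scalerA.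
Qed.
End Scal.

Section MatrixAxioms.
Variables (k : fieldType) (A : dualQuasiHopf k).
Local Notation Phi a b c := (dqh_phi A (a \ox b \ox c)).
Local Notation PhiV a b c := (dqh_phiV A (a \ox b \ox c)).
Local Notation oA := (dqh_one A).
Let HA := dqh_bialg (dqh_axioms A).

Definition mprod (I J : Type) (c : I -> I -> A) (d : J -> J -> A) (p q : I * J) : A :=
  c p.1 q.1 ** d p.2 q.2.
(** The coefficients of the dual comodule in the dual basis; the transposition
    matches the reversal of coproducts by the antipode. *)
Definition mdual (I : Type) (c : I -> I -> A) (i j : I) : A := dqh_S A (c j i).
Definition mone (i j : unit) : A := oA.
(** The coefficients of a direct sum. *)
Definition mplus (I J : Type) (c : I -> I -> A) (d : J -> J -> A) (p q : I + J) : A :=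
  match p, q with inl i, inl j => c i j | inr i, inr j => d i j | _, _ => 0 end.

Section One.
Variables (I J : finType) (c : I -> I -> A) (d : J -> J -> A).
Hypotheses (mc : multmat c) (md : multmat d).

Lemma multmat_prod : multmat (mprod c d).
Proof.
split=> -[i j] [i' j'] /=.
  rewrite (dqb_mul_Delta HA); expand1; rewrite sum_pair; apply: eq_bigr => s _; expand1.
rewrite /mprod (dqb_mul_counit HA) mc.2 md.2 -natrM mulnb //.
Qed.

Lemma multmat_dual : multmat (mdual c).
Proof.
split=> i j; last by rewrite (dqh_S_counit (dqh_axioms A)) mc.2 eq_sym.
rewrite (dqh_S_Delta (dqh_axioms A)); expand1.
Qed.

Lemma multmat_one : multmat mone.
Proof.
split=> -[] []; last exact: (dqb_one_counit HA).
by rewrite (dqb_one_Delta HA) (bigD1 tt) //= big1 ?addr0 // => -[].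
Qed.

Lemma multmat_plus : multmat (mplus c d).
Proof.
have z1 (a : A) : 0 \ox a = 0 :> A \ox A by apply: (lin0 (f := fun x => x \ox a)); lin.
have z2 (a : A) : a \ox 0 = 0 :> A \ox A by apply: (lin0 (f := otimes a)); lin.
split=> -[i|i] [j|j] /=; rewrite ?mc.1 ?md.1 ?mc.2 ?md.2 ?linear0 // big_sumType /=.
- by rewrite [X in _ + X]big1 ?addr0 // => s _; rewrite z1.
- by rewrite !big1 ?addr0 // => s _; rewrite ?z1 ?z2.
- by rewrite !big1 ?addr0 // => s _; rewrite ?z1 ?z2.
- by rewrite [X in X + _]big1 ?add0r // => s _; rewrite z2.
Qed.
End One.

Section Three.
Variables (I J L T : finType).
Variables (c : I -> I -> A) (d : J -> J -> A) (h : L -> L -> A) (g : T -> T -> A).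
Hypotheses (mc : multmat c) (md : multmat d) (mh : multmat h)
  (mg : multmat g).

Lemma phi_r i j l i' j' l' :
  \sum_s \sum_t \sum_u Phi (c i s) (d j t) (h l u) * PhiV (c s i') (d t j') (h u l')
  = (i == i')%:R * (j == j')%:R * (l == l')%:R.
Proof.
have := dqb_phiV_r HA (c i i') (d j j') (h l l').
rewrite mc.2 md.2 mh.2 => <-.
expand1; apply: eq_bigr => s _; expand1; apply: eq_bigr => t _; expand1.
Qed.
Lemma phi_l i j l i' j' l' :
  \sum_s \sum_t \sum_u PhiV (c i s) (d j t) (h l u) * Phi (c s i') (d t j') (h u l')
  = (i == i')%:R * (j == j')%:R * (l == l')%:R.
Proof.
have := dqb_phiV_l HA (c i i') (d j j') (h l l').
rewrite mc.2 md.2 mh.2 => <-.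
expand1; apply: eq_bigr => s _; expand1; apply: eq_bigr => t _; expand1.
Qed.
Lemma assoc_mat i j l i' j' l' :
  \sum_s \sum_t \sum_u Phi (c s i') (d t j') (h u l') *: (c i s ** (d j t ** h l u))
  = \sum_s \sum_t \sum_u Phi (c i s) (d j t) (h l u) *: (c s i' ** d t j' ** h u l').
Proof.
have := dqb_assoc HA (c i i') (d j j') (h l l').
by move=> E; etransitivity; [etransitivity; [|exact: E]|]; [symmetry|]; expand_all.
Qed.
Lemma cocycle_mat i j l r i' j' l' r' :
  \sum_i1 \sum_j1 \sum_l1 \sum_r1
    Phi (c i i1) (d j j1) (h l l1 ** g r r1) * Phi (c i1 i' ** d j1 j') (h l1 l')
      (g r1 r')
  = \sum_i1 \sum_j1 \sum_j2 \sum_l1 \sum_l2 \sum_r1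
    Phi (d j j1) (h l l1) (g r r1) * Phi (c i i1) (d j1 j2 ** h l1 l2) (g r1 r')
    * Phi (c i1 i') (d j2 j') (h l2 l').
Proof.
have := dqb_cocycle HA (c i i') (d j j') (h l l') (g r r').
by move=> E; etransitivity; [etransitivity; [|exact: E]|]; [symmetry|]; expand_all.
Qed.
End Three.
End MatrixAxioms.

(** * Rearranging finite sums; the reassociator at the unit *)

Section SumTools.
Variable R : nmodType.
Lemma sum_pairA (I J L : finType) (F : I * (J * L) -> R) :
  \sum_p F p = \sum_(p : I * J * L) F (p.1.1, (p.1.2, p.2)).
Proof.
rewrite !sum_pair; apply: eq_bigr => i _; exact: sum_pair.
Qed.
Lemma sum_unit (F : unit -> R) : \sum_u F u = F tt.
Proof. by rewrite (bigD1 tt) //= big1 ?addr0 // => -[]. Qed.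
End SumTools.
Lemma eq_sum (R : nmodType) (I : finType) (F G : I -> R) :
  (forall i, F i = G i) -> \sum_i F i = \sum_i G i.
Proof. by move=> E; apply: eq_bigr. Qed.
(** Turn a sum over a nested product type into nested sums over its factors. *)
Ltac flatten := first
  [refine (etrans (sum_pairA _) _); cbn [fst snd]; flatten
  | refine (etrans (sum_pair _) _); cbn [fst snd]; flatten | reflexivity].
Ltac flatten_both := etransitivity; [flatten|]; symmetry; etransitivity; [flatten|];
  symmetry.
Ltac distr_scale := first [refine (etrans (scaler_suml _ _ _ _) _);
    refine (etrans (eq_sum _) _); [intro; distr_scale|reflexivity] | reflexivity].
Ltac distr_mul := first [refine (etrans (mulr_suml _ _ _ _) _);
    refine (etrans (eq_sum _) _); [intro; distr_mul|reflexivity] | reflexivity].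
Lemma exchange_sum (R : nmodType) (I J : finType) (F : I -> J -> R) :
  \sum_i \sum_j F i j = \sum_j \sum_i F i j.
Proof. exact: exchange_big. Qed.
(** Exchange sums so that the one at depth [n] comes first. *)
Ltac bring n :=
  lazymatch n with
  | O => reflexivity
  | S ?m => etransitivity; [refine (eq_sum _); intro; bring m | refine (exchange_sum _)]
  end.
Ltac sweedler_expand := first
  [ (rewrite sweedler_pathsk || rewrite sweedler_paths);
    [cbn [paths Nat.pred]; sweedler_expand | by [] | mlin]
  | refine (eq_sum _); intro; sweedler_expand | reflexivity ].
(** Two nested sums over the same index types in different orders are matched
    one index at a time: bring the one at depth [n] on the left and the one at
    depth [m] on the right to the front, and identify them. *)
Tactic Notation "pull" constr(n) constr(m) "as" ident(x) :=
  etransitivity; [bring n|]; symmetry; etransitivity; [bring m|]; symmetry;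
  refine (eq_sum _); intro x; cbv beta.
Ltac pull_list l :=
  lazymatch l with
  | (?n, ?m) :: ?t => let x := fresh "z" in pull n m as x; pull_list t
  | _ => idtac
  end.
Tactic Notation "pulls" constr(l) := pull_list l.
Section Kron.
Variables (R : pzRingType).
Lemma kron (I : finType) (i : I) (F : I -> R) : \sum_s (s == i)%:R * F s = F i.
Proof.
rewrite (bigD1 i) //= eqxx mul1r big1 ?addr0 // => s /negPf->; exact: mul0r.
Qed.
Lemma kron' (I : finType) (i : I) (F : I -> R) : \sum_s (i == s)%:R * F s = F i.
Proof. by under eq_bigr => s _ do rewrite eq_sym; exact: kron. Qed.
Lemma kron2 (I J : finType) i j (F : I -> J -> R) :
  \sum_s \sum_t (i == s)%:R * (j == t)%:R * F s t = F i j.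
Proof.
rewrite -[RHS](kron' i (fun s => F s j)); apply: eq_bigr => s _.
rewrite -(kron' j) mulr_sumr; apply: eq_bigr => t _; exact/esym/mulrA.
Qed.
End Kron.

Section MatUnit.
Variables (k : fieldType) (A : dualQuasiHopf k).
Local Notation Phi a b c := (dqh_phi A (a \ox b \ox c)).
Local Notation PhiV a b c := (dqh_phiV A (a \ox b \ox c)).
Local Notation oA := (dqh_one A).
Let HA := dqh_bialg (dqh_axioms A).
Variables (I J : finType) (c : I -> I -> A) (d : J -> J -> A).
Hypotheses (mc : multmat c) (md : multmat d).

(** This is how the cocycle identity determines the reassociator at the unit:
    there it says that a certain invertible matrix is idempotent. *)
Lemma mat_idem (T : finType) (X Y : T -> T -> k) :
  (forall i j, \sum_s X i s * Y s j = (i == j)%:R) ->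
  (forall i j, X i j = \sum_s X i s * X s j) -> forall i j, X i j = (i == j)%:R.
Proof.
move=> XY XX i j.
have E : \sum_t (\sum_s X i s * X s t) * Y t j = \sum_s X i s * (s == j)%:R.
  rewrite (eq_bigr (fun t => \sum_s X i s * X s t * Y t j)); last first.
    by move=> t _; rewrite mulr_suml.
  rewrite exchange_big; apply: eq_bigr => s _.
  by rewrite -XY mulr_sumr; apply: eq_bigr => t _; rewrite mulrA.
rewrite -XY; transitivity (\sum_s X i s * (s == j)%:R).
  rewrite (bigD1 j) //= eqxx mulr1 big1 ?addr0 // => s /negPf->.
  by rewrite mulr0.
by rewrite -E; apply: eq_bigr => t _; rewrite -XX.
Qed.

(** The cocycle identity at [1, 1, a, b] makes [Phi 1 a b] idempotent. *)
Lemma phi_1l i j i' j' : Phi oA (c i i') (d j j') = (i == i')%:R * (j == j')%:R.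
Proof.
pose X (p q : I * J) := Phi oA (c p.1 q.1) (d p.2 q.2).
pose Y (p q : I * J) := PhiV oA (c p.1 q.1) (d p.2 q.2).
have := @mat_idem _ X Y _ _ (i, j) (i', j'); rewrite /X /= xpair_eqE -natrM mulnb.
apply=> {i j i' j'} -[i j] [i' j'].
  have := phi_r (multmat_one A) mc md tt i j tt i' j'.
  rewrite sum_unit mul1r => E; rewrite sum_pair /X /Y /=.
  by rewrite xpair_eqE -mulnb natrM -E.
have := cocycle_mat (multmat_one A) (multmat_one A) mc md tt tt i j tt tt i' j'.
rewrite !sum_unit /mone /= => E.
have hP := dqb_phi1 HA; have h1 := dqb_one_counit HA.
move: E; under eq_bigr => i1 _ do (under eq_bigr => j1 _ do
  rewrite hP h1 mul1r (dqb_mul_counit HA) (dqb_mul1l HA) mc.2 md.2).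
rewrite kron2 => ->; rewrite sum_pair; apply: eq_bigr => s _.
rewrite exchange_big; apply: eq_bigr => t _ /=.
under eq_bigr => u _ do rewrite (dqb_mul1l HA) hP h1 mul1r mc.2 mulrC.
exact: kron.
Qed.

(** The cocycle identity at [a, b, 1, 1] makes [Phi a b 1] idempotent. *)
Lemma phi_1r i j i' j' : Phi (c i i') (d j j') oA = (i == i')%:R * (j == j')%:R.
Proof.
pose X (p q : I * J) := Phi (c p.1 q.1) (d p.2 q.2) oA.
pose Y (p q : I * J) := PhiV (c p.1 q.1) (d p.2 q.2) oA.
have := @mat_idem _ X Y _ _ (i, j) (i', j'); rewrite /X /= xpair_eqE -natrM mulnb.
apply=> {i j i' j'} -[i j] [i' j'].
  have E := phi_r mc md (multmat_one A) i j tt i' j' tt.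
  rewrite sum_pair xpair_eqE -mulnb natrM -[RHS]mulr1 -[RHS]E.
  by apply: eq_bigr => s _; apply: eq_bigr => t _; rewrite sum_unit.
have E := cocycle_mat mc md (multmat_one A) (multmat_one A) i j tt tt i' j' tt tt.
have hP := dqb_phi1 HA; have h1 := dqb_one_counit HA.
rewrite -[LHS](kron2 i' j' (fun s t => Phi (c i s) (d j t) oA)).
etransitivity; [etransitivity; [|exact: E]|].
  apply: eq_bigr => s _; apply: eq_bigr => t _.
  rewrite !sum_unit /mone /= hP (dqb_mul_counit HA) (dqb_mul1l HA) h1 !mulr1 mc.2 md.2.
  by rewrite mulrC ![_ == i' in RHS]eq_sym ![_ == j' in RHS]eq_sym.
rewrite sum_pair; apply: eq_bigr => s _ /=.
rewrite exchange_big; apply: eq_bigr => t _; under eq_bigr => u _ do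
  rewrite !sum_unit /mone /= hP h1 !mulr1 (dqb_mul1r HA) md.2 -mulrA.
by rewrite kron'.
Qed.
End MatUnit.

(** * Comodules and their tensor products *)

Section Cat.
Variables (k : fieldType) (A : dualQuasiHopf k).

(** Local finiteness is part of an object, so that identities of linear maps
    may be checked on families with a coefficient matrix. *)
Record comod := Comod { cm :> precomodule A; cmP : localfin cm }.
Lemma coact_lin (M : comod) : lin (@coact _ _ M).
Proof. exact: (cmP M).1. Qed.
Hint Resolve coact_lin : lins.

(** Direct sums of coefficient matrices take care of sums of vectors. *)
Lemma localfin_gen (M : precomodule A) (G : M -> Prop) :
  lin (@coact _ _ M) ->
  (forall m, G m -> exists (I : finType) (c : I -> I -> A) (e : I -> M) (j : I),
     mbasis c e /\ m = e j) ->
  (forall P : M -> Prop, P 0 -> (forall x y, P x -> P y -> P (x + y)) ->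
     (forall a x, P x -> P (a *: x)) -> (forall m, G m -> P m) -> forall m, P m) ->
  localfin M.
Proof.
move=> lM Gb ind; split=> //; apply: ind.
- exists void, (fun _ _ => 0), (fun=> 0), (fun=> 0); split; last by rewrite big1 // =>
  -[].
  by split=> [|[]]; split=> -[].
- move=> x y [I [c [e [l [[mc ce] ->]]]]] [J [d [f [r [[md df] ->]]]]].
  exists (I + J)%type, (mplus c d).
  exists (fun p => match p with inl i => e i | inr j => f j end).
  exists (fun p => match p with inl i => l i | inr j => r j end).
  split; last by rewrite big_sumType.
  split; first exact: multmat_plus.
  have z (m : M) : m \ox (0 : A) = 0 by apply: (lin0 (f := otimes m)); lin.
  case=> j /=; rewrite ?ce ?df big_sumType /=.
    by rewrite [X in _ + X]big1 ?addr0.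
  by rewrite [X in X + _]big1 ?add0r.
- move=> a x [I [c [e [l [b ->]]]]]; exists I, c, e, (fun i => a * l i); split=> //.
  by rewrite scaler_sumr; apply: eq_bigr => i _; rewrite scalerA.
move=> m /Gb[I [c [e [j [b ->]]]]]; exists I, c, e, (fun i => (i == j)%:R); split=> //.
by rewrite delta_sum.
Qed.

Lemma ext1 (M : comod) (W : lmodType k) (F G : M -> W) : lin F -> lin G ->
  (forall (I : finType) (c : I -> I -> A) (e : I -> M), mbasis c e ->
     forall j, F (e j) = G (e j)) -> forall m, F m = G m.
Proof.
move=> lF lG E m; have [I [c [e [l [b ->]]]]] := (cmP M).2 m.
rewrite !lin_bigsum //; apply: eq_bigr => i _.
by rewrite !linZ // (E _ _ _ b).
Qed.
Lemma extT (V V' W : lmodType k) (F G : V \ox V' -> W) : lin F -> lin G ->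
  (forall v v', F (v \ox v') = G (v \ox v')) -> forall t, F t = G t.
Proof.
move=> lF lG E; apply: tens_ind => [|x y Ex Ey|//]; first by rewrite !lin0.
by rewrite !linD // Ex Ey.
Qed.
Lemma ext2 (M N : comod) (W : lmodType k) (F G : M \ox N -> W) : lin F -> lin G ->
  (forall (I : finType) (c : I -> I -> A) (e : I -> M), mbasis c e ->
   forall (J : finType) (d : J -> J -> A) (f : J -> N), mbasis d f ->
     forall i j, F (e i \ox f j) = G (e i \ox f j)) -> forall m, F m = G m.
Proof.
move=> lF lG E; apply: extT => // v v'.
have l1 (H : M \ox N -> W) x : lin H -> lin (fun v => H (v \ox x)) by move=> lH; lin.
have l2 (H : M \ox N -> W) x : lin H -> lin (fun v => H (x \ox v)) by move=> lH; lin.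
move: v; apply: ext1; [exact: l1..|] => I c e be i.
move: v'; apply: ext1; [exact: l2..|] => J d f bf j.
exact: (E _ _ _ be _ _ _ bf).
Qed.

Lemma lin_ctcoact (M N : comod) : lin (@coact _ _ (com_tensor M N)).
Proof.
apply: lin_tlift; split=> [w|v]; last by lin.
apply: lin_tliftc; [split=> [?|?]; lin| exact: coact_lin].
Qed.
Lemma mbasis_tens (M N : comod) (I : finType) (c : I -> I -> A) (e : I -> M)
    (J : finType) (d : J -> J -> A) (f : J -> N) : mbasis c e -> mbasis d f ->
  @mbasis _ _ (com_tensor M N) _ (mprod c d) (fun p : I * J => e p.1 \ox f p.2).
Proof.
move=> [mc ce] [md df]; split=> [|[i j]]; first exact: multmat_prod.
rewrite /coact /= tliftE ?ce; last first.
  split=> [w|v]; last by lin.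
  by apply: lin_tliftc; [split=> [?|?]; lin| exact: coact_lin].
rewrite tlift_sum; last by split=> [?|?]; lin.
rewrite sum_pair; apply: eq_bigr => s _; rewrite tliftE ?df; last by split=> [?|?]; lin.
rewrite tlift_sum; last by split=> [?|?]; lin.
apply: eq_bigr => t _; rewrite tliftE //; by split=> [?|?]; lin.
Qed.

Lemma ten_localfin (M N : comod) : localfin (com_tensor M N).
Proof.
apply: (@localfin_gen (com_tensor M N) (fun t : M \ox N => exists (I : finType)
  (c : I -> I -> A) (e : I -> M)
  (J : finType) (d : J -> J -> A) (f : J -> N) i j,
  [/\ mbasis c e, mbasis d f & t = e i \ox f j])).
- exact: lin_ctcoact.
- move=> _ [I [c [e [J [d [f [i [j [be bf ->]]]]]]]]].
  by exists _, (mprod c d), (fun p : I * J => e p.1 \ox f p.2), (i, j); split=> //;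
    apply: mbasis_tens.
move=> P P0 PD PZ PG; apply: tens_ind => // v w.
have [I [c [e [l [be ->]]]]] := (cmP M).2 v.
have [J [d [f [r [bf ->]]]]] := (cmP N).2 w.
rewrite (lin_bigsum (f := fun x => x \ox _)); last by lin.
elim/big_ind: _ => // i _.
rewrite (linZ (f := fun x => x \ox _)); last by lin.
apply: (PZ); rewrite (lin_bigsum (f := otimes _)); last by lin.
elim/big_ind: _ => // j _.
rewrite (linZ (f := otimes _)); last by lin.
apply: (PZ); apply: PG; by exists I, c, e, J, d, f, i, j.
Qed.
Definition cten M N := Comod (ten_localfin M N).

Lemma mbasis_unit : @mbasis _ _ (com_unit A) _ (@mone k A) (fun=> 1).
Proof. split=> [|[]]; first exact: multmat_one. by rewrite sum_unit. Qed.
Lemma unit_localfin : localfin (com_unit A).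
Proof.
apply: (@localfin_gen (com_unit A) (fun t : k => t = 1)).
- by rewrite /coact /=; lin.
- by move=> _ ->; exists _, (@mone k A), (fun=> 1), tt; split=> //; apply: mbasis_unit.
move=> P P0 PD PZ PG m; rewrite -[m]mulr1; exact/PZ/PG.
Qed.
Definition cone := Comod unit_localfin.

Record chom (M N : comod) := Chom { cf :> M -> N; cfP : is_comorphism cf }.
Lemma cf_lin M N (f : chom M N) : lin f.
Proof. exact: (cfP f).1. Qed.
Hint Resolve cf_lin : lins.
Lemma chom_eq M N (f g : chom M N) : (forall x, f x = g x) -> f = g.
Proof.
case: f g => f pf [g pg] /= /funext E; case: _ / E pg => pg.
by congr Chom; apply: Prop_irrelevance.
Qed.
Lemma mbasis_map (M N : comod) (f : M -> N) (I : finType) (c : I -> I -> A)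
    (e : I -> M) : is_comorphism f ->
  mbasis c e -> mbasis c (fun i => f (e i)).
Proof.
move=> [lf cf] [mc ce]; split=> // j; rewrite cf ce /tmap tlift_sum; last by split=>
  ?; lin.
by apply: eq_bigr => i _; rewrite tliftE //; split=> ?; lin.
Qed.
Lemma comor_crit (M N : comod) (f : M -> N) : lin f ->
  (forall (I : finType) (c : I -> I -> A) (e : I -> M), mbasis c e ->
     forall j, coact (f (e j)) = \sum_i f (e i) \ox c i j) -> is_comorphism f.
Proof.
move=> lf E; split=> //; apply: ext1.
- by lin.
- by apply: lin_tliftc; [lin|exact: coact_lin].
move=> I c e be j; rewrite (E _ _ _ be) (mb_coact be) /tmap tlift_sum; last by split=>
  ?; lin.
by apply: eq_bigr => i _; rewrite tliftE //; split=> ?; lin.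
Qed.
End Cat.
#[export] Hint Resolve coact_lin cf_lin : lins.

(** * The associativity constraint of comodules *)

Section Struct.
Variables (k : fieldType) (A : dualQuasiHopf k).
Local Notation Phi a b c := (dqh_phi A (a \ox b \ox c)).
Local Notation PhiV a b c := (dqh_phiV A (a \ox b \ox c)).
Implicit Types M N P Q : comod A.

Lemma linD_ext V V' (W : lmodType k) (F : V \ox V' -> W) v : lin F -> lin
  (fun x => F (v \ox x)).
Proof. by move=> lF; lin. Qed.
Lemma linD_ext' V V' (W : lmodType k) (F : V \ox V' -> W) v : lin F -> lin
  (fun x => F (x \ox v)).
Proof. by move=> lF; lin. Qed.

Lemma ext3 M N P (W : lmodType k) (F G : (M \ox N) \ox P -> W) : lin F -> lin G ->
  (forall (I : finType) (c : I -> I -> A) (e : I -> M), mbasis c e ->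
   forall (J : finType) (d : J -> J -> A) (f : J -> N), mbasis d f ->
   forall (L : finType) (h : L -> L -> A) (g : L -> P), mbasis h g ->
     forall i j l, F (e i \ox f j \ox g l) = G (e i \ox f j \ox g l)) -> forall m, F m
       = G m.
Proof.
move=> lF lG E; apply: extT => // v v'.
move: v; apply: ext2; [exact: linD_ext'..|] => I c e be J d f bf i j.
move: v'; apply: ext1; [exact: linD_ext..|] => L h g bg l.
exact: (E _ _ _ be _ _ _ bf _ _ _ bg).
Qed.
Lemma ext3' M N P (W : lmodType k) (F G : M \ox (N \ox P) -> W) : lin F -> lin G ->
  (forall (I : finType) (c : I -> I -> A) (e : I -> M), mbasis c e ->
   forall (J : finType) (d : J -> J -> A) (f : J -> N), mbasis d f ->
   forall (L : finType) (h : L -> L -> A) (g : L -> P), mbasis h g ->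
     forall i j l, F (e i \ox (f j \ox g l)) = G (e i \ox (f j \ox g l))) -> forall m,
       F m = G m.
Proof.
move=> lF lG E; apply: extT => // v v'.
move: v'; apply: ext2; [exact: linD_ext..|] => J d f bf L h g bg j l.
move: v; apply: ext1; [exact: linD_ext'..|] => I c e be i.
exact: (E _ _ _ be _ _ _ bf _ _ _ bg).
Qed.
Lemma ext4 M N P Q (W : lmodType k) (F G : ((M \ox N) \ox P) \ox Q -> W) : lin F ->
  lin G ->
  (forall (I : finType) (c : I -> I -> A) (e : I -> M), mbasis c e ->
   forall (J : finType) (d : J -> J -> A) (f : J -> N), mbasis d f ->
   forall (L : finType) (h : L -> L -> A) (g : L -> P), mbasis h g ->
   forall (T : finType) (r : T -> T -> A) (s : T -> Q), mbasis r s ->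
     forall i j l t, F (e i \ox f j \ox g l \ox s t) = G
       (e i \ox f j \ox g l \ox s t)) ->
  forall m, F m = G m.
Proof.
move=> lF lG E; apply: extT => // v v'.
move: v; apply: ext3; [exact: linD_ext'..|] => I c e be J d f bf L h g bg i j l.
move: v'; apply: ext1; [exact: linD_ext..|] => T r s bs t.
exact: (E _ _ _ be _ _ _ bf _ _ _ bg _ _ _ bs).
Qed.

Lemma mbasis_reidx M (I J : finType) (c : I -> I -> A) (e : I -> M) (b : J -> I) :
  bijective b -> mbasis c e -> mbasis (fun x y => c (b x) (b y)) (fun x => e (b x)).
Proof.
move=> bb [[mc1 mc2] ce]; split; first split.
- by move=> i j; rewrite mc1 (reindex b) //; apply: onW_bij.
- by move=> i j; rewrite mc2 (inj_eq (bij_inj bb)).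
by move=> j; rewrite ce (reindex b) //; apply: onW_bij.
Qed.

Lemma comor_mat M N (f : M -> N) (I J : finType) (c : I -> I -> A) (x : I -> M)
    (d : J -> J -> A) (y : J -> N) (F : J -> I -> k) : lin f ->
  mbasis c x -> mbasis d y -> (forall p, f (x p) = \sum_q F q p *: y q) ->
  (forall q p, \sum_s F s p *: d q s = \sum_s F q s *: c s p) ->
  forall p, coact (f (x p)) = tmap f id (coact (x p)).
Proof.
move=> lf bx bY E R p; rewrite (mb_coact bx) E (lin_bigsum _ _ _ (coact_lin (M := N))).
rewrite (lin_bigsum (f := tmap f id)); last by apply: lin_tmap.
transitivity (\sum_q \sum_s F s p *: (y q \ox d q s)).
  rewrite exchange_big; apply: eq_bigr => s _.
  by rewrite (linZ _ _ (coact_lin (M := N))) (mb_coact bY) scaler_sumr.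
transitivity (\sum_q \sum_s F q s *: (y q \ox c s p)); last first.
  rewrite exchange_big; apply: eq_bigr => s _.
  rewrite tmapE // E (lin_bigsum (f := fun v => v \ox c s p)); last by lin.
  by apply: eq_bigr => q _; rewrite (linZ (f := fun v => v \ox c s p)); last by lin.
apply: eq_bigr => q _; have l : lin (otimes (y q) : A -> _) by lin.
have {}R := congr1 (otimes (y q)) (R q p); move: R; rewrite !(lin_bigsum _ _ _ l).
by under eq_bigr => s _ do rewrite (linZ _ _ l); under [X in _ = X]eq_bigr => s _ do
  rewrite (linZ _ _ l).
Qed.

Lemma invert_mat (V W : lmodType k) (f : V -> W) (g : W -> V) (I J : finType)
  (x : I -> V) (y : J -> W)
    (F : J -> I -> k) (G : I -> J -> k) : lin g ->
  (forall p, f (x p) = \sum_q F q p *: y q) ->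
  (forall q, g (y q) = \sum_p G p q *: x p) ->
  (forall p' p, \sum_q G p' q * F q p = (p' == p)%:R) ->
  forall p, g (f (x p)) = x p.
Proof.
move=> lg Ef Eg E p; rewrite Ef (lin_bigsum _ _ _ lg) -[RHS](delta_sum p x).
under eq_bigr => q _ do rewrite (linZ _ _ lg) Eg scaler_sumr.
rewrite exchange_big; apply: eq_bigr => p' _; rewrite -E scaler_suml.
by apply: eq_bigr => q _; rewrite scalerA mulrC.
Qed.

Lemma lin_assoc M N P : lin (@com_assoc _ A M N P).
Proof. rewrite /com_assoc; lin. Qed.
Lemma lin_assocV M N P : lin (@com_assocV _ A M N P).
Proof. rewrite /com_assocV; lin. Qed.

Section B3.
Variables (M N P : comod A).
Variables (I : finType) (c : I -> I -> A) (e : I -> M) (be : mbasis c e).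
Variables (J : finType) (d : J -> J -> A) (f : J -> N) (bf : mbasis d f).
Variables (L : finType) (h : L -> L -> A) (g : L -> P) (bg : mbasis h g).

Lemma assoc_b i j l : @com_assoc _ A M N P (e i \ox f j \ox g l)
  = \sum_(p : I * J * L) Phi (c p.1.1 i) (d p.1.2 j) (h p.2 l) *:
    (e p.1.1 \ox (f p.1.2 \ox g p.2)).
Proof.
rewrite /com_assoc tliftE; last by lin.
rewrite tliftE; last by lin.
rewrite (mb_coact be) tlift_sum; last by lin.
rewrite !sum_pair; apply: eq_bigr => i' _; rewrite tliftE; last by lin.
rewrite (mb_coact bf) tlift_sum; last by lin.
apply: eq_bigr => j' _; rewrite tliftE; last by lin.
rewrite (mb_coact bg) tlift_sum; last by lin.
by apply: eq_bigr => l' _; rewrite tliftE; last by lin.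
Qed.
Lemma assocV_b i j l : @com_assocV _ A M N P (e i \ox (f j \ox g l))
  = \sum_(p : I * J * L) PhiV (c p.1.1 i) (d p.1.2 j) (h p.2 l) *:
    (e p.1.1 \ox f p.1.2 \ox g p.2).
Proof.
rewrite /com_assocV tliftE; last by lin.
rewrite tliftE; last by lin.
rewrite (mb_coact be) tlift_sum; last by lin.
rewrite !sum_pair; apply: eq_bigr => i' _; rewrite tliftE; last by lin.
rewrite (mb_coact bf) tlift_sum; last by lin.
apply: eq_bigr => j' _; rewrite tliftE; last by lin.
rewrite (mb_coact bg) tlift_sum; last by lin.
by apply: eq_bigr => l' _; rewrite tliftE; last by lin.
Qed.
Lemma assocK_b i j l : @com_assocV _ A M N P (@com_assoc _ A M N P
  (e i \ox f j \ox g l))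
   = e i \ox f j \ox g l.
Proof.
apply: (@invert_mat _ _ _ _ _ _ (fun p : I * J * L => e p.1.1 \ox f p.1.2 \ox g p.2)
  (fun p => e p.1.1 \ox (f p.1.2 \ox g p.2)) _ _ (@lin_assocV M N P)
  (fun p => assoc_b p.1.1 p.1.2 p.2) (fun p => assocV_b p.1.1 p.1.2 p.2) _ (i, j, l)).
move=> [[i1 j1] l1] [[i2 j2] l2] /=; rewrite !sum_pair.
by rewrite (phi_l (mb_mult be) (mb_mult bf) (mb_mult bg)) !xpair_eqE -!natrM !mulnb.
Qed.
Lemma assocVK_b i j l : @com_assoc _ A M N P (@com_assocV _ A M N P
  (e i \ox (f j \ox g l)))
   = e i \ox (f j \ox g l).
Proof.
apply: (@invert_mat _ _ _ _ _ _ (fun p : I * J * L => e p.1.1 \ox (f p.1.2 \ox g p.2))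
  (fun p => e p.1.1 \ox f p.1.2 \ox g p.2) _ _ (@lin_assoc M N P)
  (fun p => assocV_b p.1.1 p.1.2 p.2) (fun p => assoc_b p.1.1 p.1.2 p.2) _ (i, j, l)).
move=> [[i1 j1] l1] [[i2 j2] l2] /=; rewrite !sum_pair.
by rewrite (phi_r (mb_mult be) (mb_mult bf) (mb_mult bg)) !xpair_eqE -!natrM !mulnb.
Qed.
Lemma bij_assoc : bijective (fun p : I * J * L => (p.1.1, (p.1.2, p.2))).
Proof. by exists (fun p => (p.1, p.2.1, p.2.2)) => [[[]]|[? []]]. Qed.

Lemma assoc_mor_b i j l :
  @coact _ _ (cten M (cten N P)) (@com_assoc _ A M N P (e i \ox f j \ox g l))
  = tmap (@com_assoc _ A M N P) id (@coact _ _ (cten (cten M N) P)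
    (e i \ox f j \ox g l)).
Proof.
apply: (@comor_mat (cten (cten M N) P) (cten M (cten N P)) _ _ _ _
  (fun p : I * J * L => e p.1.1 \ox f p.1.2 \ox g p.2) _ _ _ (@lin_assoc M N P)
  (@mbasis_tens _ _ (cten M N) P _ _ _ _ _ _ (mbasis_tens be bf) bg)
  (@mbasis_reidx (cten M (cten N P)) _ _ _ _ _ bij_assoc
     (@mbasis_tens _ _ M (cten N P) _ _ _ _ _ _ be (mbasis_tens bf bg)))
  (fun p => assoc_b p.1.1 p.1.2 p.2) _ (i, j, l)).
move=> [[i1 j1] l1] [[i2 j2] l2]; rewrite !sum_pair.
exact: (assoc_mat (mb_mult be) (mb_mult bf) (mb_mult bg)).
Qed.
End B3.

Lemma assocK M N P t : @com_assocV _ A M N P (@com_assoc _ A M N P t) = t.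
Proof.
apply: (@ext3 M N P _ (fun t => com_assocV (com_assoc t)) (fun t => t)) =>
  [||I c e be J d f bf L h g bg i j l]; last exact: (assocK_b be bf bg).
  by apply: lin_comp; [exact: lin_assocV|exact: lin_assoc].
exact: lin_id.
Qed.
Lemma assocVK M N P t : @com_assoc _ A M N P (@com_assocV _ A M N P t) = t.
Proof.
apply: (@ext3' M N P _ (fun t => com_assoc (com_assocV t)) (fun t => t)) =>
  [||I c e be J d f bf L h g bg i j l]; last exact: (assocVK_b be bf bg).
  by apply: lin_comp; [exact: lin_assoc|exact: lin_assocV].
exact: lin_id.
Qed.
Lemma assoc_mor M N P : @is_comorphism _ _ (cten (cten M N) P) (cten M (cten N P))
  (@com_assoc _ A M N P).
Proof.
split; first exact: lin_assoc.
apply: ext3 => [||I c e be J d f bf L h g bg i j l]; last exact: (assoc_mor_b be bf bg).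
  by apply: lin_comp; [exact: (@coact_lin _ _ (cten M (cten N P)))|exact: lin_assoc].
apply: lin_comp; last exact: (@coact_lin _ _ (cten (cten M N) P)).
by apply: lin_tmap => //; exact: lin_assoc.
Qed.
Lemma inv_mor M N (f : M -> N) (g : N -> M) : is_comorphism f -> lin g ->
  cancel f g -> cancel g f -> is_comorphism g.
Proof.
move=> [lf cf] lg fK gK; split=> // n.
rewrite -{2}[n]gK cf; set t := coact _.
move: (t); apply: extT => //; first by apply: lin_comp; apply: lin_tmap.
by move=> v w; rewrite !tmapE // fK.
Qed.
Definition cassoc M N P := Chom (assoc_mor M N P).
Definition cassocV M N P := Chom (inv_mor (assoc_mor M N P) (@lin_assocV M N P)
  (@assocK M N P) (@assocVK M N P)).

Lemma cid_mor M : is_comorphism (fun x : M => x).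
Proof.
split=> // m; set t := coact _; move: (t); apply: extT; first exact: lin_id.
  exact: lin_tmap.
by move=> v w; rewrite tmapE.
Qed.
Definition cid M := Chom (cid_mor M).
Lemma ccomp_mor M N P (g : chom N P) (f : chom M N) : is_comorphism (fun x => g (f x)).
Proof.
split=> [|m]; first by change (lin (fun x => g (f x))); lin.
rewrite (cfP g).2 (cfP f).2; set t := coact _; move: (t).
apply: (extT (F := fun t => tmap g id (tmap f id t)) (G := tmap (fun x => g (f x)) id)).
- by apply: lin_comp; apply: lin_tmap => //; lin.
- by apply: lin_tmap => //; lin.
by move=> v w; rewrite !tmapE //; lin.
Qed.
Definition ccomp M N P (g : chom N P) (f : chom M N) := Chom (ccomp_mor g f).

Lemma ctmap_mor M N M' N' (f : chom M M') (g : chom N N') :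
  @is_comorphism _ _ (cten M N) (cten M' N') (tmap f g).
Proof.
split; first by apply: lin_tmap; lin.
apply: ext2 => [||I c e be J d f' bf i j].
- by apply: lin_comp; [exact: (@coact_lin _ _ (cten M' N'))|apply: lin_tmap; lin].
- by apply: lin_comp; [apply: lin_tmap => //; apply: lin_tmap; lin|exact:
  (@coact_lin _ _ (cten M N))].
rewrite tmapE; [|lin|lin].
rewrite (mb_coact (mbasis_tens (mbasis_map (cfP f) be) (mbasis_map (cfP g) bf)) (i, j)).
rewrite (mb_coact (mbasis_tens be bf) (i, j)).
rewrite (lin_bigsum (f := tmap _ _)); last by apply: lin_tmap => //; apply: lin_tmap;
  lin.
by apply: eq_bigr => p _; rewrite !tmapE //; lin.
Qed.
Definition ctmap M N M' N' (f : chom M M') (g : chom N N') := Chom (ctmap_mor f g).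
End Struct.

(** * Calculus in a braided monoidal category *)

Declare Scope cat_scope.
Delimit Scope cat_scope with cat.

(** Equality of morphisms is Leibniz equality, so that coherence can be used by
    rewriting. *)
Record moncat := Moncat {
  ob :> Type;
  hom : ob -> ob -> Type;
  idm : forall X, hom X X;
  comp : forall X Y Z, hom Y Z -> hom X Y -> hom X Z;
  compA : forall W X Y Z (h : hom Y Z) (g : hom X Y) (f : hom W X),
    comp (comp h g) f = comp h (comp g f);
  comp1m : forall X Y (f : hom X Y), comp (idm Y) f = f;
  compm1 : forall X Y (f : hom X Y), comp f (idm X) = f;
  ten : ob -> ob -> ob;
  one : ob;
  tenm : forall X X' Y Y', hom X X' -> hom Y Y' -> hom (ten X Y) (ten X' Y');
  tenm1 : forall X Y, tenm (idm X) (idm Y) = idm (ten X Y);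
  tenmM : forall X X' X'' Y Y' Y'' (f' : hom X' X'') (f : hom X X')
      (g' : hom Y' Y'') (g : hom Y Y'),
    tenm (comp f' f) (comp g' g) = comp (tenm f' g') (tenm f g);
  al : forall X Y Z, hom (ten (ten X Y) Z) (ten X (ten Y Z));
  alV : forall X Y Z, hom (ten X (ten Y Z)) (ten (ten X Y) Z);
  alK : forall X Y Z, comp (alV X Y Z) (al X Y Z) = idm _;
  alVK : forall X Y Z, comp (al X Y Z) (alV X Y Z) = idm _;
  al_nat : forall X X' Y Y' Z Z' (f : hom X X') (g : hom Y Y') (h : hom Z Z'),
    comp (al X' Y' Z') (tenm (tenm f g) h) = comp (tenm f (tenm g h)) (al X Y Z);
  lu : forall X, hom (ten one X) X;
  luV : forall X, hom X (ten one X);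
  luK : forall X, comp (luV X) (lu X) = idm _;
  luVK : forall X, comp (lu X) (luV X) = idm _;
  lu_nat : forall X Y (f : hom X Y),
    comp (lu Y) (tenm (idm one) f) = comp f (lu X);
  ru : forall X, hom (ten X one) X;
  ruV : forall X, hom X (ten X one);
  ruK : forall X, comp (ruV X) (ru X) = idm _;
  ruVK : forall X, comp (ru X) (ruV X) = idm _;
  ru_nat : forall X Y (f : hom X Y),
    comp (ru Y) (tenm f (idm one)) = comp f (ru X);
  pentagon : forall W X Y Z,
    comp (al W X (ten Y Z)) (al (ten W X) Y Z)
    = comp (tenm (idm W) (al X Y Z))
        (comp (al W (ten X Y) Z) (tenm (al W X Y) (idm Z)));
  triangle : forall X Y,
    comp (tenm (idm X) (lu Y)) (al X one Y) = tenm (ru X) (idm Y);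
  lu_al : forall X Y, comp (lu (ten X Y)) (al one X Y) = tenm (lu X) (idm Y);
  ru_al : forall X Y, comp (tenm (idm X) (ru Y)) (al X Y one) = ru (ten X Y);
  lu_one : lu one = ru one
}.

Arguments one {C} : rename.
Arguments idm {C X} : rename.
Arguments al {C} X Y Z : rename.
Arguments alV {C} X Y Z : rename.
Arguments lu {C} X : rename.
Arguments luV {C} X : rename.
Arguments ru {C} X : rename.
Arguments ruV {C} X : rename.

(** The components are not assumed to be isomorphisms: the convolution inverse
    of sigma is to be constructed, and invertibility is obtained from duality
    in [rigid_brK]. *)
Record braiding (C : moncat) := Braiding {
  br :> forall X Y : C, hom (ten X Y) (ten Y X);
  br_nat : forall (X X' Y Y' : C) (f : hom X X') (g : hom Y Y'),
    comp (br X' Y') (tenm f g) = comp (tenm g f) (br X Y);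
  br_hexl : forall X Y Z,
    comp (al Y Z X) (comp (br X (ten Y Z)) (al X Y Z))
    = comp (tenm (@idm _ Y) (br X Z)) (comp (al Y X Z) (tenm (br X Y) (@idm _ Z)));
  br_hexr : forall X Y Z,
    comp (alV Z X Y) (comp (br (ten X Y) Z) (alV X Y Z))
    = comp (tenm (br X Z) (@idm _ Y)) (comp (alV X Z Y) (tenm (@idm _ X) (br Y Z)));
  br_1r : forall X, comp (lu X) (br X one) = ru X;
  br_1l : forall X, comp (ru X) (br one X) = lu X
}.

Notation "f ∘ g" := (comp f g) (at level 60, right associativity,
  format "f  ∘  g") : cat_scope.
Notation "X ⊗ Y" := (ten X Y) (at level 38, left associativity) : cat_scope.
Notation "f · X" := (tenm f (@idm _ X)) (at level 37, left associativity) : cat_scope.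
Notation "V ∙ g" := (tenm (@idm _ V) g) (at level 37, left associativity) : cat_scope.
Local Open Scope cat_scope.

Section Calculus.
Variable C : moncat.
Implicit Types V W X Y Z : C.

Section Chains.
Variables (W X Y Y' Z Z' T : C).

(** Composites are bracketed to the right. The lemma [rmn] replaces [m] arrows
    at the head of a composite by [n] others, and [wmn] does so with all of
    them whiskered by an object. *)
Lemma r22 (f : hom Y Z) (g : hom X Y) (h : hom Y' Z) (k : hom X Y')
  (x : hom W X) : f ∘ g = h ∘ k -> f ∘ g ∘ x = h ∘ k ∘ x.
Proof. by rewrite -!compA => ->. Qed.
Lemma r21 (f : hom Y Z) (g : hom X Y) (h : hom X Z)
  (x : hom W X) : f ∘ g = h -> f ∘ g ∘ x = h ∘ x.
Proof. by rewrite -!compA => ->. Qed.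
Lemma r20 (f : hom Y X) (g : hom X Y)
  (x : hom W X) : f ∘ g = idm -> f ∘ g ∘ x = x.
Proof. by rewrite -!compA => ->; rewrite comp1m. Qed.
Lemma r33 (e : hom Z T) (f : hom Y Z) (g : hom X Y)
  (j : hom Z' T) (h : hom Y' Z') (k : hom X Y')
  (x : hom W X) : e ∘ f ∘ g = j ∘ h ∘ k -> e ∘ f ∘ g ∘ x = j ∘ h ∘ k ∘ x.
Proof. by move=> E; rewrite -[f ∘ g ∘ x]compA -[LHS]compA E !compA. Qed.
Lemma r32 (e : hom Z T) (f : hom Y Z) (g : hom X Y)
  (h : hom Y' T) (k : hom X Y')
  (x : hom W X) : e ∘ f ∘ g = h ∘ k -> e ∘ f ∘ g ∘ x = h ∘ k ∘ x.
Proof. by move=> E; rewrite -[f ∘ g ∘ x]compA -[LHS]compA E !compA. Qed.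
Lemma r23 (f : hom Y Z) (g : hom X Y)
  (j : hom Z' Z) (h : hom Y' Z') (k : hom X Y')
  (x : hom W X) : f ∘ g = j ∘ h ∘ k -> f ∘ g ∘ x = j ∘ h ∘ k ∘ x.
Proof. by move=> E; rewrite -[LHS]compA E !compA. Qed.
End Chains.

Lemma homx X Y (f g : hom X Y) :
  (forall W (x : hom W X), f ∘ x = g ∘ x) -> f = g.
Proof. by move=> /(_ X idm); rewrite !compm1. Qed.

Lemma whM X Y Z T (f : hom Y Z) (g : hom X Y) : (f ∘ g) · T = (f · T) ∘ (g · T).
Proof. by rewrite -tenmM comp1m. Qed.

Lemma wlM X Y Z T (f : hom Y Z) (g : hom X Y) : T ∙ (f ∘ g) = (T ∙ f) ∘ (T ∙ g).
Proof. by rewrite -tenmM comp1m. Qed.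

Section Whisker.
Variables (X Y Y' Z Z' T U : C).
Lemma w22 (f : hom Y Z) (g : hom X Y) (h : hom Y' Z) (k : hom X Y') :
  f ∘ g = h ∘ k -> f · T ∘ g · T = h · T ∘ k · T.
Proof. by rewrite -!whM => ->. Qed.
Lemma w21 (f : hom Y Z) (g : hom X Y) (h : hom X Z) :
  f ∘ g = h -> f · T ∘ g · T = h · T.
Proof. by rewrite -!whM => ->. Qed.
Lemma w20 (f : hom Y X) (g : hom X Y) :
  f ∘ g = idm -> f · T ∘ g · T = idm.
Proof. by rewrite -!whM => ->; rewrite tenm1. Qed.
End Whisker.

Lemma swap V W X Y (f : hom V W) (g : hom X Y) : f · Y ∘ V ∙ g = W ∙ g ∘ f · X.
Proof. by rewrite -!tenmM !comp1m !compm1. Qed.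

Lemma al_natl V W X Y (f : hom V W) :
  al W X Y ∘ f · X · Y = f · (X ⊗ Y) ∘ al V X Y.
Proof. by rewrite al_nat tenm1. Qed.
Lemma al_natm V W X Y (f : hom V W) :
  al X W Y ∘ X ∙ f · Y = X ∙ (f · Y) ∘ al X V Y.
Proof. by rewrite al_nat. Qed.
Lemma al_natr V W X Y (f : hom V W) :
  al X Y W ∘ (X ⊗ Y) ∙ f = X ∙ (Y ∙ f) ∘ al X Y V.
Proof. by rewrite -al_nat tenm1. Qed.

Lemma iso_swap X X' Y Y' (f : hom X X') (g : hom Y Y') (iX : hom X Y)
    (jX : hom Y X) (iX' : hom X' Y') (jX' : hom Y' X') :
  iX ∘ jX = idm -> jX' ∘ iX' = idm ->
  iX' ∘ f = g ∘ iX -> jX' ∘ g = f ∘ jX.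
Proof.
move=> ij ji E; rewrite -[LHS]compm1 -ij compA -[g ∘ _]compA -E.
by rewrite !compA -[jX' ∘ _]compA ji comp1m.
Qed.

Lemma alV_natl V W X Y (f : hom V W) :
  alV W X Y ∘ f · (X ⊗ Y) = f · X · Y ∘ alV V X Y.
Proof. exact: iso_swap (alVK _ _ _) (alK _ _ _) (al_natl _ _ _). Qed.
Lemma alV_natm V W X Y (f : hom V W) :
  alV X W Y ∘ X ∙ (f · Y) = X ∙ f · Y ∘ alV X V Y.
Proof. exact: iso_swap (alVK _ _ _) (alK _ _ _) (al_natm _ _ _). Qed.
Lemma alV_natr V W X Y (f : hom V W) :
  alV X Y W ∘ X ∙ (Y ∙ f) = (X ⊗ Y) ∙ f ∘ alV X Y V.
Proof. exact: iso_swap (alVK _ _ _) (alK _ _ _) (al_natr _ _ _). Qed.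
Lemma ruV_nat X Y (f : hom X Y) : ruV Y ∘ f = f · one ∘ ruV X.
Proof. exact: iso_swap (ruVK _) (ruK _) (ru_nat _). Qed.
Lemma luV_nat X Y (f : hom X Y) : luV Y ∘ f = one ∙ f ∘ luV X.
Proof. exact: iso_swap (luVK _) (luK _) (lu_nat _). Qed.

Lemma al_inj W X Y Z (f g : hom W (X ⊗ Y ⊗ Z)) :
  al _ _ _ ∘ f = al _ _ _ ∘ g -> f = g.
Proof. by move=> /(congr1 (comp (alV _ _ _))); rewrite -!compA alK !comp1m. Qed.

Lemma iso_inv X Y Z (f : hom X Y) (f' : hom Y X) (g : hom Y Z) (g' : hom Z Y)
    (h : hom X Z) (h' : hom Z X) :
  f' ∘ f = idm -> g' ∘ g = idm -> h ∘ h' = idm -> g ∘ f = h -> f' ∘ g' = h'.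
Proof.
move=> ff gg hh E; rewrite -[LHS]compm1 -hh -E !compA (r20 _ gg).
by rewrite -compA ff comp1m.
Qed.

Lemma ruV_al X Y : alV X Y one ∘ X ∙ ruV Y = ruV (X ⊗ Y).
Proof.
apply: iso_inv (alK _ _ _) _ (ruVK _) (ru_al _ _).
by rewrite -wlM ruK tenm1.
Qed.

Lemma pentagonV W X Y Z :
  al W X (Y ⊗ Z) ∘ al (W ⊗ X) Y Z ∘ alV W X Y · Z
  = W ∙ al X Y Z ∘ al W (X ⊗ Y) Z.
Proof.
by rewrite -compA pentagon !compA -whM alVK tenm1 compm1.
Qed.

Lemma al_ruV X Y : al X Y one ∘ ruV (X ⊗ Y) = X ∙ ruV Y.
Proof. by rewrite -ruV_al (r20 _ (alVK _ _ _)). Qed.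
Lemma al_luV X Y : al X one Y ∘ ruV X · Y = X ∙ luV Y.
Proof.
rewrite -[LHS]comp1m -tenm1 -luK wlM !compA (r21 _ (triangle _ _)).
by rewrite -whM ruVK tenm1 compm1.
Qed.
Lemma ru_alV X Y : ru X · Y ∘ alV X one Y = X ∙ lu Y.
Proof. by rewrite -triangle compA alVK compm1. Qed.
Lemma pentagonV2 W X Y Z :
  al W X Y · Z ∘ alV (W ⊗ X) Y Z
  = alV W (X ⊗ Y) Z ∘ W ∙ alV X Y Z ∘ al W X (Y ⊗ Z).
Proof.
rewrite -[al W X (Y ⊗ Z)]compm1 -(alVK (W ⊗ X) Y Z) -[al W X _ ∘ _]compA.
rewrite pentagon !compA -[W ∙ alV _ _ _ ∘ _ in RHS]compA -wlM alK tenm1 comp1m.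
by rewrite (r20 _ (alK _ _ _)).
Qed.

(** Words are tensor products bracketed to the left, such as [V ⊗ X ⊗ Y], and
    the operations [mrg], [spl], [cre], [kil] act on their last letters. All
    associativity constraints are hidden inside them, so that they compose as
    in a strict category. They are locked, lest unification expose the
    constraints during rewriting. *)
Definition mrg X Y Z (g : hom (X ⊗ Y) Z) V : hom (V ⊗ X ⊗ Y) (V ⊗ Z) :=
  locked (V ∙ g ∘ al V X Y).
Definition spl X Y Z (g : hom Z (X ⊗ Y)) V : hom (V ⊗ Z) (V ⊗ X ⊗ Y) :=
  locked (alV V X Y ∘ V ∙ g).
Definition cre1 X (g : hom one X) V : hom V (V ⊗ X) := locked (V ∙ g ∘ ruV V).
Definition kil1 X (g : hom X one) V : hom (V ⊗ X) V := locked (ru V ∘ V ∙ g).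
Definition kil X Y (g : hom (X ⊗ Y) one) V : hom (V ⊗ X ⊗ Y) V :=
  locked (ru V ∘ mrg g V).
Definition cre X Y (g : hom one (X ⊗ Y)) V : hom V (V ⊗ X ⊗ Y) :=
  locked (spl g V ∘ ruV V).

Lemma mrgE X Y Z (g : hom (X ⊗ Y) Z) V : mrg g V = V ∙ g ∘ al V X Y.
Proof. by rewrite /mrg -lock. Qed.
Lemma splE X Y Z (g : hom Z (X ⊗ Y)) V : spl g V = alV V X Y ∘ V ∙ g.
Proof. by rewrite /spl -lock. Qed.
Lemma cre1E X (g : hom one X) V : cre1 g V = V ∙ g ∘ ruV V.
Proof. by rewrite /cre1 -lock. Qed.
Lemma kil1E X (g : hom X one) V : kil1 g V = ru V ∘ V ∙ g.
Proof. by rewrite /kil1 -lock. Qed.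
Lemma kilE X Y (g : hom (X ⊗ Y) one) V : kil g V = ru V ∘ mrg g V.
Proof. by rewrite /kil -lock. Qed.
Lemma creE X Y (g : hom one (X ⊗ Y)) V : cre g V = spl g V ∘ ruV V.
Proof. by rewrite /cre -lock. Qed.

Lemma mrg_nat X Y Z (g : hom (X ⊗ Y) Z) V W (f : hom V W) :
  mrg g W ∘ f · X · Y = f · Z ∘ mrg g V.
Proof. by rewrite !mrgE !compA al_natl -!compA swap. Qed.
Lemma spl_nat X Y Z (g : hom Z (X ⊗ Y)) V W (f : hom V W) :
  spl g W ∘ f · Z = f · X · Y ∘ spl g V.
Proof. by rewrite !splE !compA -swap -!compA alV_natl. Qed.
Lemma kil_nat X Y (g : hom (X ⊗ Y) one) V W (f : hom V W) :
  kil g W ∘ f · X · Y = f ∘ kil g V.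
Proof. by rewrite !kilE !compA mrg_nat -!compA ru_nat. Qed.
Lemma cre_nat X Y (g : hom one (X ⊗ Y)) V W (f : hom V W) :
  cre g W ∘ f = f · X · Y ∘ cre g V.
Proof. by rewrite !creE !compA ruV_nat -!compA spl_nat. Qed.
Lemma cre1_nat X (g : hom one X) V W (f : hom V W) :
  cre1 g W ∘ f = f · X ∘ cre1 g V.
Proof. by rewrite !cre1E !compA ruV_nat -!compA -swap. Qed.
Lemma kil1_nat X (g : hom X one) V W (f : hom V W) :
  kil1 g W ∘ f · X = f ∘ kil1 g V.
Proof. by rewrite !kil1E !compA -swap -!compA ru_nat. Qed.

Variable c : braiding C.

(** The braiding of the last two letters of a word. *)
Definition b V X Y : hom (V ⊗ X ⊗ Y) (V ⊗ Y ⊗ X) :=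
  locked (alV V Y X ∘ mrg (br c X Y) V).
Lemma bE V X Y : b V X Y = alV V Y X ∘ mrg (br c X Y) V.
Proof. by rewrite /b -lock. Qed.

Lemma b_nat V W X Y (f : hom V W) : b W X Y ∘ f · X · Y = f · Y · X ∘ b V X Y.
Proof. by rewrite !bE !compA mrg_nat -!compA alV_natl. Qed.
Lemma b_natl V X X' Y (g : hom X X') :
  b V X' Y ∘ V ∙ g · Y = (V ⊗ Y) ∙ g ∘ b V X Y.
Proof.
rewrite !bE !mrgE !compA al_natm -[V ∙ br c X' Y ∘ _]compA -wlM br_nat wlM compA.
by rewrite -!compA alV_natr.
Qed.
Lemma b_natr V X Y Y' (g : hom Y Y') :
  b V X Y' ∘ (V ⊗ X) ∙ g = V ∙ g · X ∘ b V X Y.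
Proof.
rewrite !bE !mrgE !compA al_natr -[V ∙ br c X Y' ∘ _]compA -wlM br_nat wlM compA.
by rewrite -!compA alV_natm.
Qed.

Lemma al_b V X Y : al V Y X ∘ b V X Y = V ∙ br c X Y ∘ al V X Y.
Proof. by rewrite bE (r20 _ (alVK _ _ _)) mrgE. Qed.

Lemma b_hexl V X Y Z :
  al V Y Z · X ∘ b (V ⊗ Y) X Z ∘ b V X Y · Z = b V X (Y ⊗ Z) ∘ al (V ⊗ X) Y Z.
Proof.
apply: al_inj; rewrite (r22 _ (al_b _ _ _)) pentagon.
have E : al V (Y ⊗ Z) X ∘ al V Y Z · X
    = V ∙ alV Y Z X ∘ al V Y (Z ⊗ X) ∘ al (V ⊗ Y) Z X.
  by rewrite pentagon -[RHS]compA -wlM alK tenm1 comp1m.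
rewrite (r23 _ E) (r22 _ (al_b _ _ _)) (r22 _ (al_natr _ _ _)).
rewrite bE whM (r32 _ (pentagonV _ _ _ _)) mrgE whM (r22 _ (al_natm _ _ _)).
rewrite -!compA -!wlM; congr ((_ ∙ _ ∘ _) ∘ _).
by rewrite !compA -br_hexl (r20 _ (alK _ _ _)).
Qed.

Lemma b_hexr V X Y Z :
  al (V ⊗ Z) X Y ∘ b V X Z · Y ∘ b (V ⊗ X) Y Z = b V (X ⊗ Y) Z ∘ al V X Y · Z.
Proof.
apply: al_inj; rewrite (r22 _ (al_b _ _ _)) (r23 _ (pentagon _ _ _ _)).
rewrite (r22 _ (w22 _ (al_b _ _ _))) (r22 _ (al_natm _ _ _)).
have E : al V (X ⊗ Z) Y ∘ al V X Z · Y
    = V ∙ alV X Z Y ∘ al V X (Z ⊗ Y) ∘ al (V ⊗ X) Z Y.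
  by rewrite pentagon -[RHS]compA -wlM alK tenm1 comp1m.
rewrite (r23 _ E) al_b (r22 _ (al_natr _ _ _)) pentagon.
rewrite -!compA -!wlM; congr ((_ ∙ _ ∘ _) ∘ _).
by rewrite !compA -(r33 _ (br_hexr c X Y Z)) alK compm1 -compA alVK comp1m.
Qed.

Lemma b_1r V X : b V X one ∘ ruV (V ⊗ X) = ruV V · X.
Proof.
apply: al_inj; rewrite (r22 _ (al_b _ _ _)).
rewrite al_ruV al_luV -wlM; congr (_ ∙ _); apply: homx => W x.
by rewrite -[LHS]comp1m -luK !compA (r21 _ (br_1r c _)) (r20 _ (ruVK _)).
Qed.

Lemma b_1l V X : b V one X ∘ ruV V · X = ruV (V ⊗ X).
Proof.
apply: al_inj; rewrite (r22 _ (al_b _ _ _)).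
rewrite al_ruV al_luV -wlM; congr (_ ∙ _); apply: homx => W x.
by rewrite -[LHS]comp1m -ruK !compA (r21 _ (br_1l c _)) (r20 _ (luVK _)).
Qed.

(** The hexagons, together with naturality, let a strand [W] pass an operation;
    in this lemma and the next three, the last letter of the name is the side
    of the strand on which the operation stands before the crossing. *)
Lemma b_mrgr V W X Y Z (g : hom (X ⊗ Y) Z) :
  b V W Z ∘ mrg g (V ⊗ W)
  = mrg g V · W ∘ b (V ⊗ X) W Y ∘ b V W X · Y.
Proof.
by rewrite !mrgE whM !compA b_hexl -!compA b_natr.
Qed.
Lemma b_mrgl V W X Y Z (g : hom (X ⊗ Y) Z) :
  b V Z W ∘ mrg g V · W
  = mrg g (V ⊗ W) ∘ b V X W · Y ∘ b (V ⊗ X) Y W.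
Proof.
by rewrite !mrgE whM !compA b_hexr -!compA b_natl.
Qed.
Lemma b_splr V W X Y Z (g : hom Z (X ⊗ Y)) :
  spl g V · W ∘ b V W Z
  = b (V ⊗ X) W Y ∘ b V W X · Y ∘ spl g (V ⊗ W).
Proof.
have E : b (V ⊗ X) W Y ∘ b V W X · Y ∘ alV (V ⊗ W) X Y
    = alV V X Y · W ∘ b V W (X ⊗ Y).
  rewrite -[LHS]comp1m -tenm1 -(alK V X Y) whM !compA (r32 _ (b_hexl _ _ _ _)).
  by rewrite alVK compm1.
by rewrite !splE whM (r32 _ E) b_natr !compA.
Qed.
Lemma b_spll V W X Y Z (g : hom Z (X ⊗ Y)) :
  spl g (V ⊗ W) ∘ b V Z W
  = b V X W · Y ∘ b (V ⊗ X) Y W ∘ spl g V · W.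
Proof.
have E : b V X W · Y ∘ b (V ⊗ X) Y W ∘ alV V X Y · W
    = alV (V ⊗ W) X Y ∘ b V (X ⊗ Y) W.
  rewrite -[LHS]comp1m -(alK (V ⊗ W) X Y) !compA (r32 _ (b_hexr _ _ _ _)).
  by rewrite -whM alVK tenm1 compm1.
by rewrite !splE whM (r32 _ E) b_natl !compA.
Qed.
Lemma ru_b V W : ru V · W ∘ b V W one = ru (V ⊗ W).
Proof.
rewrite -[LHS]compm1 -ruK !compA (r21 _ (b_1r _ _)) -[LHS]compA -whM ruVK.
by rewrite tenm1 comp1m.
Qed.
Lemma ru_bl V W : ru (V ⊗ W) ∘ b V one W = ru V · W.
Proof.
rewrite -[LHS]compm1 -tenm1 -ruK whM !compA (r21 _ (b_1l _ _)) -[LHS]compA ruVK.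
by rewrite comp1m.
Qed.

Lemma b_kilr V W X Y (g : hom (X ⊗ Y) one) :
  kil g V · W ∘ b (V ⊗ X) W Y ∘ b V W X · Y = kil g (V ⊗ W).
Proof. by rewrite !kilE whM !compA -b_mrgr (r21 _ (ru_b _ _)). Qed.
Lemma b_kill V W X Y (g : hom (X ⊗ Y) one) :
  kil g (V ⊗ W) ∘ b V X W · Y ∘ b (V ⊗ X) Y W = kil g V · W.
Proof. by rewrite !kilE whM !compA -b_mrgl (r21 _ (ru_bl _ _)). Qed.
Lemma b_crel V W X Y (g : hom one (X ⊗ Y)) :
  b V X W · Y ∘ b (V ⊗ X) Y W ∘ cre g V · W = cre g (V ⊗ W).
Proof. by rewrite !creE whM -(r23 _ (b_spll _ _ _)) b_1l. Qed.
Lemma b_cre1r V W X (g : hom one X) : b V W X ∘ cre1 g (V ⊗ W) = cre1 g V · W.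
Proof. by rewrite !cre1E whM (r22 _ (b_natr _ _ _)) b_1r. Qed.
Lemma b_cre1l V W X (g : hom one X) : b V X W ∘ cre1 g V · W = cre1 g (V ⊗ W).
Proof. by rewrite !cre1E whM (r22 _ (b_natl _ _ _)) b_1l. Qed.
Lemma b_kil1r V W X (g : hom X one) : kil1 g V · W ∘ b V W X = kil1 g (V ⊗ W).
Proof. by rewrite !kil1E whM compA -b_natr (r21 _ (ru_b _ _)). Qed.

Lemma kil_cre V X Y Z (g : hom (X ⊗ Y) one) (h : hom one (Y ⊗ Z)) :
  kil g V · Z ∘ cre h (V ⊗ X)
  = V ∙ (lu Z ∘ g · Z ∘ alV X Y Z ∘ X ∙ h ∘ ruV X).
Proof.
rewrite !wlM kilE creE mrgE splE !whM !compA.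
rewrite (r23 _ (pentagonV2 _ _ _ _)) (r22 _ (al_natr _ _ _)) al_ruV.
by rewrite -(r22 _ (alV_natm _ _ _)) (r21 _ (ru_alV _ _)).
Qed.

Section Rigid.
Variables (X X' : C) (e : hom (X' ⊗ X) one) (n : hom one (X ⊗ X')).
Hypothesis zigl : ru X ∘ X ∙ e ∘ al X X' X ∘ n · X ∘ luV X = idm.
Hypothesis zigr : lu X' ∘ e · X' ∘ alV X' X X' ∘ X' ∙ n ∘ ruV X' = idm.

(** The snake identities in words. *)
Lemma zigzagl V : kil e (V ⊗ X) ∘ cre n V · X = idm.
Proof.
transitivity (V ∙ (ru X ∘ X ∙ e ∘ al X X' X ∘ n · X ∘ luV X)).
  rewrite !wlM kilE creE mrgE splE !whM !compA.
  rewrite -ru_al !compA (r22 _ (al_natr _ _ _)) (r32 _ (pentagonV _ _ _ _)).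
  by rewrite (r22 _ (al_natm _ _ _)) al_luV.
by rewrite zigl tenm1.
Qed.

Lemma zigzagr V : kil e V · X' ∘ cre n (V ⊗ X') = idm.
Proof. by rewrite kil_cre zigr tenm1. Qed.

(** The partner X' of X undoes the passage of X through Y: create X and X', let
    X' pass through Y, and evaluate X' against the original X. *)
Lemma b_rigidK V Y :
  (kil e (V ⊗ X ⊗ Y) ∘ b (V ⊗ X) X' Y · X ∘ cre n V · Y · X) ∘ b V X Y = idm.
Proof.
rewrite !compA -b_nat.
have -> : b (V ⊗ X) X' Y · X ∘ b (V ⊗ X ⊗ X') X Y ∘ cre n V · X · Y 
  = (b (V ⊗ X) X' Y · X ∘ b (V ⊗ X ⊗ X') X Y) ∘ cre n V · X · Y by rewrite compA.
by rewrite -compA b_kill -whM zigzagl tenm1.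
Qed.
Lemma b_rigidVK V Y :
  b V X Y ∘ (kil e (V ⊗ X ⊗ Y) ∘ b (V ⊗ X) X' Y · X ∘ cre n V · Y · X) = idm.
Proof.
rewrite -(r22 _ (kil_nat _ _)) -!whM b_crel.
by rewrite zigzagl.
Qed.

(** The inverse of the braiding of [X] with [Y], with all constraints written
    out so that it can be evaluated on basis vectors. *)
Definition rigid_br Y : hom (Y ⊗ X) (X ⊗ Y) :=
  locked (ru (X ⊗ Y) ∘ (X ⊗ Y) ∙ e ∘ al (X ⊗ Y) X' X ∘ alV X Y X' · X
          ∘ X ∙ br c X' Y · X ∘ al X X' Y · X ∘ n · Y · X ∘ luV Y · X).
Lemma rigid_br_def Y : rigid_br Y
  = ru (X ⊗ Y) ∘ (X ⊗ Y) ∙ e ∘ al (X ⊗ Y) X' X ∘ alV X Y X' · X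
    ∘ X ∙ br c X' Y · X ∘ al X X' Y · X ∘ n · Y · X ∘ luV Y · X.
Proof. by rewrite /rigid_br -lock. Qed.

Lemma lu_b Y Z : lu Z · Y ∘ b one Y Z = br c Y Z ∘ lu Y · Z.
Proof.
rewrite -lu_al bE mrgE !compA (r20 _ (alVK _ _ _)) -lu_al.
by rewrite (r22 _ (lu_nat _)).
Qed.

Lemma rigid_brE Y : rigid_br Y ∘ lu Y · X
  = lu X · Y ∘ kil e (one ⊗ X ⊗ Y) ∘ b (one ⊗ X) X' Y · X ∘ cre n one · Y · X.
Proof.
rewrite -(r22 _ (kil_nat _ _)) -(r22 _ (w22 _ (b_nat _ _ _))).
have -> : cre n one = alV one X X' ∘ one ∙ n ∘ ruV one.
  by rewrite creE splE compA.
rewrite !whM -(lu_al X X') !whM !compA.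
rewrite (r20 _ (w20 _ (w20 _ (alVK _ _ _)))).
rewrite (r22 _ (w22 _ (w22 _ (lu_nat _)))).
have -> : lu one · Y · X ∘ ruV one · Y · X = idm.
  by rewrite lu_one -!whM ruVK !tenm1.
rewrite compm1 rigid_br_def kilE mrgE bE mrgE !whM !compA.
by rewrite -[_ ∘ lu Y · X]whM luK tenm1 compm1.
Qed.

Lemma rigid_brK Y : rigid_br Y ∘ br c X Y = idm.
Proof.
rewrite -[LHS]compm1 -tenm1 -(luVK X) whM !compA -(r22 _ (lu_b _ _)).
rewrite -[rigid_br Y ∘ _]compA rigid_brE !compA.
have := congr1 (fun z => z ∘ luV X · Y) (b_rigidK one Y); rewrite !compA => ->.
by rewrite comp1m -whM luVK tenm1.
Qed.
Lemma rigid_brVK Y : br c X Y ∘ rigid_br Y = idm.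
Proof.
rewrite -[LHS]compm1 -tenm1 -(luVK Y) whM !compA (r21 _ (rigid_brE _)) !compA.
rewrite -(r22 _ (lu_b _ _)).
have := congr1 (fun z => z ∘ luV Y · X) (b_rigidVK one Y); rewrite !compA => ->.
by rewrite comp1m -whM luVK tenm1.
Qed.
End Rigid.

Section Inverse.
Variable cV : forall X Y, hom (Y ⊗ X) (X ⊗ Y).
Hypothesis cK : forall X Y, cV X Y ∘ br c X Y = idm.
Hypothesis cVK : forall X Y, br c X Y ∘ cV X Y = idm.

Definition bV V X Y : hom (V ⊗ Y ⊗ X) (V ⊗ X ⊗ Y) :=
  locked (alV V X Y ∘ mrg (cV X Y) V).
Lemma bVE V X Y : bV V X Y = alV V X Y ∘ mrg (cV X Y) V.
Proof. by rewrite /bV -lock. Qed.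
Lemma bK V X Y : bV V X Y ∘ b V X Y = idm.
Proof.
rewrite bVE bE !mrgE !compA (r20 _ (alVK _ _ _)).
by rewrite -[V ∙ cV _ _ ∘ _]compA -wlM cK tenm1 comp1m alK.
Qed.
Lemma bVK V X Y : b V X Y ∘ bV V X Y = idm.
Proof.
rewrite bVE bE !mrgE !compA (r20 _ (alVK _ _ _)).
by rewrite -[V ∙ c _ _ ∘ _]compA -wlM cVK tenm1 comp1m alK.
Qed.
Lemma injl X Y W (f : hom X Y) (g : hom Y X) (x y : hom W X) :
  g ∘ f = idm -> f ∘ x = f ∘ y -> x = y.
Proof. by move=> gf /(congr1 (comp g)); rewrite -!compA gf !comp1m. Qed.
Lemma injr X Y W (f : hom X Y) (g : hom Y X) (x y : hom Y W) :
  f ∘ g = idm -> x ∘ f = y ∘ f -> x = y.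
Proof. by move=> gf /(congr1 (fun z => comp z g)); rewrite !compA gf !compm1. Qed.

Lemma bV_nat V W X Y (f : hom V W) :
  bV W X Y ∘ f · Y · X = f · X · Y ∘ bV V X Y.
Proof.
apply: (injl (bK _ _ _)); rewrite (r20 _ (bVK _ _ _)) (r22 _ (b_nat _ _ _)).
by rewrite bVK compm1.
Qed.
Lemma bV_spll V W X Y Z (g : hom Z (X ⊗ Y)) :
  bV V X W · Y ∘ spl g (V ⊗ W) = b (V ⊗ X) Y W ∘ spl g V · W ∘ bV V Z W.
Proof.
apply: (injl (w20 Y (bK V X W))); rewrite (r20 _ (w20 _ (bVK _ _ _))).
by rewrite -(r23 _ (b_spll _ _ _)) bVK compm1.
Qed.
Lemma bV_splr V W X Y Z (g : hom Z (X ⊗ Y)) :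
  spl g (V ⊗ W) ∘ bV V W Z = bV V W X · Y ∘ bV (V ⊗ X) W Y ∘ spl g V · W.
Proof.
apply: (injr (bVK V W Z)); rewrite !compA bK compm1 b_splr.
by rewrite (r20 _ (bK _ _ _)) (r20 _ (w20 _ (bK _ _ _))).
Qed.
Lemma bV_mrgr V W X Y Z (g : hom (X ⊗ Y) Z) :
  mrg g (V ⊗ W) ∘ bV V W X · Y ∘ bV (V ⊗ X) W Y = bV V W Z ∘ mrg g V · W.
Proof.
apply: (injl (bK V W Z)); rewrite (r20 _ (bVK _ _ _)) (r23 _ (b_mrgr _ _ _)).
by rewrite (r20 _ (w20 _ (bVK _ _ _))) bVK compm1.
Qed.
Lemma bV_mrgl V W X Y Z (g : hom (X ⊗ Y) Z) :
  mrg g V · W ∘ bV (V ⊗ X) Y W ∘ bV V X W · Y = bV V Z W ∘ mrg g (V ⊗ W).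
Proof.
apply: (injl (bK V Z W)); rewrite (r20 _ (bVK _ _ _)) (r23 _ (b_mrgl _ _ _)).
by rewrite (r20 _ (bVK _ _ _)) -whM bVK tenm1 compm1.
Qed.
Lemma bV_cre1r V W X (g : hom one X) : bV V W X ∘ cre1 g V · W = cre1 g (V ⊗ W).
Proof. by rewrite -b_cre1r (r20 _ (bK _ _ _)). Qed.
Lemma bV_cre1l V W X (g : hom one X) : bV V X W ∘ cre1 g (V ⊗ W) = cre1 g V · W.
Proof. by rewrite -b_cre1l (r20 _ (bK _ _ _)). Qed.
Lemma bV_kil1r V W X (g : hom X one) : kil1 g (V ⊗ W) ∘ bV V W X = kil1 g V · W.
Proof. by rewrite -b_kil1r compA bVK compm1. Qed.
Lemma bV_kilr V W X Y (g : hom (X ⊗ Y) one) :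
  kil g (V ⊗ W) ∘ bV V W X · Y = kil g V · W ∘ b (V ⊗ X) W Y.
Proof. by rewrite -b_kilr !compA -whM bVK tenm1 compm1. Qed.
Lemma bV_hexr V X Y Z :
  bV V (X ⊗ Y) Z ∘ al (V ⊗ Z) X Y
  = al V X Y · Z ∘ bV (V ⊗ X) Y Z ∘ bV V X Z · Y.
Proof.
apply: (injl (bK V _ Z)); rewrite (r20 _ (bVK _ _ _)) (r23 _ (esym (b_hexr _ _ _ _))).
by rewrite (r20 _ (bVK _ _ _)) -whM bVK tenm1 compm1.
Qed.
Lemma bV_natr V X X' Y (g : hom X X') :
  bV V X' Y ∘ (V ⊗ Y) ∙ g = V ∙ g · Y ∘ bV V X Y.
Proof.
apply: (injl (bK V X' Y)); rewrite (r20 _ (bVK _ _ _)) (r22 _ (b_natl _ _ _)).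
by rewrite bVK compm1.
Qed.

Section Drinfeld.
Variables (X X' X'' : C).
Variables (e : hom (X' ⊗ X) one) (n : hom one (X ⊗ X')).
Variables (e' : hom (X'' ⊗ X') one) (n' : hom one (X' ⊗ X'')).
Hypothesis zigl : ru X ∘ X ∙ e ∘ al X X' X ∘ n · X ∘ luV X = idm.
Hypothesis zigl' : ru X' ∘ X' ∙ e' ∘ al X' X'' X' ∘ n' · X' ∘ luV X' = idm.

(** The comparison of an object with its double dual. *)
Definition drinfeld : hom X X'' :=
  lu X'' ∘ (e ∘ br c X X') · X'' ∘ alV X X' X'' ∘ X ∙ n' ∘ ruV X.
Definition drinfeldV : hom X'' X :=
  lu X ∘ (kil e' (one ⊗ X) ∘ bV (one ⊗ X) X'' X' ∘ cre n one · X'') ∘ luV X''.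

(** The braidings cancel, and two snake identities remain. *)
Lemma drinfeldK : drinfeldV ∘ drinfeld = idm.
Proof.
have dE V : V ∙ drinfeld
    = kil e V · X'' ∘ b V X X' · X'' ∘ cre n' (V ⊗ X).
  rewrite /drinfeld -kil_cre -[RHS]compA -whM; congr (_ · _ ∘ _).
  by rewrite !kilE bE !mrgE !compA (r20 _ (alVK _ _ _)) wlM !compA.
rewrite /drinfeldV !compA luV_nat (r22 _ (swap _ _)) (r22 _ (bV_natr _ _ _)).
rewrite dE !whM !compA (r22 _ (kil_nat _ _)) (r22 _ (kil_nat _ _)).
rewrite (r20 _ (zigzagl zigl' _)) (r20 _ (bVK _ _ _)) .
by rewrite (r20 _ (zigzagl zigl _)) luVK.
Qed.
End Drinfeld.
End Inverse.
End Calculus.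
Local Close Scope cat_scope.

(** * The monoidal category of comodules *)

Ltac clin :=
  cbv beta;
  lazymatch goal with
  | |- lin (fun x => x) => apply: lin_id
  | |- lin (tmap _ _) => apply: lin_tmap; clin
  | |- lin (cf ?f) => exact: (cf_lin f)
  | |- lin (@com_assoc _ _ _ _ _) => exact: lin_assoc
  | |- lin (@com_assocV _ _ _ _ _) => exact: lin_assocV
  | |- lin (fun x => ?f (@?E x)) =>
      lazymatch E with
      | (fun x => x) => clin0 f
      | _ => apply: (lin_comp (f := f) (g := E)); [clin|clin]
      end
  | |- _ => lin
  end
with clin0 f := change (lin f); clin.

Ltac tmap_eval := rewrite tmapE; [|clin|clin].

Section TmapB.
Variables (k : fieldType) (V W V' W' : lmodType k) (f : V -> V') (g : W -> W').
Hypotheses (lf : lin f) (lg : lin g).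
Lemma tmapr_b (Y : finType) v w (b : Y -> k) (u : Y -> W') :
  g w = \sum_y b y *: u y -> tmap f g (v \ox w) = \sum_y b y *: (f v \ox u y).
Proof.
move=> E; rewrite tmapE // E (lin_bigsum (f := otimes _)); last by lin.
by apply: eq_bigr => y _; rewrite (linZ (f := otimes _)); last by lin.
Qed.
Lemma tmapl_b (Y : finType) v w (b : Y -> k) (u : Y -> V') :
  f v = \sum_y b y *: u y -> tmap f g (v \ox w) = \sum_y b y *: (u y \ox g w).
Proof.
move=> E; rewrite tmapE // E (lin_bigsum (f := fun x => x \ox _)); last by lin.
by apply: eq_bigr => y _; rewrite (linZ (f := fun x => x \ox _)); last by lin.
Qed.
End TmapB.

Section MonCat.
Variables (k : fieldType) (A : dualQuasiHopf k).
Local Notation Phi a b c := (dqh_phi A (a \ox b \ox c)).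
Let HA := dqh_bialg (dqh_axioms A).
Implicit Types M N P Q : comod A.

Lemma mbasis_cone : @mbasis _ _ (cone A) _ (@mone k A) (fun=> (1 : k^o)).
Proof. exact: mbasis_unit. Qed.
Lemma lin_clu M : lin (@com_lunit _ A M).
Proof. by apply: lin_tlift; split=> ?; [apply: (@lin_scalel _ k^o)|]; lin. Qed.
Lemma lin_cru M : lin (@com_runit _ A M).
Proof. by apply: lin_tlift; split=> ?; [|apply: (@lin_scalel _ k^o)]; lin. Qed.
Lemma cluE M (a : k) (m : M) : @com_lunit _ A M ((a : k^o) \ox m) = a *: m.
Proof. by apply: tliftE; split=> ?; [apply: (@lin_scalel _ k^o)|]; lin. Qed.
Lemma cruE M (a : k) (m : M) : @com_runit _ A M (m \ox (a : k^o)) = a *: m.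
Proof. by apply: tliftE; split=> ?; [|apply: (@lin_scalel _ k^o)]; lin. Qed.

Definition cluf M (m : M) : k^o \ox M := (1 : k^o) \ox m.
Definition cruf M (m : M) : M \ox k^o := m \ox (1 : k^o).
Lemma cluf_mor M : @is_comorphism _ _ M (cten (cone A) M) (@cluf M).
Proof.
apply: comor_crit; first by rewrite /cluf; lin.
move=> I c e be j; rewrite (mb_coact (mbasis_tens mbasis_cone be) (tt, j)).
rewrite sum_pair sum_unit; apply: eq_bigr => i _.
by rewrite /mprod /mone /= (dqb_mul1l HA).
Qed.
Lemma cruf_mor M : @is_comorphism _ _ M (cten M (cone A)) (@cruf M).
Proof.
apply: comor_crit; first by rewrite /cruf; lin.
move=> I c e be j; rewrite (mb_coact (mbasis_tens be mbasis_cone) (j, tt)).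
rewrite sum_pair; apply: eq_bigr => i _.
by rewrite sum_unit /mprod /mone /= (dqb_mul1r HA).
Qed.
Lemma clufK M : cancel (@cluf M) (@com_lunit _ A M).
Proof. by move=> m; rewrite /cluf cluE scale1r. Qed.
Lemma crufK M : cancel (@cruf M) (@com_runit _ A M).
Proof. by move=> m; rewrite /cruf cruE scale1r. Qed.
Lemma cluK M : cancel (@com_lunit _ A M) (@cluf M).
Proof.
apply: (extT (F := fun t => cluf (com_lunit t)) (G := fun t => t)) => [||a m].
- by apply: lin_comp; [rewrite /cluf; lin | exact: lin_clu].
- exact: lin_id.
rewrite cluE /cluf -[in RHS](mulr1 a) (linZ (f := otimes _)); last by lin.
by rewrite -(linZ (f := fun x => x \ox m)) //; lin.
Qed.
Lemma cruK M : cancel (@com_runit _ A M) (@cruf M).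
Proof.
apply: (extT (F := fun t => cruf (com_runit t)) (G := fun t => t)) => [||m a].
- by apply: lin_comp; [rewrite /cruf; lin | exact: lin_cru].
- exact: lin_id.
rewrite cruE /cruf -[in RHS](mulr1 a) (linZ (f := fun x => x \ox _)); last by lin.
by rewrite -(linZ (f := otimes m)) //; lin.
Qed.
Definition cluV M := Chom (cluf_mor M).
Definition cruV M := Chom (cruf_mor M).
Definition clu M := Chom (inv_mor (cluf_mor M) (@lin_clu M) (@clufK M) (@cluK M)).
Definition cru M := Chom (inv_mor (cruf_mor M) (@lin_cru M) (@crufK M) (@cruK M)).

Lemma cassoc_nat M M' N N' P P' (f : chom M M') (g : chom N N') (h : chom P P') t :
  cassoc M' N' P' (tmap (tmap f g) h t) = tmap f (tmap g h) (cassoc M N P t).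
Proof.
have l1 : lin (tmap (tmap f g) h) by lin.
have l2 : lin (tmap f (tmap g h)) by lin.
apply: (ext3 (F := fun t => cassoc M' N' P' (tmap (tmap f g) h t))
  (G := fun t => tmap f (tmap g h) (cassoc M N P t))) =>
    [||I c e be J d f' bf L r s bs i j l].
- by clin.
- by clin.
rewrite !tmapE; [|clin..].
etransitivity; first exact:
  (assoc_b (mbasis_map (cfP f) be) (mbasis_map (cfP g) bf) (mbasis_map (cfP h) bs) i j
    l).
rewrite [cassoc _ _ _ _](assoc_b be bf bs) (lin_bigsum _ _ _ l2); apply: eq_bigr => p _.
by rewrite (linZ _ _ l2) !tmapE //; clin.
Qed.

(** On basis vectors this is the cocycle identity. *)
Lemma cpentagon M N P Q t :
  cassoc M N (cten P Q) (cassoc (cten M N) P Q t) =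
  tmap id (cassoc N P Q) (cassoc M (cten N P) Q (tmap (cassoc M N P) id t)).
Proof.
apply: (ext4 (F := fun t => cassoc M N (cten P Q) (cassoc (cten M N) P Q t))
  (G := fun t => tmap id (cassoc N P Q) (cassoc M (cten N P) Q
    (tmap (cassoc M N P) id t)))).
- by clin.
- by clin.
move=> I c e be J d f bf L h g bg T r s bs i j l u.
rewrite /= tmapE; [|exact: lin_assoc|lin].
have := @assoc_b _ _ (cten M N) P Q _ _ _ (mbasis_tens be bf) _ _ _ bg _ _ _ bs (i,j)
  l u.
rewrite /= => ->.
rewrite (push _ (@lin_assoc _ _ M N (cten P Q)) (fun p : I * J * L * T =>
  @assoc_b _ _ M N (cten P Q) _ _ _ be _ _ _ bf _ _ _ (mbasis_tens bg bs) p.1.1.1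
    p.1.1.2 (p.1.2, p.2))).
rewrite (assoc_b be bf bg).
have l1 := linD_ext' (s u) (@lin_assoc _ A M (cten N P) Q).
rewrite (push _ l1 (fun p : I * J * L =>
  @assoc_b _ _ M (cten N P) Q _ _ _ be _ _ _ (mbasis_tens bf bg) _ _ _ bs p.1.1
    (p.1.2, p.2) u)).
have l2 : lin (tmap (fun x : M => x) (@com_assoc _ A N P Q)) by clin.
rewrite (push _ l2 (fun p : I * J * L * (I * (J * L) * T) =>
  tmapr_b (@lin_id _ M) (@lin_assoc _ A N P Q) (e p.2.1.1)
    (assoc_b bf bg bs p.2.1.2.1 p.2.1.2.2 p.2.2))).
flatten_both.
(* First the indices of the resulting basis vector, then the summation indices
   of the cocycle identity. *)
pull 4%N 3%N as i'. pull 4%N 6%N as j'. pull 4%N 6%N as l'. pull 4%N 6%N as u'.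
etransitivity; last (etransitivity; first exact: (congr1
  (fun x => x *: (e i' \ox (f j' \ox (g l' \ox s u'))))
  (cocycle_mat (mb_mult be) (mb_mult bf) (mb_mult bg) (mb_mult bs) i' j' l' u' i j l
    u))).
  by symmetry; etransitivity; [distr_scale|]; do 4! (refine (eq_sum _) => ?); rewrite
    mulrC.
etransitivity; [distr_scale|].
pulls [:: (0, 0); (0, 2); (0, 0); (0, 1); (0, 0); (0, 0)]%N.
rewrite /mprod /=; congr (_ *: _); ring.
Qed.

Lemma ext_ru M (W : lmodType k) (F G : M \ox k^o -> W) : lin F -> lin G ->
  (forall m : M, F (m \ox (1 : k^o)) = G (m \ox (1 : k^o))) -> forall t, F t = G t.
Proof.
move=> lF lG E; apply: extT => // m a.
have -> : m \ox a = @GRing.scale k (Defs_tensor__canonical__GRing_Lmodule M k^o)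
  (a : k) (m \ox (1 : k^o)).
  by rewrite -(linZ (f := otimes m)) ?[_ *: _]mulr1 //; lin.
by rewrite (linZ _ _ lF) (linZ _ _ lG) E.
Qed.
Lemma ext_lu M (W : lmodType k) (F G : k^o \ox M -> W) : lin F -> lin G ->
  (forall m : M, F ((1 : k^o) \ox m) = G ((1 : k^o) \ox m)) -> forall t, F t = G t.
Proof.
move=> lF lG E; apply: extT => // a m.
have -> : a \ox m = @GRing.scale k (Defs_tensor__canonical__GRing_Lmodule k^o M)
  (a : k) ((1 : k^o) \ox m).
  by rewrite -(linZ (f := fun x => x \ox m)) ?[_ *: _]mulr1 //; lin.
by rewrite (linZ _ _ lF) (linZ _ _ lG) E.
Qed.

Lemma assoc_triv M N P (I : finType) (c : I -> I -> A) (e : I -> M) (be : mbasis c e)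
 (J : finType) (d : J -> J -> A) (f : J -> N) (bf : mbasis d f)
 (L : finType) (h : L -> L -> A) (g : L -> P) (bg : mbasis h g) i j l :
  (forall i' j' l', Phi (c i' i) (d j' j) (h l' l) =
    ((i' == i) && (j' == j) && (l' == l))%:R) ->
  @com_assoc _ A M N P (e i \ox f j \ox g l) = e i \ox (f j \ox g l).
Proof.
move=> E; rewrite (assoc_b be bf bg) -[RHS](delta_sum (i, j, l)
  (fun p : I * J * L => e p.1.1 \ox (f p.1.2 \ox g p.2))).
by apply: eq_bigr => -[[i' j'] l'] _; rewrite E !xpair_eqE.
Qed.

(** The reassociator is trivial when its middle argument is the unit; for the
    other two positions see [clu_al] and [cru_al]. *)
Lemma ctriangle M N t :
  tmap id (clu N) (cassoc M (cone A) N t) = tmap (cru M) id t.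
Proof.
have l1 : lin (fun t => tmap (fun x : M => x) (clu N) (cassoc M (cone A) N t)) by clin.
have l2 : lin (tmap (cru M) (fun x : N => x)) by clin.
apply: (extT l1 l2) => v n; move: v.
apply: (ext_ru (linD_ext' n l1) (linD_ext' n l2)) => m.
move: m; apply: ext1 => [||I c e be i].
- exact: (lin_comp (linD_ext' n l1) (@lin_otimesl _ _ _ _ _ _ (@lin_id _ _))).
- exact: (lin_comp (linD_ext' n l2) (@lin_otimesl _ _ _ _ _ _ (@lin_id _ _))).
move: n; apply: ext1 => [||J d f bf j].
- exact: (linD_ext _ l1).
- exact: (linD_ext _ l2).
rewrite [cassoc _ _ _ _](assoc_triv be mbasis_cone bf (j := tt)) => [|i' [] j'].
  by do 2 tmap_eval; rewrite /= cluE cruE !scale1r.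
by rewrite (dqb_phi1 HA) (mb_mult be).2 (mb_mult bf).2 -natrM mulnb andbT.
Qed.

Lemma clu_al M N t : clu (cten M N) (cassoc (cone A) M N t) = tmap (clu M) id t.
Proof.
have l1 : lin (fun t => clu (cten M N) (cassoc (cone A) M N t)) by clin.
have l2 : lin (tmap (clu M) (fun x : N => x)) by clin.
apply: (extT l1 l2) => v n; move: v.
apply: (ext_lu (linD_ext' n l1) (linD_ext' n l2)) => m.
move: m; apply: ext1 => [||I c e be i].
- exact: (lin_comp (linD_ext' n l1) (@lin_otimesr _ _ _ _ _ _ (@lin_id _ _))).
- exact: (lin_comp (linD_ext' n l2) (@lin_otimesr _ _ _ _ _ _ (@lin_id _ _))).
move: n; apply: ext1 => [||J d f bf j].
- exact: (linD_ext _ l1).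
- exact: (linD_ext _ l2).
rewrite [cassoc _ _ _ _](assoc_triv mbasis_cone be bf (i := tt)) => [|[] i' j'].
  by tmap_eval; rewrite [clu _ _](cluE (M:=cten M N)) scale1r /= cluE scale1r.
by rewrite (phi_1l (mb_mult be) (mb_mult bf)) -natrM mulnb.
Qed.
Lemma cru_al M N t : tmap id (cru N) (cassoc M N (cone A) t) = cru (cten M N) t.
Proof.
have l1 : lin (fun t => tmap (fun x : M => x) (cru N) (cassoc M N (cone A) t)) by clin.
have l2 : lin (cru (cten M N)) by clin.
apply: (@ext_ru (cten M N) _ _ _ l1 l2) => m.
move: m; apply: ext2 => [||I c e be J d f bf i j].
- exact: (lin_comp l1 (@lin_otimesl _ _ _ _ _ _ (@lin_id _ _))).
- exact: (lin_comp l2 (@lin_otimesl _ _ _ _ _ _ (@lin_id _ _))).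
rewrite [cassoc _ _ _ _](assoc_triv be bf mbasis_cone (l := tt)) => [|i' j' []].
  by tmap_eval; rewrite [cru (cten M N) _](cruE (M:=cten M N)) scale1r /= cruE scale1r.
by rewrite (phi_1r (mb_mult be) (mb_mult bf)) -natrM mulnb andbT.
Qed.

Definition comcat : moncat.
refine (@Moncat (comod A) (@chom k A) (@cid k A) (@ccomp k A) _ _ _ (@cten k A) (cone A)
  (fun M M' N N' => @ctmap k A M N M' N') _ _ (@cassoc k A) (@cassocV k A) _ _ _ clu
    cluV _ _ _ cru cruV _ _ _ _ _ _ _ _).
- by move=> *; apply: chom_eq.
- by move=> *; apply: chom_eq.
- by move=> *; apply: chom_eq.
- move=> X Y; apply: chom_eq => t; move: t.
  by apply: extT => [||v w] /=; [clin|clin|rewrite tmapE].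
- move=> X X' X'' Y Y' Y'' f' f g' g; apply: chom_eq => t; move: t.
  apply: (extT (F := tmap (fun x => f' (f x)) (fun x => g' (g x)))
    (G := fun t => tmap f' g' (tmap f g t))) => [||v w]; [clin|clin|].
  by rewrite !tmapE //; clin.
- by move=> X Y Z; apply: chom_eq => t; apply: assocK.
- by move=> X Y Z; apply: chom_eq => t; apply: assocVK.
- by move=> *; apply: chom_eq => t; apply: cassoc_nat.
- by move=> X; apply: chom_eq => t; apply: cluK.
- by move=> X; apply: chom_eq => t; apply: clufK.
- move=> X Y f; apply: chom_eq => t; move: t.
  apply: (extT (F := fun t => clu Y (tmap (fun x : k^o => x) f t))
    (G := fun t => f (clu X t))) => [||v w]; [clin|clin|].
  by tmap_eval; rewrite /= !cluE (linZ _ _ (cf_lin f)).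
- by move=> X; apply: chom_eq => t; apply: cruK.
- by move=> X; apply: chom_eq => t; apply: crufK.
- move=> X Y f; apply: chom_eq => t; move: t.
  apply: (extT (F := fun t => cru Y (tmap f (fun x : k^o => x) t))
    (G := fun t => f (cru X t))) => [||v w]; [clin|clin|].
  by tmap_eval; rewrite /= !cruE (linZ _ _ (cf_lin f)).
- by move=> *; apply: chom_eq => t; apply: cpentagon.
- by move=> *; apply: chom_eq => t; apply: ctriangle.
- by move=> *; apply: chom_eq => t; apply: clu_al.
- by move=> *; apply: chom_eq => t; apply: cru_al.
apply: chom_eq => t; move: t; apply: (extT (F := clu (cone A)) (G := cru (cone A))) =>
  [||v w]; [clin|clin|].
transitivity ((v : k) * w); first exact: (cluE (M := cone A)).
by rewrite mulrC; symmetry; exact: (cruE (M := cone A)).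
Defined.
End MonCat.

(** * The braiding of comodules *)

Section Braid.
Variables (k : fieldType) (A : dualQuasiHopf k).
Variables (sigma : {scalar (A \ox A)%type}) (hs : co_quasi_triangular sigma).
Local Notation Phi a b c := (dqh_phi A (a \ox b \ox c)).
Local Notation PhiV a b c := (dqh_phiV A (a \ox b \ox c)).
Local Notation Sig a b := (sigma (a \ox b)).
Implicit Types M N P Q : comod A.

Lemma lin_braid M N : lin (@com_braiding _ A sigma M N).
Proof. rewrite /com_braiding; lin. Qed.

Section B2.
Variables (M N : comod A).
Variables (I : finType) (c : I -> I -> A) (e : I -> M) (be : mbasis c e).
Variables (J : finType) (d : J -> J -> A) (f : J -> N) (bf : mbasis d f).

Lemma braid_b i j : @com_braiding _ A sigma M N (e i \ox f j)
  = \sum_(p : I * J) Sig (c p.1 i) (d p.2 j) *: (f p.2 \ox e p.1).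
Proof.
rewrite /com_braiding tliftE; last by lin.
rewrite (mb_coact be) tlift_sum; last by lin.
rewrite !sum_pair; apply: eq_bigr => i' _; rewrite tliftE; last by lin.
rewrite (mb_coact bf) tlift_sum; last by lin.
by apply: eq_bigr => j' _; rewrite tliftE; last by lin.
Qed.

Lemma bij_swap : bijective (fun p : I * J => (p.2, p.1)).
Proof. by exists (fun p => (p.2, p.1)) => -[]. Qed.

Lemma sig_comm i j i' j' :
  \sum_s \sum_t Sig (c s i) (d t j) *: (d j' t ** c i' s)
  = \sum_s \sum_t Sig (c i' s) (d j' t) *: (c s i ** d t j).
Proof.
have E := cqt_comm hs (c i' i) (d j' j).
have mc := mb_mult be; have md := mb_mult bf.
by etransitivity; [|etransitivity; [exact: (esym E)|]]; [symmetry|]; expand_all.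
Qed.

Lemma braid_mor_b i j :
  @coact _ _ (cten N M) (@com_braiding _ A sigma M N (e i \ox f j))
  = tmap (@com_braiding _ A sigma M N) id (@coact _ _ (cten M N) (e i \ox f j)).
Proof.
apply: (@comor_mat _ _ (cten M N) (cten N M) _ _ _ _
  (fun p : I * J => e p.1 \ox f p.2) _ _ _ (@lin_braid M N)
  (mbasis_tens be bf)
  (@mbasis_reidx _ _ (cten N M) _ _ _ _ _ bij_swap (mbasis_tens bf be))
  (fun p => braid_b p.1 p.2) _ (i, j)).
move=> [i1 j1] [i2 j2]; rewrite !sum_pair; exact: sig_comm.
Qed.
End B2.

Lemma braid_mor M N : @is_comorphism _ _ (cten M N) (cten N M)
  (@com_braiding _ A sigma M N).
Proof.
split; first exact: lin_braid.
apply: ext2 => [||I c e be J d f bf i j]; last exact: (braid_mor_b be bf).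
  by apply: lin_comp; [exact: (@coact_lin _ _ (cten N M))|exact: lin_braid].
apply: lin_comp; last exact: (@coact_lin _ _ (cten M N)).
by apply: lin_tmap => //; exact: lin_braid.
Qed.
Definition cbr M N := Chom (braid_mor M N).

Lemma cbr_nat M M' N N' (f : chom M M') (g : chom N N') t :
  cbr M' N' (tmap f g t) = tmap g f (cbr M N t).
Proof.
have l2 : lin (tmap g f) by clin.
apply: (ext2 (F := fun t => cbr M' N' (tmap f g t))
  (G := fun t => tmap g f (cbr M N t)))
  => [||I c e be J d f' bf i j]; [clin|clin|].
tmap_eval; etransitivity; first exact: (braid_b (mbasis_map (cfP f) be)
  (mbasis_map (cfP g) bf) i j).
rewrite [cbr _ _ _](braid_b be bf) (lin_bigsum _ _ _ l2); apply: eq_bigr => p _.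
by rewrite (linZ _ _ l2); tmap_eval.
Qed.

Lemma sig_mulr (I J L : finType) c d h : @multmat k A I c -> @multmat k A J d ->
  @multmat k A L h -> forall i j l i' j' l',
  Sig (c i' i) (d j' j ** h l' l) =
  \sum_i1 \sum_i2 \sum_i3 \sum_i4 \sum_j1 \sum_j2 \sum_j3 \sum_l1 \sum_l2 \sum_l3
   PhiV (d j' j1) (h l' l1) (c i' i1) * Sig (c i1 i2) (h l1 l2)
   * Phi (d j1 j2) (c i2 i3) (h l2 l3) * Sig (c i3 i4) (d j2 j3)
   * PhiV (c i4 i) (d j3 j) (h l3 l).
Proof. by move=> mc md mh i j l i' j' l'; rewrite (cqt_mulr hs); expand_all. Qed.
Lemma sig_mull (I J L : finType) c d h : @multmat k A I c -> @multmat k A J d ->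
  @multmat k A L h -> forall i j l i' j' l',
  Sig (c i' i ** d j' j) (h l' l) =
  \sum_i1 \sum_i2 \sum_i3 \sum_j1 \sum_j2 \sum_j3 \sum_l1 \sum_l2 \sum_l3 \sum_l4
   Phi (h l' l1) (c i' i1) (d j' j1) * Sig (c i1 i2) (h l1 l2)
   * PhiV (c i2 i3) (h l2 l3) (d j1 j2) * Sig (d j2 j3) (h l3 l4)
   * Phi (c i3 i) (d j3 j) (h l4 l).
Proof. by move=> mc md mh i j l i' j' l'; rewrite (cqt_mull hs); expand_all. Qed.

(** On basis vectors this is the rule for [sigma a (bc)]. *)
Lemma cbr_tensr M N P t : cbr M (cten N P) t =
  cassocV N P M (tmap id (cbr M P) (cassoc N M P
    (tmap (cbr M N) id (cassocV M N P t)))).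
Proof.
have l1 : lin (tmap (cbr M N) (fun x : P => x)) by clin.
have l3 : lin (tmap (fun x : N => x) (cbr M P)) by clin.
apply: (ext3' (F := cbr M (cten N P)) (G := fun t => cassocV N P M
  (tmap id (cbr M P) (cassoc N M P (tmap (cbr M N) id (cassocV M N P t))))))
  => [||I c e be J d f bf L h g bg i j l].
- by clin.
- by clin.
etransitivity; first exact: (@braid_b M (cten N P) _ _ _ be _ _ _ (mbasis_tens bf bg)
  i (j,l)).
rewrite [cassocV M N P _](assocV_b be bf bg).
rewrite (push _ l1 (fun p : I * J * L => tmapl_b (cf_lin (cbr M N)) (@lin_id _ P)
  (g p.2) (braid_b be bf p.1.1 p.1.2))).
rewrite (push _ (cf_lin (cassoc N M P)) (fun p : I * J * L * (I * J) =>
  assoc_b bf be bg p.2.2 p.2.1 p.1.2)).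
rewrite (push _ l3 (fun p : I * J * L * (I * J) * (J * I * L) =>
  tmapr_b (@lin_id _ N) (cf_lin (cbr M P)) (f p.2.1.1) (braid_b be bg p.2.1.2 p.2.2))).
rewrite (push _ (cf_lin (cassocV N P M)) (fun p : I * J * L * (I * J) * (J * I * L) *
  (I * L) =>
  assocV_b bf bg be p.1.2.1.1 p.2.2 p.2.1)).
flatten_both; rewrite /mprod /=.
under eq_bigr => i' _ do under eq_bigr => j' _ do under eq_bigr => l' _ do
  rewrite (sig_mulr (mb_mult be) (mb_mult bf) (mb_mult bg)).
pulls [:: (0, 12); (0, 10); (0, 10)]%N.
etransitivity; [distr_scale|].
pulls [:: (0, 8); (0, 6); (0, 3); (0, 0); (0, 3); (0, 2); (0, 0); (0, 2); (0, 1);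
  (0, 0)]%N.
congr (_ *: _); ring.
Qed.

(** On basis vectors this is the rule for [sigma (ab) c]. *)
Lemma cbr_tensl M N P t : cbr (cten M N) P t =
  cassoc P M N (tmap (cbr M P) id (cassocV M P N (tmap id (cbr N P) (cassoc M N P t)))).
Proof.
have l1 : lin (tmap (fun x : M => x) (cbr N P)) by clin.
have l3 : lin (tmap (cbr M P) (fun x : N => x)) by clin.
apply: (ext3 (F := cbr (cten M N) P) (G := fun t => cassoc P M N
  (tmap (cbr M P) id (cassocV M P N (tmap id (cbr N P) (cassoc M N P t))))))
  => [||I c e be J d f bf L h g bg i j l].
- by clin.
- by clin.
etransitivity; first exact: (@braid_b (cten M N) P _ _ _ (mbasis_tens be bf) _ _ _ bg
  (i,j) l).
rewrite [cassoc M N P _](assoc_b be bf bg).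
rewrite (push _ l1 (fun p : I * J * L => tmapr_b (@lin_id _ M) (cf_lin (cbr N P))
  (e p.1.1) (braid_b bf bg p.1.2 p.2))).
rewrite (push _ (cf_lin (cassocV M P N)) (fun p : I * J * L * (J * L) =>
  assocV_b be bg bf p.1.1.1 p.2.2 p.2.1)).
rewrite (push _ l3 (fun p : I * J * L * (J * L) * (I * L * J) =>
  tmapl_b (cf_lin (cbr M P)) (@lin_id _ N) (f p.2.2) (braid_b be bg p.2.1.1 p.2.1.2))).
rewrite (push _ (cf_lin (cassoc P M N)) (fun p : I * J * L * (J * L) * (I * L * J) *
  (I * L) =>
  assoc_b bg be bf p.2.2 p.2.1 p.1.2.2)).
flatten_both; rewrite /mprod /=.
under eq_bigr => i' _ do under eq_bigr => j' _ do under eq_bigr => l' _ do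
  rewrite (sig_mull (mb_mult be) (mb_mult bf) (mb_mult bg)).
pulls [:: (0, 11); (0, 11); (0, 10)]%N.
etransitivity; [distr_scale|].
pulls [:: (0, 8); (0, 5); (0, 0); (0, 5); (0, 2); (0, 0); (0, 3); (0, 2); (0, 1);
  (0, 0)]%N.
congr (_ *: _); ring.
Qed.

Lemma cbr_1r M t : clu M (cbr M (cone A) t) = cru M t.
Proof.
have l1 : lin (fun t => clu M (cbr M (cone A) t)) by clin.
apply: (ext_ru l1 (cf_lin (cru M))) => m.
move: m; apply: ext1 => [||I c e be i].
- exact: (lin_comp l1 (@lin_otimesl _ _ _ _ _ _ (@lin_id _ _))).
- exact: (lin_comp (cf_lin (cru M)) (@lin_otimesl _ _ _ _ _ _ (@lin_id _ _))).
rewrite [cbr _ _ _](braid_b be (mbasis_cone A) i tt) sum_pair.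
under eq_bigr => i' _ do rewrite sum_unit /= (cqt_1r hs) (mb_mult be).2.
by rewrite (delta_sum i (fun x => (1 : k^o) \ox e x)) /= cluE cruE.
Qed.
Lemma cbr_1l M t : cru M (cbr (cone A) M t) = clu M t.
Proof.
have l1 : lin (fun t => cru M (cbr (cone A) M t)) by clin.
apply: (ext_lu l1 (cf_lin (clu M))) => m.
move: m; apply: ext1 => [||I c e be i].
- exact: (lin_comp l1 (@lin_otimesr _ _ _ _ _ _ (@lin_id _ _))).
- exact: (lin_comp (cf_lin (clu M)) (@lin_otimesr _ _ _ _ _ _ (@lin_id _ _))).
rewrite [cbr _ _ _](braid_b (mbasis_cone A) be tt i) sum_pair sum_unit /=.
under eq_bigr => i' _ do rewrite (cqt_1l hs) (mb_mult be).2.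
by rewrite (delta_sum i (fun x => e x \ox (1 : k^o))) /= cluE cruE.
Qed.

Definition combr : braiding (comcat A).
refine (@Braiding (comcat A) cbr _ _ _ _ _).
- by move=> *; apply: chom_eq => t; apply: cbr_nat.
- move=> X Y Z; apply: chom_eq => t.
  change (cassoc Y Z X (cbr X (cten Y Z) (cassoc X Y Z t)) =
    tmap id (cbr X Z) (cassoc Y X Z (tmap (cbr X Y) id t))).
  rewrite cbr_tensr; etransitivity; first exact: assocVK.
  by rewrite [cassocV _ _ _ _]assocK.
- move=> X Y Z; apply: chom_eq => t.
  change (cassocV Z X Y (cbr (cten X Y) Z (cassocV X Y Z t)) =
    tmap (cbr X Z) id (cassocV X Z Y (tmap id (cbr Y Z) t))).
  rewrite cbr_tensl; etransitivity; first exact: assocK.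
  by rewrite [cassoc _ _ _ _]assocVK.
- by move=> X; apply: chom_eq => t; apply: cbr_1r.
- by move=> X; apply: chom_eq => t; apply: cbr_1l.
Defined.
End Braid.

(** * Finite-dimensional comodules, their duals and the coend *)

Section Ffun.
Variables (k : fieldType) (I J : finType).
Local Notation V := {ffun I -> k^o}.
Definition dlt (i : I) : V := [ffun j => (j == i)%:R : k^o].
Lemma ffun_dlt (v : V) : v = \sum_i (v i : k) *: dlt i.
Proof.
apply/ffunP => j; rewrite sum_ffunE (bigD1 j) //= big1 ?addr0 => [|i ij].
  by rewrite !ffunE eqxx [_ *: _]mulr1.
by rewrite !ffunE eq_sym (negPf ij) [_ *: _]mulr0.
Qed.
Definition lext (W : lmodType k) (F : I -> W) (v : V) : W := \sum_i (v i : k) *: F i.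
Lemma lin_lext W F : lin (@lext W F).
Proof.
move=> a x y; rewrite /lext scaler_sumr -big_split; apply: eq_bigr => i _.
by rewrite !ffunE scalerDl scalerA.
Qed.
Lemma lextE W F i : @lext W F (dlt i) = F i.
Proof.
by rewrite /lext -[RHS](delta_sum i F); apply: eq_bigr => j _; rewrite ffunE.
Qed.
Lemma ext_ffun (W : lmodType k) (F G : V -> W) : lin F -> lin G ->
  (forall i, F (dlt i) = G (dlt i)) -> forall v, F v = G v.
Proof.
move=> lF lG E v; rewrite [v]ffun_dlt !lin_bigsum //; apply: eq_bigr => i _.
by rewrite !linZ // E.
Qed.
End Ffun.
Section Ffun2.
Variables (k : fieldType) (I J : finType).
Local Notation V := {ffun I -> k^o}.
Local Notation V' := {ffun J -> k^o}.
Definition bext (W : lmodType k) (F : I -> J -> W) : V \ox V' -> W :=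
  tlift (fun v w => lext (fun i => lext (F i) w) v).
Lemma bext_bilin (W : lmodType k) (F : I -> J -> W) :
  bilin (fun (v : V) (w : V') => lext (fun i => lext (F i) w) v).
Proof.
split=> ?; first exact: lin_lext.
apply: lin_sum => i; apply: lin_scaler; exact: lin_lext.
Qed.
Lemma lin_bext W F : lin (@bext W F).
Proof. exact/lin_tlift/bext_bilin. Qed.
Lemma bextE W F i j : @bext W F (dlt k i \ox dlt k j) = F i j.
Proof. by rewrite /bext tliftE ?lextE //; apply: bext_bilin. Qed.
Lemma ext_ffun2 (W : lmodType k) (F G : V \ox V' -> W) : lin F -> lin G ->
  (forall i j, F (dlt k i \ox dlt k j) = G (dlt k i \ox dlt k j)) -> forall v, F v = G
    v.
Proof.
move=> lF lG E; apply: (extT lF lG) => v w.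
move: v; apply: (ext_ffun (linD_ext' w lF) (linD_ext' w lG)) => i.
by move: w; apply: (ext_ffun (linD_ext _ lF) (linD_ext _ lG)).
Qed.
End Ffun2.

Section Objects.
Variables (k : fieldType) (A : dualQuasiHopf k).
Local Notation Phi a b c := (dqh_phi A (a \ox b \ox c)).
Local Notation PhiV a b c := (dqh_phiV A (a \ox b \ox c)).
Local Notation eps := (counit A).
Local Notation oA := (dqh_one A).
Local Notation S := (dqh_S A).
Local Notation alpha := (dqh_alpha A).
Local Notation beta := (dqh_beta A).
Let HH := dqh_axioms A.

(** A multiplicative matrix, standing for a finite-dimensional comodule with a
    basis. The objects [fob p] are the ones over which the coend is taken;
    matrices are closed under duals and tensor products on the nose. *)
Record fmat := Fmat { fI : finType; fm :> fI -> fI -> A; fmP : multmat fm }.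
Definition fcom (p : fmat) : precomodule A :=
  @Precomodule k A {ffun fI p -> k^o}
    (lext (fun j => \sum_i (dlt k i : {ffun fI p -> k^o}) \ox p i j)).
Lemma fcom_b p : @mbasis _ A (fcom p) _ p (@dlt k (fI p)).
Proof. split=> [|j]; [exact: fmP|exact: lextE]. Qed.
Lemma fcom_localfin p : localfin (fcom p).
Proof.
split=> [|v]; first exact: lin_lext.
exists (fI p), p, (@dlt k (fI p)), v; split; [exact: fcom_b|exact: ffun_dlt].
Qed.
Definition fob p : comod A := Comod (fcom_localfin p).
Lemma fob_b p : @mbasis _ A (fob p) _ p (@dlt k (fI p)).
Proof. exact: fcom_b. Qed.
Definition fdual p := Fmat (multmat_dual (fmP p)).
Definition fprod p q := Fmat (multmat_prod (fmP p) (fmP q)).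
Definition fone := Fmat (multmat_one A).

Lemma fob_mor p (M : comod A) (f : fob p -> M) (J : finType) (d : J -> J -> A)
  (y : J -> M)
   (F : J -> fI p -> k) : lin f -> mbasis d y ->
  (forall i, f (dlt k i) = \sum_q F q i *: y q) ->
  (forall q i, \sum_s F s i *: d q s = \sum_s F q s *: p s i) -> is_comorphism f.
Proof.
move=> lf bY E R; split=> //; apply: ext_ffun => [||i].
- by apply: lin_comp => //; exact: coact_lin.
- by apply: lin_comp; [exact: lin_tmap|exact: (@coact_lin _ _ (fob p))].
exact: (comor_mat lf (fob_b p) bY E R).
Qed.
Lemma fob2_mor p q (M : comod A) (f : cten (fob p) (fob q) -> M) (J : finType)
   (d : J -> J -> A) (y : J -> M)
   (F : J -> fI p * fI q -> k) : lin f -> mbasis d y ->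
  (forall i, f (dlt k i.1 \ox dlt k i.2) = \sum_q F q i *: y q) ->
  (forall j i, \sum_s F s i *: d j s = \sum_s F j s *: mprod p q s i) -> is_comorphism
    f.
Proof.
move=> lf bY E R; split=> //; apply: ext_ffun2 => [||i j].
- by apply: lin_comp => //; exact: coact_lin.
- by apply: lin_comp; [exact: lin_tmap|exact: (@coact_lin _ _ (cten (fob p) (fob q)))].
exact: (@comor_mat _ _ _ _ _ _ _ _ _ _ _ _ lf (mbasis_tens (fob_b p) (fob_b q)) bY E R
  (i, j)).
Qed.

(** The coefficients c_ij transform under the coaction of the coend as [e'_i
    (x) e_j] does under that of [X' (x) X]. *)
Lemma und_b p : @mbasis _ A (und A) (fI p * fI p)%type (mprod (mdual p) p)
  (fun x => p x.1 x.2).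
Proof.
split=> [|[i j]]; first exact: multmat_prod (multmat_dual (fmP p)) (fmP p).
have mp := fmP p; rewrite /coact /=.
change (\sw[3]_(a1 a2 a3 <- p i j) (a2 \ox (S a1 ** a3)) = \sum_i0 p i0.1 i0.2 \ox
  mprod (mdual p) p i0 (i, j)).
by expand1; rewrite sum_pair.
Qed.
Lemma lin_und : lin (@coact _ A (und A)).
Proof. by apply: lin_sweedler; mlin. Qed.
Definition areg : precomodule A := @Precomodule k A A (Delta A).
Lemma areg_comodule : is_comodule areg.
Proof.
split=> [|m|m]; [exact: linearP| |exact: coalg_counitr].
exact: coalg_coassoc.
Qed.
(** The regular comodule is locally finite, and applying the counit to the
    members of a family writes them in terms of its coefficients. *)
Lemma fmat_span (a : A) : exists (p : fmat) (l : fI p -> fI p -> k), a = \sum_i \sum_j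
  l i j *: p i j.
Proof.
have [_ /(_ a)[I [c [e [l [[mc ce] ->]]]]]] := comodule_localfin areg_comodule.
exists (Fmat mc), (fun i j => eps (e i) * l j).
rewrite exchange_big; apply: eq_bigr => j _ /=.
rewrite -[e j in LHS](@coalg_counitl _ A).
have -> : Delta A (e j) = \sum_i e i \ox c i j by exact: ce.
rewrite tlift_sum; last by lin.
rewrite scaler_sumr; apply: eq_bigr => i _; rewrite tliftE; last by lin.
by rewrite scalerA mulrC.
Qed.
Lemma ext_A (W : lmodType k) (F G : A -> W) : lin F -> lin G ->
  (forall (p : fmat) i j, F (p i j) = G (p i j)) -> forall a, F a = G a.
Proof.
move=> lF lG E a; have [p [l ->]] := fmat_span a.
rewrite !lin_bigsum //; apply: eq_bigr => i _.
rewrite !lin_bigsum //; apply: eq_bigr => j _.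
by rewrite !linZ // E.
Qed.
Lemma und_localfin : localfin (und A).
Proof.
apply: (@localfin_gen _ _ (und A) (fun t => exists (p : fmat) i j, t = p i j)).
- exact: lin_und.
- by move=> _ [p [i [j ->]]]; exists (fI p * fI p)%type, (mprod (mdual p) p),
  (fun x => p x.1 x.2), (i, j); split; [exact: und_b|].
move=> P P0 PD PZ PG a; have [p [l ->]] := fmat_span a.
elim/big_ind: _ => // i _; elim/big_ind: _ => // j _.
by apply: (PZ); apply: PG; exists p, i, j.
Qed.
Definition cund := Comod und_localfin.
Lemma cund_b p : @mbasis _ A cund (fI p * fI p)%type (mprod (mdual p) p)
  (fun x => p x.1 x.2).
Proof. exact: und_b. Qed.

Lemma alpha_mat (p : fmat) (i j : fI p) : \sum_s \sum_t alpha (p s t) *: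
  (S (p i s) ** p t j) = alpha (p i j) *: oA.
Proof.
have mp := fmP p; rewrite -(dqh_alpha_ax HH); symmetry; expand_all.
Qed.
Lemma beta_mat (p : fmat) (i j : fI p) : \sum_s \sum_t beta (p s t) *:
  (p i s ** S (p t j)) = beta (p i j) *: oA.
Proof.
have mp := fmP p; rewrite -(dqh_beta_ax HH); symmetry; expand_all.
Qed.
Lemma zigzag1_mat (p : fmat) (i j : fI p) : \sum_s1 \sum_s2 \sum_s3 \sum_s4
   Phi (p i s1) (S (p s2 s3)) (p s4 j) * beta (p s1 s2) * alpha (p s3 s4) = (i == j)%:R.
Proof.
have mp := fmP p; rewrite -mp.2 -(dqh_zigzag1 HH); symmetry; expand_all.
Qed.
Lemma zigzag2_mat (p : fmat) (i j : fI p) : \sum_s1 \sum_s2 \sum_s3 \sum_s4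
   PhiV (S (p i s1)) (p s2 s3) (S (p s4 j)) * alpha (p s1 s2) * beta (p s3 s4) =
     (i == j)%:R.
Proof.
have mp := fmP p; rewrite -mp.2 -(dqh_zigzag2 HH); symmetry; expand_all.
Qed.

Definition evalf (p : fmat) : fob (fdual p) \ox fob p -> k^o :=
  bext (fun i j => alpha (p i j) : k^o).
Lemma evalfE p i j : @evalf p (dlt k i \ox dlt k j) = alpha (p i j).
Proof. exact: bextE. Qed.
Lemma evalf_mor p : @is_comorphism _ A (cten (fob (fdual p)) (fob p)) (cone A)
  (@evalf p).
Proof.
apply: (@fob2_mor (fdual p) p (cone A) _ _ _ _ (fun _ ij => alpha (p ij.1 ij.2)) _
  (mbasis_cone A)).
- exact: lin_bext.
- by move=> [i j]; rewrite sum_unit evalfE [_ *: _]mulr1.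
move=> [] [i j]; rewrite sum_unit /mone -alpha_mat sum_pair //.
Qed.
Definition ev p := Chom (@evalf_mor p).

Lemma ext_k (W : lmodType k) (F G : k^o -> W) : lin F -> lin G -> F 1 = G 1 ->
  forall a, F a = G a.
Proof.
move=> lF lG E a; have -> : a = (a : k) *: (1 : k^o) by rewrite [_ *: _]mulr1.
by rewrite (linZ _ _ lF) (linZ _ _ lG) E.
Qed.
Definition coevf (p : fmat) (a : k^o) : fob p \ox fob (fdual p) :=
  (a : k) *: \sum_s \sum_t beta (p s t) *: (dlt k s \ox dlt k t).
Lemma coevf_mor p : @is_comorphism _ A (cone A) (cten (fob p) (fob (fdual p)))
  (@coevf p).
Proof.
have l1 : lin (@coevf p) by apply: (@lin_scalel _ _ _ (fun x => x)); exact: lin_id.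
split=> //; apply: ext_k.
- exact: (lin_comp (coact_lin (M := cten (fob p) (fob (fdual p)))) l1).
- exact: (lin_comp (lin_tmap l1 (@lin_id _ _)) (coact_lin (M := cone A))).
apply: (@comor_mat _ _ (cone A) (cten (fob p) (fob (fdual p))) _ _ _ _ _ _ _
  (fun st _ => beta (p st.1 st.2)) l1 (mbasis_cone A)
    (mbasis_tens (fob_b p) (fob_b (fdual p))) _ _ tt).
- by move=> _; rewrite sum_pair /coevf scale1r.
by move=> [s t] []; rewrite sum_unit /mone -beta_mat sum_pair.
Qed.
Definition coev p := Chom (@coevf_mor p).

Definition incf (p : fmat) : fob (fdual p) \ox fob p -> und A := bext
  (fun i j => p i j).
Lemma incfE p i j : @incf p (dlt k i \ox dlt k j) = p i j.
Proof. exact: bextE. Qed.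
Lemma incf_mor p : @is_comorphism _ A (cten (fob (fdual p)) (fob p)) cund (@incf p).
Proof.
apply: (@fob2_mor (fdual p) p cund _ _ _ _ (fun x y => (x == y)%:R) _ (cund_b p)).
- exact: lin_bext.
- by move=> [i j]; rewrite incfE (delta_sum (i, j) (fun x => (p x.1 x.2 : cund))).
move=> q i; rewrite (delta_sum i (fun s => mprod (mdual p) p q s)).
by rewrite (delta_sum' q (fun s => mprod (mdual p) p s i)).
Qed.
(** The universal morphism from [X' (x) X] to the coend. *)
Definition inc p := Chom (@incf_mor p).
Lemma incE p i j : inc p (dlt k i \ox dlt k j) = p i j.
Proof. exact: bextE. Qed.

Lemma coevE p : coev p (1 : k^o) = \sum_(x : fI p * fI p) beta (p x.1 x.2) *:
  (dlt k x.1 \ox dlt k x.2).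
Proof. by rewrite /= /coevf scale1r sum_pair. Qed.

Lemma coev_al p (M : comod A) (J : finType) (d : J -> J -> A) (e : J -> M)
  (be : mbasis d e) j :
  cassoc (fob p) (fob (fdual p)) M (tmap (coev p) id (cluV M (e j))) =
  \sum_(x : fI p * fI p * (fI p * fI p * J)) 
    (beta (p x.1.1 x.1.2) * Phi (p x.2.1.1 x.1.1) (S (p x.1.2 x.2.1.2)) (d x.2.2 j)) *:
     (dlt k x.2.1.1 \ox (dlt k x.2.1.2 \ox e x.2.2)).
Proof.
rewrite [tmap _ _ _](tmapl_b (cf_lin (coev p)) (@lin_id _ M) (e j) (coevE p)).
exact: (push _ (cf_lin (cassoc (fob p) (fob (fdual p)) M))
  (fun x : fI p * fI p => assoc_b (fob_b p) (fob_b (fdual p)) be x.1 x.2 j)).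
Qed.
Lemma coev_alV p (M : comod A) (J : finType) (d : J -> J -> A) (e : J -> M)
  (be : mbasis d e) j :
  cassocV M (fob p) (fob (fdual p)) (tmap id (coev p) (cruV M (e j))) =
  \sum_(x : fI p * fI p * (J * fI p * fI p)) 
    (beta (p x.1.1 x.1.2) * PhiV (d x.2.1.1 j) (p x.2.1.2 x.1.1) (S (p x.1.2 x.2.2))) *:
     (e x.2.1.1 \ox dlt k x.2.1.2 \ox dlt k x.2.2).
Proof.
rewrite [tmap _ _ _](tmapr_b (@lin_id _ M) (cf_lin (coev p)) (e j) (coevE p)).
exact: (push _ (cf_lin (cassocV M (fob p) (fob (fdual p))))
  (fun x : fI p * fI p => assocV_b be (fob_b p) (fob_b (fdual p)) j x.1 x.2)).
Qed.
Lemma cru_ev p (M : comod A) (m : M) i j :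
  cru M (tmap id (ev p) (m \ox (dlt k i \ox dlt k j))) = alpha (p i j) *: m.
Proof. by tmap_eval; rewrite /= evalfE cruE. Qed.
Lemma clu_ev p (M : comod A) (m : M) i j :
  clu M (tmap (ev p) id ((dlt k i \ox dlt k j) \ox m)) = alpha (p i j) *: m.
Proof. by tmap_eval; rewrite /= evalfE cluE. Qed.

Lemma czigl (p : fmat) v : cru (fob p) (tmap id (ev p)
  (cassoc (fob p) (fob (fdual p)) (fob p)
  (tmap (coev p) id (cluV (fob p) v)))) = v.
Proof.
have l1 : lin (fun t => cru (fob p) (tmap (fun x : fob p => x) (ev p) t)) by clin.
apply: (ext_ffun (F := fun v => cru (fob p) (tmap (fun x : fob p => x) (ev p)
  (cassoc (fob p) (fob (fdual p)) (fob p)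
  (tmap (coev p) id (cluV (fob p) v))))) (G := fun v => v)) => [||j]; [clin|clin|].
rewrite (coev_al p (fob_b p)) (lin_bigsum _ _ _ l1).
under eq_bigr => x _ do rewrite (linZ _ _ l1) cru_ev scalerA.
rewrite -[RHS](delta_sum j (@dlt k (fI p))); etransitivity; [flatten|].
etransitivity; [bring 2%N|]; apply: eq_sum => i; rewrite -zigzag1_mat.
symmetry; etransitivity; [distr_scale|]; symmetry.
do 4 (refine (eq_sum _) => ?); congr (_ *: _); ring.
Qed.
Lemma czigr (p : fmat) v : clu (fob (fdual p))
  (tmap (ev p) id (cassocV (fob (fdual p)) (fob p) (fob (fdual p))
  (tmap id (coev p) (cruV (fob (fdual p)) v)))) = v.
Proof.
have l1 : lin (fun t => clu (fob (fdual p)) (tmap (ev p) (fun x : fob (fdual p) => x)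
  t)) by clin.
apply: (ext_ffun (F := fun v => clu (fob (fdual p))
  (tmap (ev p) (fun x : fob (fdual p) => x) (cassocV (fob (fdual p)) (fob p)
    (fob (fdual p))
  (tmap (fun x : fob (fdual p) => x) (coev p) (cruV (fob (fdual p)) v)))))
    (G := fun v => v)) => [||j]; [clin|clin|].
rewrite (coev_alV p (fob_b (fdual p))) (lin_bigsum _ _ _ l1).
under eq_bigr => x _ do rewrite (linZ _ _ l1) clu_ev scalerA.
rewrite -[RHS](delta_sum j (@dlt k (fI p))); etransitivity; [flatten|].
etransitivity; [bring 4%N|]; apply: eq_sum => i; rewrite eq_sym -(zigzag2_mat (p:=p)).
symmetry; etransitivity; [distr_scale|]; symmetry.
pulls [:: (2, 0); (2, 0)]%N.
do 2 (refine (eq_sum _) => ?).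
rewrite /= /mdual; congr (_ *: _); ring.
Qed.

(** The universal coaction of the coend. Written without a basis, it is defined
    and natural on all comodules; on [fob p] it is the coevaluation followed by
    [inc], see [coend_coact_fob]. *)
Definition coend_coact (M : precomodule A) (m : M) : M \ox A :=
  \tsum_(m0, m' <- coact m) \sw[5]_(m1 m2 m3 m4 m5 <- m')
    (Phi m1 (S m3) m5 * beta m2) *: (m0 \ox m4).
Lemma lin_coend_coact (M : comod A) : lin (@coend_coact M).
Proof.
apply: lin_tliftc; last exact: coact_lin.
split=> [w|v].
  by apply: lin_sweedlerF; nlin_red; intros_lin; lin.
by apply: lin_sweedler; mlin.
Qed.
Lemma coend_coact_b (M : comod A) (J : finType) (d : J -> J -> A) (e : J -> M)
  (be : mbasis d e) j :
  coend_coact (e j) = \sum_i \sum_s1 \sum_s2 \sum_s3 \sum_s4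
     (Phi (d i s1) (S (d s2 s3)) (d s4 j) * beta (d s1 s2)) *: (e i \ox d s3 s4).
Proof.
have md := mb_mult be.
rewrite /coend_coact (mb_coact be) tlift_sum; last first.
  split=> [w|v]; first by apply: lin_sweedlerF; nlin_red; intros_lin; lin.
  by apply: lin_sweedler; mlin.
apply: eq_bigr => i _; rewrite tliftE; first by expand1.
split=> [w|v]; first by apply: lin_sweedlerF; nlin_red; intros_lin; lin.
by apply: lin_sweedler; mlin.
Qed.
Lemma coend_coact_fob (p : fmat) v : @coend_coact (fob p) v = tmap id (inc p)
  (cassoc (fob p) (fob (fdual p)) (fob p)
  (tmap (coev p) id (cluV (fob p) v))).
Proof.
have l1 : lin (tmap (fun x : fob p => x) (inc p)) by clin.
apply: (ext_ffun (F := @coend_coact (fob p)) (G := fun v => tmap (fun x : fob p => x)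
  (inc p) (cassoc (fob p) (fob (fdual p)) (fob p)
  (tmap (coev p) id (cluV (fob p) v))))) => [||j];
    [exact: (@lin_coend_coact (fob p))|clin|].
rewrite (coev_al p (fob_b p)) (lin_bigsum _ _ _ l1) (coend_coact_b (fob_b p)).
under [RHS]eq_bigr => x _ do rewrite (linZ _ _ l1)
  (tmapE _ _ (@lin_id _ _) (cf_lin (inc p))) incE.
symmetry; etransitivity; [flatten|].
etransitivity; [bring 2%N|]. do 5 (refine (eq_sum _) => ?); congr (_ *: _); ring.
Qed.
Definition bmap (M : comod A) (p : fmat) (e : fI p -> M) : fob p -> M := lext e.
Lemma bmap_mor (M : comod A) (p : fmat) (e : fI p -> M) : mbasis p e -> is_comorphism
  (bmap e).
Proof.
move=> be; apply: (fob_mor (F := fun x y => (x == y)%:R) (lin_lext e) be) => [i|q i].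
  by rewrite lextE (delta_sum i e).
by rewrite (delta_sum i (fun s => p q s)) (delta_sum' q (fun s => p s i)).
Qed.
Lemma coend_coact_nat (M N : comod A) (f : chom M N) m : coend_coact (f m) = tmap f id
  (coend_coact m).
Proof.
have l1 : lin (tmap f (fun x : A => x)) by clin.
apply: (ext1 (F := fun m => coend_coact (f m))
  (G := fun m => tmap f id (coend_coact m)))
  => [||I c e be j].
- by apply: lin_comp; [exact: lin_coend_coact|clin].
- by apply: lin_comp; [clin|exact: lin_coend_coact].
rewrite (coend_coact_b be); etransitivity; first exact:
  (coend_coact_b (mbasis_map (cfP f) be) j).
do 5 (rewrite (lin_bigsum _ _ _ l1); apply: eq_bigr => ? _).
by rewrite (linZ _ _ l1) tmapE //; clin.
Qed.
(** A family with a coefficient matrix [p] is the image of the basis of [fob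
    p], where the coaction is a composite of morphisms; naturality transports
    this property. *)
Lemma coend_coact_mor (M : comod A) : @is_comorphism _ A M (cten M cund)
  (@coend_coact M).
Proof.
split; first exact: lin_coend_coact.
apply: ext1 => [||I c e be j].
- by apply: lin_comp; [exact: (coact_lin (M := cten M cund))|exact: lin_coend_coact].
- by apply: lin_comp; [apply: lin_tmap => //; exact: lin_coend_coact|exact: coact_lin].
pose p := Fmat (mb_mult be); pose f := Chom (@bmap_mor M p e be).
pose dp := ccomp (ctmap (cid (fob p)) (inc p)) (ccomp (cassoc _ _ _)
  (ccomp (ctmap (coev p) (cid (fob p))) (cluV (fob p)))).
pose G := ccomp (ctmap f (cid cund)) dp.
have GE i : G (dlt k i) = coend_coact (e i).
  rewrite -(lextE e i); etransitivity; last exact: (esym (coend_coact_nat f (dlt k i))).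
  by congr (tmap _ _ _); rewrite coend_coact_fob.
have := (cfP G).2 (dlt k j); rewrite GE => ->.
rewrite (mb_coact (fob_b p)) (mb_coact be).
have lG := cf_lin G; have ld := @lin_coend_coact M.
rewrite (lin_bigsum _ _ _ (lin_tmap lG (@lin_id _ A))).
rewrite (lin_bigsum _ _ _ (lin_tmap ld (@lin_id _ A))); apply: eq_bigr => i _.
rewrite (tmapE _ _ lG (@lin_id _ A)) (tmapE _ _ ld (@lin_id _ A)) GE //.
Qed.
Definition cdelta M := Chom (@coend_coact_mor M).

Definition psif (q p : fmat) : fob q \ox fob p -> fob (fprod q p) :=
  bext (fun i j => dlt k (i, j)).
Lemma psi_mor q p : @is_comorphism _ A (cten (fob q) (fob p)) (fob (fprod q p))
  (@psif q p).
Proof.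
apply: (fob2_mor (F := fun x y => (x == y)%:R) (lin_bext _) (fob_b (fprod q p))) =>
  [[i j]|x y].
  by rewrite /psif bextE (delta_sum (i, j) (@dlt k (fI (fprod q p)))).
rewrite (delta_sum y (fun s => mprod q p x s)).
by rewrite (delta_sum' x (fun s => mprod q p s y)).
Qed.
Definition psi q p := Chom (@psi_mor q p).
Definition psiVf (q p : fmat) : fob (fprod q p) -> fob q \ox fob p :=
  lext (fun x => dlt k x.1 \ox dlt k x.2).
Lemma psiV_mor q p : @is_comorphism _ A (fob (fprod q p)) (cten (fob q) (fob p))
  (@psiVf q p).
Proof.
apply: (@fob_mor (fprod q p) (cten (fob q) (fob p)) (@psiVf q p) _ (mprod q p)
  (fun x => dlt k x.1 \ox dlt k x.2) (fun x y => (x == y)%:R) (lin_lext _)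
  (mbasis_tens (fob_b q) (fob_b p))) => [i|x y].
  by rewrite /psiVf lextE (delta_sum i (fun x => dlt k x.1 \ox dlt k x.2)).
rewrite (delta_sum y (fun s => mprod q p x s)).
by rewrite (delta_sum' x (fun s => mprod q p s y)).
Qed.
Definition psiV q p := Chom (@psiV_mor q p).
Lemma psiE q p i j : psi q p (dlt k i \ox dlt k j) = dlt k (i, j).
Proof. exact: bextE. Qed.
Lemma psiVE q p i : psiV q p (dlt k i) = dlt k i.1 \ox dlt k i.2.
Proof. exact: lextE. Qed.
Lemma psiK q p v : psiV q p (psi q p v) = v.
Proof.
apply: (ext_ffun2 (F := fun v => psiV q p (psi q p v)) (G := fun v => v)) => [||i j];
  [clin|clin|].
by rewrite psiE psiVE.
Qed.
End Objects.

(** * The inverse braiding *)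

Section InvBraid.
Variables (k : fieldType) (A : dualQuasiHopf k).
Variables (sigma : {scalar (A \ox A)%type}) (hs : co_quasi_triangular sigma).
Local Notation Phi a b c := (dqh_phi A (a \ox b \ox c)).
Local Notation PhiV a b c := (dqh_phiV A (a \ox b \ox c)).
Local Notation Sig a b := (sigma (a \ox b)).
Local Notation eps := (counit A).
Local Notation S := (dqh_S A).
Local Notation alpha := (dqh_alpha A).
Local Notation beta := (dqh_beta A).
Local Notation C := (comcat A).
Local Notation c := (combr hs).

Definition fo (p : fmat A) : C := fob p.
Definition evc p : hom (ten (fo (fdual p)) (fo p)) one := ev p.
Definition coevc p : hom one (ten (fo p) (fo (fdual p))) := coev p.
Lemma pzigl (p : fmat A) : (ru (fo p) ∘ fo p ∙ evc p
  ∘ al (fo p) (fo (fdual p)) (fo p) ∘ coevc p · fo p ∘ luV (fo p))%cat = idm.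
Proof. apply: chom_eq => v; exact: czigl. Qed.
Lemma pzigr (p : fmat A) : (lu (fo (fdual p)) ∘ evc p · fo (fdual p)
  ∘ alV (fo (fdual p)) (fo p) (fo (fdual p)) ∘ fo (fdual p) ∙ coevc p ∘ ruV
    (fo (fdual p)))%cat = idm.
Proof. apply: chom_eq => v; exact: czigr. Qed.

Lemma mbasis_cten (M N : comod A) (I : finType) (c : I -> I -> A) (e : I -> M)
    (J : finType) (d : J -> J -> A) (f : J -> N) : mbasis c e -> mbasis d f ->
  @mbasis _ _ (cm (cten M N)) _ (mprod c d) (fun p : I * J => e p.1 \ox f p.2).
Proof. exact: mbasis_tens. Qed.
(** The coefficients of [rigid_br]; this form is the convolution inverse of
    sigma. *)
Definition sigmaV_form (a b : A) : k :=
  \sw[10]_(a1 a2 a3 a4 a5 a6 a7 a8 a9 a10 <- a) \sw[4]_(b1 b2 b3 b4 <- b)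
   (Phi (a1 ** b1) (S a8) a10 * PhiV a2 b2 (S a7) * Phi a3 (S a5) b4 * beta a4
     * Sig (S a6) b3 * alpha a9).

Definition rigid_brX (p : fmat A) (Y : comod A) : chom (cten Y (fob p))
  (cten (fob p) Y) :=
  rigid_br c (evc p) (coevc p) Y.

(** The matrix of the inverse braiding, read off from its expression by the
    coevaluation, the braiding of X' and the evaluation. *)
Lemma rigid_brX_b p (Y : comod A) (J : finType) (d : J -> J -> A) (f : J -> Y)
  (bf : mbasis d f) i j :
  rigid_brX p Y (f j \ox dlt k i) = \sum_i' \sum_j' sigmaV_form (p i' i) (d j' j) *:
    (dlt k i' \ox f j').
Proof.
rewrite /rigid_brX rigid_br_def.
change (cru (cten (fob p) Y) (tmap id (ev p) (cassoc (cten (fob p) Y) (fob (fdual p))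
  (fob p)
  (tmap (cassocV (fob p) Y (fob (fdual p))) id
    (tmap (tmap id (cbr hs (fob (fdual p)) Y)) id
   (tmap (cassoc (fob p) (fob (fdual p)) Y) id
     (tmap (tmap (coev p) id) id (tmap (cluV Y) id (f j \ox dlt k i))))))))
   = \sum_i' \sum_j' sigmaV_form (p i' i) (d j' j) *: (dlt k i' \ox f j')).
have -> : tmap (cassoc (fob p) (fob (fdual p)) Y) id
  (tmap (tmap (coev p) id) id (tmap (cluV Y) id (f j \ox dlt k i)))
  = cassoc (fob p) (fob (fdual p)) Y (tmap (coev p) id (cluV Y (f j))) \ox
    (dlt k i : fob p).
  by do 3 tmap_eval.
rewrite (coev_al p bf).
have l1 : lin (fun t => tmap (tmap (fun x : fob p => x) (cbr hs (fob (fdual p)) Y))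
  (fun x : fob p => x) (t \ox (dlt k i : fob p))).
  apply: lin_comp; [clin|lin].
rewrite (push _ l1 (fun x : fI p * fI p * (fI p * fI p * J) => tmapl_b
  (lin_tmap (@lin_id _ (fob p)) (cf_lin _)) (@lin_id _ (fob p)) (dlt k i : fob p)
   (tmapr_b (@lin_id _ (fob p)) (cf_lin (cbr hs (fob (fdual p)) Y))
     (dlt k x.2.1.1 : fob p) (braid_b sigma (fob_b (fdual p)) bf x.2.1.2 x.2.2)))).
rewrite (push _ (lin_tmap (cf_lin (cassocV (fob p) Y (fob (fdual p))))
  (@lin_id _ (fob p))) (fun x : fI p * fI p * (fI p * fI p * J) * (fI p * J) =>
  tmapl_b (cf_lin (cassocV (fob p) Y (fob (fdual p)))) (@lin_id _ (fob p))
    (dlt k i : fob p)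
  (assocV_b (fob_b p) bf (fob_b (fdual p)) x.1.2.1.1 x.2.2 x.2.1))).
rewrite (push _ (cf_lin (cassoc (cten (fob p) Y) (fob (fdual p)) (fob p)))
  (fun x : fI p * fI p * (fI p * fI p * J) * (fI p * J) * (fI p * J * fI p) =>
   assoc_b (mbasis_cten (fob_b p) bf) (fob_b (fdual p)) (fob_b p) x.2.1 x.2.2 i)).
have l2 : lin (fun t => cru (cten (fob p) Y) (tmap (fun x : cten (fob p) Y => x)
  (ev p) t)) by clin.
rewrite (lin_bigsum _ _ _ l2).
under eq_bigr => x _ do rewrite (linZ _ _ l2) (@cru_ev _ _ p (cten (fob p) Y)) scalerA.
have md := mb_mult bf; have mp := fmP p.
etransitivity; [flatten|]. rewrite /= /mdual /mprod /=.
symmetry; etransitivity.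
  do 2 (refine (eq_sum _); intro).
  by refine (etrans (congr1 (fun z => z *: _) _) _);
    [rewrite /sigmaV_form; sweedler_expand|distr_scale].
cbv beta.
pulls [:: (0, 10); (0, 10); (0, 7); (0, 2); (0, 0); (0, 0); (0, 0); (0, 1); (0, 3);
  (0, 3); (0, 3); (0, 2); (0, 1); (0, 0)]%N.
congr (_ *: _); ring.
Qed.

Lemma sum_pair' (R : nmodType) (I J : finType) (F : I -> J -> R) :
  \sum_(p : I * J) F p.1 p.2 = \sum_i \sum_j F i j.
Proof. exact: sum_pair. Qed.
Lemma coef2 (I J : finType) (G : I * J -> k) i j :
  \sum_x G x *: (dlt k x.1 \ox dlt k x.2) = dlt k i \ox dlt k j :> {ffun I -> k^o} \ox
    {ffun J -> k^o} ->
  forall i' j', G (i', j') = (i' == i)%:R * (j' == j)%:R.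
Proof.
move=> E i' j'; pose F := bext (fun x y => (i' == x)%:R * (j' == y)%:R : k^o).
have lF : lin F by exact: lin_bext.
have FE x y : F (dlt k x \ox dlt k y) = (i' == x)%:R * (j' == y)%:R by exact: bextE.
have := congr1 F E; rewrite (lin_bigsum _ _ _ lF) FE => <-.
rewrite -[LHS](@delta_sum' k k^o _ (i', j') G); apply: eq_bigr => -[x y] _.
by rewrite (linZ _ _ lF) FE /= xpair_eqE -mulnb natrM [RHS]mulrC.
Qed.

Lemma sigmaV_l (p q : fmat A) i j i' j' :
  \sum_s \sum_t sigmaV_form (p i' s) (q j' t) * Sig (p s i) (q t j) = (i' == i)%:R *
    (j' == j)%:R.
Proof.
have := congr1 (fun f : chom (cten (fob p) (fob q)) (cten (fob p) (fob q)) => f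
  (dlt k i \ox dlt k j))
  (rigid_brK c (pzigl p) (fo q)).
change (rigid_brX p (fob q) (cbr hs (fob p) (fob q) (dlt k i \ox dlt k j)) = dlt k i
  \ox dlt k j -> 
 \sum_s \sum_t sigmaV_form (p i' s) (q j' t) * Sig (p s i) (q t j) = (i' == i)%:R *
   (j' == j)%:R).
rewrite [cbr _ _ _ _](braid_b sigma (fob_b p) (fob_b q))
  (lin_bigsum _ _ _ (cf_lin (rigid_brX p (fob q)))).
under eq_bigr => x _ do rewrite (linZ _ _ (cf_lin (rigid_brX p (fob q))))
  (rigid_brX_b (fob_b q)) -sum_pair' scaler_sumr.
rewrite exchange_big; under eq_bigr => x _ do (under eq_bigr => y _ do rewrite
  scalerA; rewrite -scaler_suml).
move/coef2 => /(_ i' j') /= <-; rewrite sum_pair.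
by apply: eq_sum => s; apply: eq_sum => t; rewrite mulrC.
Qed.
Lemma sigmaV_r (p q : fmat A) i j i' j' :
  \sum_s \sum_t Sig (p i' s) (q j' t) * sigmaV_form (p s i) (q t j) = (i' == i)%:R *
    (j' == j)%:R.
Proof.
have := congr1 (fun f : chom (cten (fob q) (fob p)) (cten (fob q) (fob p)) => f
  (dlt k j \ox dlt k i))
  (rigid_brVK c (pzigl p) (fo q)).
change (cbr hs (fob p) (fob q) (rigid_brX p (fob q) (dlt k j \ox dlt k i)) = dlt k j
  \ox dlt k i -> 
 \sum_s \sum_t Sig (p i' s) (q j' t) * sigmaV_form (p s i) (q t j) = (i' == i)%:R *
   (j' == j)%:R).
have lb := cf_lin (cbr hs (fob p) (fob q)).
rewrite (rigid_brX_b (fob_b q)) -sum_pair' (lin_bigsum _ _ _ lb).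
under eq_bigr => x _ do rewrite (linZ _ _ lb) [cbr _ _ _ _](braid_b sigma (fob_b p)
  (fob_b q)) scaler_sumr.
rewrite exchange_big; under eq_bigr => x _ do (under eq_bigr => y _ do rewrite
  scalerA; rewrite -scaler_suml).
move=> E; rewrite mulrC -(coef2 (G := fun x => \sum_(y : fI p * fI q) sigmaV_form
  (p y.1 i) (q y.2 j) * Sig (p x.2 y.1) (q x.1 y.2)) (i := j) (j := i)) /=.
  by rewrite sum_pair; apply: eq_sum => s; apply: eq_sum => t; rewrite mulrC.
rewrite -E [LHS]sum_pair [RHS]sum_pair; exact: exchange_sum.
Qed.

Definition mkscalar (V : lmodType k) (f : V -> k) (lf : @lin k V k^o f) : {scalar V} :=
  HB.pack_for {scalar V} f (GRing.isLinear.Build k V k^o _ f lf).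
Lemma sigmaV_form_bilin : @bilin k A A k^o sigmaV_form.
Proof.
split=> ?; first by apply: lin_sweedler; mlin.
by apply: lin_sweedlerF; nlin_red; intros_lin; apply: lin_sweedler; mlin.
Qed.
Definition sigmaV : {scalar (A \ox A)%type} := mkscalar (lin_tlift sigmaV_form_bilin).
Lemma sigmaVE a b : sigmaV (a \ox b) = sigmaV_form a b.
Proof. exact: (tliftE sigmaV_form_bilin). Qed.

Lemma lin_sw2 (F G : {scalar (A \ox A)%type}) : @bilin k A A k^o (fun a b => 
  \sw[2]_(a1 a2 <- a) \sw[2]_(b1 b2 <- b) F (a1 \ox b1) * G (a2 \ox b2)).
Proof.
split=> ?; first by apply: lin_sweedler; mlin.
by apply: lin_sweedlerF; nlin_red; intros_lin; apply: lin_sweedler; mlin.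
Qed.
Lemma eps_bilin : @bilin k A A k^o (fun a b => eps a * eps b).
Proof. by split=> w; [exact: (lin_mull (eps w) (lin_scalar _))|exact:
  (lin_mulr (eps w) (lin_scalar _))]. Qed.
Lemma ext_A2 (W : lmodType k) (F G : A -> A -> W) : bilin F -> bilin G ->
  (forall (p q : fmat A) i j i' j', F (p i j) (q i' j') = G (p i j) (q i' j')) ->
  forall a b, F a b = G a b.
Proof.
move=> [F1 F2] [G1 G2] E a b; move: a; apply: (ext_A (F1 b) (G1 b)) => p i j.
by move: b; apply: (ext_A (F2 _) (G2 _)) => q i' j'.
Qed.
Lemma sigmaV_inv : convolution_inverse sigma sigmaV.
Proof.
split.
- apply: (ext_A2 (lin_sw2 sigma sigmaV) eps_bilin) => p q i j i' j'.
  have mp := fmP p; have mq := fmP q; rewrite mp.2 mq.2 -sigmaV_r.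
  etransitivity; [sweedler_expand|]; cbv beta; apply: eq_sum => s; apply: eq_sum => t.
  by rewrite sigmaVE.
apply: (ext_A2 (lin_sw2 sigmaV sigma) eps_bilin) => p q i j i' j'.
have mp := fmP p; have mq := fmP q; rewrite mp.2 mq.2 -sigmaV_l.
  etransitivity; [sweedler_expand|]; cbv beta; apply: eq_sum => s; apply: eq_sum => t.
by rewrite sigmaVE.
Qed.

(** The formula for the inverse braiding uses coefficients only, so that it
    extends from the objects with a dual to all comodules. *)
Definition inv_braiding (M N : comod A) : N \ox M -> M \ox N := fun t =>
  \tsum_(n, m <- t) \tsum_(m0, m1 <- coact m) \tsum_(n0, n1 <- coact n)
    sigmaV (m1 \ox n1) *: (m0 \ox n0).
Lemma lin_inv_braiding M N : lin (@inv_braiding M N).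
Proof. rewrite /inv_braiding; lin. Qed.
Lemma inv_braiding_b (M N : comod A) (I : finType) (c : I -> I -> A) (e : I -> M)
  (be : mbasis c e)
 (J : finType) (d : J -> J -> A) (f : J -> N) (bf : mbasis d f) i j : @inv_braiding M
   N (f j \ox e i)
  = \sum_(p : I * J) sigmaV_form (c p.1 i) (d p.2 j) *: (e p.1 \ox f p.2).
Proof.
rewrite /inv_braiding tliftE; last by lin.
rewrite (mb_coact be) tlift_sum; last by lin.
rewrite !sum_pair; apply: eq_bigr => i' _; rewrite tliftE; last by lin.
rewrite (mb_coact bf) tlift_sum; last by lin.
by apply: eq_bigr => j' _; rewrite tliftE ?sigmaVE; last by lin.
Qed.
Lemma inv_braidingK M N t : @inv_braiding M N (cbr hs M N t) = t.
Proof.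
apply: (ext2 (F := fun t => @inv_braiding M N (cbr hs M N t)) (G := fun t => t)) =>
  [||I c e be J d f bf i j].
- by apply: lin_comp; [exact: lin_inv_braiding|clin].
- by clin.
change (@inv_braiding M N (@com_braiding _ A sigma M N (e i \ox f j)) = e i \ox f j).
apply: (@invert_mat _ _ _ _ _ _ _ (fun p : I * J => e p.1 \ox f p.2)
  (fun p => f p.2 \ox e p.1)
  _ _ (@lin_inv_braiding M N) (fun p => braid_b sigma be bf p.1 p.2)
    (fun p => inv_braiding_b be bf p.1 p.2) _ (i, j)).
move=> [i1 j1] [i2 j2]; rewrite sum_pair xpair_eqE -mulnb natrM.
exact: (@sigmaV_l (Fmat (mb_mult be)) (Fmat (mb_mult bf))).
Qed.
Lemma inv_braidingVK M N t : cbr hs M N (@inv_braiding M N t) = t.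
Proof.
apply: (ext2 (F := fun t => cbr hs M N (@inv_braiding M N t)) (G := fun t => t)) =>
  [||J d f bf I c e be j i].
- by apply: lin_comp; [clin|exact: lin_inv_braiding].
- by clin.
change (@com_braiding _ A sigma M N (@inv_braiding M N (f j \ox e i)) = f j \ox e i).
apply: (@invert_mat _ _ _ _ _ _ _ (fun p : I * J => f p.2 \ox e p.1)
  (fun p => e p.1 \ox f p.2)
  _ _ (@lin_braid _ A sigma M N) (fun p => inv_braiding_b be bf p.1 p.2)
    (fun p => braid_b sigma be bf p.1 p.2) _ (i, j)).
move=> [i1 j1] [i2 j2]; rewrite sum_pair xpair_eqE -mulnb natrM.
exact: (@sigmaV_r (Fmat (mb_mult be)) (Fmat (mb_mult bf))).
Qed.
Definition cbrV (M N : comod A) : hom ((N : C) ⊗ M)%cat ((M : C) ⊗ N)%cat :=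
  Chom (inv_mor (braid_mor hs M N) (@lin_inv_braiding M N) (@inv_braidingK M N)
    (@inv_braidingVK M N)).
Lemma cbrK (X Y : C) : (cbrV X Y ∘ br c X Y)%cat = idm.
Proof. by apply: chom_eq => t; apply: inv_braidingK. Qed.
Lemma cbrVK (X Y : C) : (br c X Y ∘ cbrV X Y)%cat = idm.
Proof. by apply: chom_eq => t; apply: inv_braidingVK. Qed.
End InvBraid.

(** * Bijectivity of the antipode *)

Lemma mat_inverseC (R : comUnitRingType) (I : finType) (u v : I -> I -> R) :
  (forall i j, \sum_s v i s * u s j = (i == j)%:R) ->
  forall i j, \sum_s u i s * v s j = (i == j)%:R.
Proof.
move=> E i j; pose M (w : I -> I -> R) := \matrix_(a, b < #|I|) w (enum_val a)
  (enum_val b).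
have re (F : I -> R) : \sum_s F s = \sum_(a < #|I|) F (enum_val a).
  by rewrite (reindex (@enum_val I I)) //; apply: onW_bij; exact: enum_val_bij.
have : M v *m M u = 1%:M.
  apply/matrixP => a b; rewrite !mxE -(inj_eq enum_val_inj) -E re.
  by apply: eq_bigr => x _; rewrite !mxE.
move=> /mulmx1C /matrixP /(_ (enum_rank i) (enum_rank j)).
rewrite !mxE -(inj_eq enum_val_inj) !enum_rankK => <-; rewrite re.
by apply: eq_bigr => x _; rewrite !mxE !enum_rankK.
Qed.

Section SpanInj.
Variables (k : fieldType) (V : lmodType k).
Definition span (I : finType) (y : I -> V) (a : V) := exists l : I -> k, a = \sum_i l
  i *: y i.

Lemma span_trans (I J : finType) (y : I -> V) (x : J -> V) a :
  (forall i, span x (y i)) -> span y a -> span x a.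
Proof.
move=> /choice[L LE] [l ->]; exists (fun j => \sum_i l i * L i j).
under eq_bigr => i _ do rewrite LE scaler_sumr.
rewrite exchange_big; apply: eq_bigr => j _; rewrite scaler_suml.
by apply: eq_bigr => i _; rewrite scalerA.
Qed.

Lemma span_basis (I : finType) (y : I -> V) : exists n (x : 'I_n -> V),
  [/\ independent x, forall s, span y (x s) & forall i, span x (y i)].
Proof.
pose P n := exists x : 'I_n -> V, (forall s, span y (x s)) /\ (forall i, span x (y i)).
have sp1 (J : finType) (z : J -> V) s : span z (z s).
  by exists (fun i => (i == s)%:R); rewrite delta_sum.
have exP : exists n, `[< P n >].
  exists #|I|; apply/asboolP; exists (fun a => y (enum_val a)); split=> [s|i]; first
    exact: sp1.
  by have := sp1 _ (fun a => y (enum_val a)) (enum_rank i); rewrite enum_rankK.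
case: (ex_minnP exP) => n /asboolP[x [yx xy]] minn {exP}.
exists n, x; split=> //; apply: contrapT => nind.
case: n x yx xy nind minn => [|n] x yx xy nind minn; first by apply: nind => l _ [].
have [t [l E]] := dependent_elim nind.
suff /minn : `[< P n >] by rewrite ltnn.
apply/asboolP; exists (fun s => x (lift t s)); split=> [s|i]; first exact: yx.
apply: span_trans (xy i) => s; case: (unliftP t s) => [r ->|->]; first exact:
  (sp1 _ (fun s => x (lift t s))).
by exists l.
Qed.

Lemma span_lin (I : finType) (y : I -> V) (T : V -> V) a : lin T ->
  span y a -> span (fun i => T (y i)) (T a).
Proof.
move=> lT [l ->]; exists l; rewrite (lin_bigsum _ _ _ lT).
by apply: eq_bigr => i _; exact: linZ.
Qed.

(** On a finite-dimensional space a surjective endomorphism is injective. *)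
Lemma span_inj (I : finType) (y : I -> V) (T : V -> V) : lin T ->
  (forall i, span y (T (y i))) -> (forall i, span (fun j => T (y j)) (y i)) ->
  forall a, span y a -> T a = 0 -> a = 0.
Proof.
move=> lT Ty yT a ya; have [n [x [ix yx xy]]] := span_basis y.
have Txx s : span x (T (x s)).
  apply: (span_trans xy); apply: (span_trans Ty).
  exact: span_lin.
have xTx s : span (fun r => T (x r)) (x s).
  apply: (span_trans _ (yx s)) => i; apply: (span_trans _ (yT i)) => j.
  exact: (span_lin lT (xy j)).
have [tau tauE] := choice Txx; have [rho rhoE] := choice xTx.
have tr : forall r s, \sum_t rho s t * tau t r = (r == s)%:R.
  move=> r s; apply/eqP; rewrite -subr_eq0; apply/eqP.
  apply: (ix (fun r => \sum_t rho s t * tau t r - (r == s)%:R)).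
  under eq_bigr => i _ do rewrite scalerBl.
  rewrite sumrB delta_sum [in X in _ - X](rhoE s).
  apply/eqP; rewrite subr_eq0; apply/eqP.
  under [RHS]eq_bigr => t _ do rewrite tauE scaler_sumr.
  rewrite [RHS]exchange_big; apply: eq_bigr => i _; rewrite scaler_suml.
  by apply: eq_bigr => t _; rewrite scalerA.
have rt := @mat_inverseC _ _ tau rho (fun i j => etrans (tr j i)
  (congr1 _ (congr1 _ (eq_sym _ _)))).
have [l ->] := span_trans xy ya.
rewrite (lin_bigsum _ _ _ lT) => E.
have {}E r : \sum_s l s * tau s r = 0.
  move: r; apply: ix; rewrite -[RHS]E.
  under [RHS]eq_bigr => s _ do rewrite (linZ _ _ lT) tauE scaler_sumr.
  rewrite [RHS]exchange_big; apply: eq_bigr => r _; rewrite scaler_suml.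
  by apply: eq_bigr => s _; rewrite scalerA.
apply: big1 => s _; suff -> : l s = 0 by rewrite scale0r.
transitivity (\sum_r (\sum_t l t * tau t r) * rho r s); last first.
  by rewrite big1 // => r _; rewrite E mul0r.
under eq_bigr => r _ do rewrite mulr_suml.
rewrite exchange_big; under eq_bigr => t _ do (under eq_bigr => r _ do rewrite -mulrA;
  rewrite -mulr_sumr rt mulrC).
by rewrite kron.
Qed.
End SpanInj.

Section Antipode.
Variables (k : fieldType) (A : dualQuasiHopf k).
Variables (sigma : {scalar (A \ox A)%type}) (hs : co_quasi_triangular sigma).
Local Notation S := (dqh_S A).
Local Notation C := (comcat A).
Local Notation c := (combr hs).

Definition drinfeldX (p : fmat A) : chom (fob p) (fob (fdual (fdual p))) :=
  drinfeld c (evc p) (coevc (fdual p)).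
Definition drinfeldXV (p : fmat A) : chom (fob (fdual (fdual p))) (fob p) :=
  drinfeldV (C := C) (cbrV hs) (coevc p) (evc (fdual p)).
Lemma drinfeldXK p v : drinfeldXV p (drinfeldX p v) = v.
Proof.
have := drinfeldK (cbrK hs) (cbrVK hs) (pzigl p) (pzigl (fdual p)).
by move=> /(congr1 (fun f : chom (fob p) (fob p) => f v)).
Qed.

Lemma ffunZ (I : finType) (a : k) (v : {ffun I -> k^o}) i : (a *: v) i = a * (v i : k).
Proof. by rewrite ffunE. Qed.
(** The Drinfeld morphism is a morphism of comodules from X to X'', and the
    coefficients of X'' are those of X with the square of the antipode
    applied. *)
Lemma S2_conj (p : fmat A) : exists u v : fI p -> fI p -> k,
  [/\ forall i j, \sum_s v i s * u s j = (i == j)%:R &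
   forall s j, \sum_i u i j *: S (S (p s i)) = \sum_i u s i *: p i j].
Proof.
exists (fun s j => (drinfeldX p (dlt k j) : {ffun _ -> _}) s).
exists (fun s j => (drinfeldXV p (dlt k j) : {ffun _ -> _}) s).
have Eu j := ffun_dlt (drinfeldX p (dlt k j) : {ffun fI p -> k^o}).
split=> [i j|s j].
  have := congr1 (fun v : {ffun fI p -> k^o} => v i) (drinfeldXK (dlt k j)).
  rewrite [drinfeldX p _]Eu (lin_bigsum _ _ _ (cf_lin (drinfeldXV p))) sum_ffunE ffunE
    => <-.
  apply: eq_sum => s; rewrite (linZ _ _ (cf_lin (drinfeldXV p))).
  by rewrite -(Eu j); exact: (etrans (mulrC _ _) (esym (ffunZ _ _ _))).
pose F (t : {ffun fI p -> k^o} \ox A) : A := tlift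
  (fun (v : {ffun fI p -> k^o}) (a : A) => (v s : k) *: a) t.
have bF : bilin (fun (v : {ffun fI p -> k^o}) (a : A) => (v s : k) *: a).
  split=> w; last by lin.
  by move=> b x y; rewrite !ffunE scalerDl scalerA.
have lF : lin F by exact: lin_tlift.
have FE v a : F (v \ox a) = (v s : k) *: a by exact: tliftE.
have EL : coact (drinfeldX p (dlt k j)) = lext (fun x => \sum_t
  (dlt k t : {ffun fI p -> k^o}) \ox fdual (fdual p) t x) (drinfeldX p (dlt k j)) by [].
have := congr1 F (etrans (esym EL) ((cfP (drinfeldX p)).2 (dlt k j))).
rewrite /lext (mb_coact (fob_b p)) (lin_bigsum _ _ _
  (lin_tmap (cf_lin (drinfeldX p)) (@lin_id _ A))).
rewrite !(lin_bigsum _ _ _ lF).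
under [X in _ = X -> _]eq_bigr => i _ do rewrite
  (tmapE _ _ (cf_lin (drinfeldX p)) (@lin_id _ A)) FE.
move=> <-; apply: eq_sum => i; rewrite (linZ _ _ lF) (lin_bigsum _ _ _ lF).
under [in RHS]eq_bigr => t _ do rewrite FE ffunE.
by rewrite delta_sum'.
Qed.

(** By [S2_conj], the square of the antipode maps the span of the coefficients
    of a finite-dimensional comodule onto itself. *)
Lemma S2_inj a : S (S a) = 0 -> a = 0.
Proof.
have [p [l E]] := fmat_span a; have [u [v [vu uc]]] := S2_conj p.
have uv := mat_inverseC vu.
apply: (@span_inj k A (fI p * fI p)%type (fun x => p x.1 x.2) (fun a => S (S a))).
- by lin.
- move=> [s t] /=; exists (fun x => u s x.1 * v x.2 t).
  transitivity (\sum_j v j t *: \sum_i u i j *: S (S (p s i))).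
    under [RHS]eq_bigr => j _ do rewrite scaler_sumr.
    rewrite exchange_big -[LHS](@delta_sum _ _ _ t (fun i => S (S (p s i)))).
    apply: eq_bigr => i _; rewrite -uv scaler_suml.
    by apply: eq_bigr => j _; rewrite scalerA mulrC.
  rewrite sum_pair exchange_big; apply: eq_bigr => j _; rewrite uc scaler_sumr.
  by apply: eq_bigr => i _; rewrite scalerA mulrC.
- move=> [t j] /=; exists (fun x => v t x.1 * u x.2 j).
  rewrite -[LHS](@delta_sum' _ _ _ t (fun i => p i j)).
  transitivity (\sum_s v t s *: \sum_i u s i *: p i j).
    under [RHS]eq_bigr => s _ do rewrite scaler_sumr.
    rewrite exchange_big; apply: eq_bigr => i _; rewrite -vu scaler_suml.
    by apply: eq_bigr => s _; rewrite scalerA.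
  rewrite sum_pair; apply: eq_bigr => s _; rewrite -uc scaler_sumr.
  by apply: eq_bigr => i _; rewrite scalerA.
by exists (fun x => l x.1 x.2); rewrite sum_pair.
Qed.
Lemma S2_surj a : exists b, a = S (S b).
Proof.
have [p [l ->]] := fmat_span a; have [u [v [vu uc]]] := S2_conj p.
suff /(_ _ _)/cid2 H : forall i j, exists2 b, True & p i j = S (S b).
  exists (\sum_i \sum_j l i j *: s2val (H i j)).
  rewrite !linear_sum; apply: eq_bigr => i _; rewrite !linear_sum; apply: eq_bigr => j
    _.
  by rewrite !linearZ /=; case: (H i j) => /= b _ <-.
move=> t j; exists (\sum_s \sum_i (v t s * u i j) *: p s i) => //.
rewrite -[LHS](@delta_sum' _ _ _ t (fun i => p i j)).
transitivity (\sum_s v t s *: \sum_i u s i *: p i j).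
  under [RHS]eq_bigr => s _ do rewrite scaler_sumr.
  rewrite exchange_big; apply: eq_bigr => i _; rewrite -vu scaler_suml.
  by apply: eq_bigr => s _; rewrite scalerA.
rewrite !linear_sum; apply: eq_bigr => s _; rewrite -uc scaler_sumr !linear_sum.
apply: eq_bigr => i _; rewrite scalerA; rewrite !linearZ /=. by [].
Qed.
Lemma antipode_bij : exists SV : A -> A, cancel S SV /\ cancel SV S.
Proof.
have surj a : exists b, S b = a by have [b ->] := S2_surj a; exists (S b).
have [SV SVK] := choice surj; exists SV; split=> // a.
apply/eqP; rewrite -subr_eq0; apply/eqP/S2_inj.
by rewrite !linearB /= SVK subrr.
Qed.
End Antipode.

(** * The explicit formulas as composites of structural morphisms *)

Section Formulas.
Variables (k : fieldType) (A : dualQuasiHopf k).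
Variables (sigma : {scalar (A \ox A)%type}) (hs : co_quasi_triangular sigma).
Local Notation Phi a b c := (dqh_phi A (a \ox b \ox c)).
Local Notation PhiV a b c := (dqh_phiV A (a \ox b \ox c)).
Local Notation Sig a b := (sigma (a \ox b)).
Local Notation S := (dqh_S A).
Local Notation alpha := (dqh_alpha A).
Local Notation beta := (dqh_beta A).
Local Notation C := (comcat A).
Local Notation c := (combr hs).
Notation X p := (fob p).
Notation X' p := (fob (fdual p)).

Lemma lin_comulU : lin (@und_comul k A).
Proof. by apply: lin_sweedler; mlin. Qed.

(** The comultiplication inserts the coevaluation between X' and X. *)
Lemma comulU_inc (p : fmat A) i j : und_comul (p i j) =
  tmap (inc p) (inc p) (cassoc (cten (X' p) (X p)) (X' p) (X p)
    (tmap (cassocV (X' p) (X p) (X' p)) id (tmap (tmap id (coev p)) id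
      (tmap (cruV (X' p)) id (dlt k i \ox dlt k j))))).
Proof.
have -> : tmap (cassocV (X' p) (X p) (X' p)) id
  (tmap (tmap id (coev p)) id (tmap (cruV (X' p)) id (dlt k i \ox dlt k j)))
  = cassocV (X' p) (X p) (X' p) (tmap id (coev p) (cruV (X' p) (dlt k i))) \ox
    (dlt k j : X p).
  by do 3 tmap_eval.
rewrite (coev_alV p (fob_b (fdual p))).
have l1 := linD_ext' (dlt k j : X p) (cf_lin (cassoc (cten (X' p) (X p)) (X' p) (X p))).
rewrite (push _ l1 (fun x : fI p * fI p * (fI p * fI p * fI p) =>
  assoc_b (mbasis_cten (fob_b (fdual p)) (fob_b p)) (fob_b (fdual p)) (fob_b p) x.2.1
    x.2.2 j)).
have l2 := lin_tmap (cf_lin (inc p)) (cf_lin (inc p)).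
rewrite (lin_bigsum _ _ _ l2).
under eq_bigr => x _ do rewrite (linZ _ _ l2) (tmapE _ _ (cf_lin (inc p))
  (cf_lin (inc p))) !incE.
have mp := fmP p; rewrite /und_comul; etransitivity; [sweedler_expand|]; cbv beta.
symmetry; etransitivity; [flatten|]; rewrite /= /mdual /mprod /=; symmetry.
pulls [:: (0, 2); (0, 4); (0, 4); (0, 2); (0, 0); (0, 0); (0, 0); (0, 0); (0, 0)]%N.
congr (_ *: _); ring.
Qed.

Section Antipode.
Variables (SV : A -> A) (SK : cancel S SV) (SVK : cancel SV S).
Lemma lin_SV : lin SV.
Proof.
move=> a x y; apply: (can_inj SK); rewrite SVK linearP !SVK //.
Qed.
Hint Resolve lin_SV : lins.
Lemma lin_pLl b : @lin k A k^o (fun a => pL SV a b).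
Proof. by apply: lin_sweedler; mlin. Qed.
Lemma lin_pLr a : @lin k A k^o (pL SV a).
Proof. by apply: lin_sweedlerF; nlin_red; intros_lin; lin. Qed.
Hint Resolve lin_pLl lin_pLr : lins.
Lemma pL_mat (p : fmat A) x y b : pL SV (S (S (p x y))) b =
  \sum_s \sum_t Phi (S (p t y)) (S (S (p x s))) b * beta (S (p s t)).
Proof.
have mp := fmP (fdual (fdual p)); rewrite /pL.
change (S (S (p x y))) with (fdual (fdual p) x y).
rewrite sweedler_pathsk; [cbn [paths Nat.pred]|by []|mlin].
by apply: eq_sum => s; apply: eq_sum => t; rewrite /= /mdual !SK.
Qed.
Lemma lin_antipodeU : lin (und_antipode SV (sigmaV sigma)).
Proof. by apply: lin_sweedler; mlin. Qed.

Lemma coend_coact_flat (M : comod A) (J : finType) (d : J -> J -> A) (e : J -> M)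
  (be : mbasis d e) j :
  coend_coact (e j) = \sum_(x : J * J * J * J * J)
     (Phi (d x.1.1.1.1 x.1.1.1.2) (S (d x.1.1.2 x.1.2)) (d x.2 j) * beta
       (d x.1.1.1.2 x.1.1.2))
      *: (e x.1.1.1.1 \ox d x.1.2 x.2).
Proof. by rewrite (coend_coact_b be) !sum_pair. Qed.

(** The antipode of the formula is: apply the universal coaction to X', take
    its coefficient across X' by the inverse braiding, and evaluate X' against
    X. The factor [pL] comes from the universal coaction of X', whose formula
    involves [S] of coefficients of X'. *)
Lemma antipodeU_inc (p : fmat A) i j : und_antipode SV (sigmaV sigma) (p i j) =
  cru (cund A) (tmap id (ev p) (cassoc (cund A) (X' p) (X p)
    (tmap (cbrV hs (cund A) (X' p)) id
     (tmap (cdelta (X' p)) id (dlt k i \ox dlt k j))))).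
Proof.
rewrite [tmap (cdelta _) _ _]tmapE; [|exact: cf_lin|exact: lin_id].
rewrite [cdelta _ _](coend_coact_flat (fob_b (fdual p))).
have l1 := linD_ext' (dlt k j : X p) (lin_tmap (cf_lin (cbrV hs (cund A) (X' p)))
  (@lin_id _ (X p))).
rewrite (push _ l1 (fun x : fI p * fI p * fI p * fI p * fI p =>
  tmapl_b (cf_lin (cbrV hs (cund A) (X' p))) (@lin_id _ (X p)) (dlt k j : X p)
   (inv_braiding_b sigma (cund_b (fdual p)) (fob_b (fdual p)) (x.1.2, x.2) x.1.1.1.1))).
rewrite (push _ (cf_lin (cassoc (cund A) (X' p) (X p)))
  (fun x : fI p * fI p * fI p * fI p * fI p * (fI p * fI p * fI p) =>
  assoc_b (cund_b (fdual p)) (fob_b (fdual p)) (fob_b p) x.2.1 x.2.2 j)).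
have l2 : lin (fun t => cru (cund A) (tmap (fun x : cund A => x) (ev p) t)) by clin.
rewrite (lin_bigsum _ _ _ l2).
under eq_bigr => x _ do rewrite (linZ _ _ l2) (@cru_ev _ _ p (cund A)) scalerA.
have mp := fmP p; rewrite /und_antipode; etransitivity; [sweedler_expand|]; cbv beta.
etransitivity.
  do 10 (refine (eq_sum _); intro).
  by refine (etrans (congr1 (fun z => z *: _) _) _);
    [rewrite pL_mat sigmaVE -!mulrA; distr_mul|distr_scale].
cbv beta; symmetry; etransitivity; [flatten|]; rewrite /= /mdual /mprod /=; symmetry.
pulls [:: (0, 4); (0, 5); (0, 7); (0, 6); (0, 4); (0, 3); (0, 0); (0, 2); (0, 2);
  (0, 2); (0, 1); (0, 0)]%N.
congr (_ *: _); ring.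
Qed.
End Antipode.

Lemma lin_gamma_l b : @lin k A k^o (fun a => gamma_form a b).
Proof. by apply: lin_sweedler; mlin. Qed.
Lemma lin_gamma_r a : @lin k A k^o (gamma_form a).
Proof. by apply: lin_sweedlerF; nlin_red; intros_lin; apply: lin_sweedler; mlin. Qed.
Hint Resolve lin_gamma_l lin_gamma_r : lins.
Lemma lin_f_l b : @lin k A k^o (fun a => f_form a b).
Proof. by apply: lin_sweedler; mlin. Qed.
Lemma lin_f_r a : @lin k A k^o (f_form a).
Proof. by apply: lin_sweedlerF; nlin_red; intros_lin; apply: lin_sweedler; mlin. Qed.
Hint Resolve lin_f_l lin_f_r : lins.

(** The evaluation of the word X' Y' Y X, from the inside out, with Y and X
    bound into one object. *)
Definition nest (p q : fmat A) : hom ((fo (fdual p) ⊗ fo (fdual q)) ⊗ fo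
  (fprod q p))%cat (one : C) :=
  (evc p ∘ (ru (fo (fdual p)) ∘ fo (fdual p) ∙ evc q ∘ al (fo (fdual p))
    (fo (fdual q)) (fo q)) · fo p
    ∘ alV (fo (fdual p) ⊗ fo (fdual q)) (fo q) (fo p)
    ∘ (fo (fdual p) ⊗ fo (fdual q)) ∙ (psiV q p : hom (fo (fprod q p))
      (fo q ⊗ fo p)))%cat.
(** The transpose of [nest], that is, the comparison of [X' (x) Y'] with the
    dual of [Y (x) X]. *)
Definition th (p q : fmat A) : chom (cten (X' p) (X' q)) (fob (fdual (fprod q p))) :=
  (lu (fo (fdual (fprod q p))) ∘ nest p q · fo (fdual (fprod q p))
   ∘ alV (fo (fdual p) ⊗ fo (fdual q)) (fo (fprod q p)) (fo (fdual (fprod q p)))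
   ∘ (fo (fdual p) ⊗ fo (fdual q)) ∙ coevc (fprod q p) ∘ ruV
     (fo (fdual p) ⊗ fo (fdual q)))%cat.

(** The form gamma is visible here: it is the coefficient of [nest], up to the
    order of the factors. *)
Lemma nestE (p q : fmat A) i j (yx : fI q * fI p) :
  nest p q ((dlt k i \ox dlt k j) \ox dlt k yx) =
  \sum_(z : fI p * fI q * fI q * fI p * (fI p * fI q * fI q))
    PhiV (S (p i z.1.1.1.1) ** S (q j z.1.1.1.2)) (q z.1.1.2 yx.1) (p z.1.2 yx.2)
    * Phi (S (p z.1.1.1.1 z.2.1.1)) (S (q z.1.1.1.2 z.2.1.2)) (q z.2.2 z.1.1.2)
    * alpha (q z.2.1.2 z.2.2) * alpha (p z.2.1.1 z.1.2).
Proof.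
pose G t := cru (X' p) (tmap (fun x : X' p => x) (ev q) (cassoc (X' p) (X' q) (X q) t)).
have lG : lin G by rewrite /G; clin.
have GE i' j' y' : G ((dlt k i' \ox dlt k j') \ox dlt k y') =
   \sum_(w : fI p * fI q * fI q) (Phi (S (p i' w.1.1)) (S (q j' w.1.2)) (q w.2 y')
      * alpha (q w.1.2 w.2)) *: dlt k w.1.1.
  rewrite /G [cassoc _ _ _ _](assoc_b (fob_b (fdual p)) (fob_b (fdual q)) (fob_b q)).
  have l : lin (fun t => cru (X' p) (tmap (fun x : X' p => x) (ev q) t)) by clin.
  rewrite (lin_bigsum _ _ _ l); apply: eq_sum => w.
  by rewrite (linZ _ _ l) cru_ev scalerA.
change (ev p (tmap G id (cassocV (cten (X' p) (X' q)) (X q) (X p) (tmap id (psiV q p)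
  ((dlt k i \ox dlt k j) \ox dlt k yx)))) = \sum_(z : fI p * fI q * fI q * fI p *
    (fI p * fI q * fI q))
    PhiV (S (p i z.1.1.1.1) ** S (q j z.1.1.1.2)) (q z.1.1.2 yx.1) (p z.1.2 yx.2)
    * Phi (S (p z.1.1.1.1 z.2.1.1)) (S (q z.1.1.1.2 z.2.1.2)) (q z.2.2 z.1.1.2)
    * alpha (q z.2.1.2 z.2.2) * alpha (p z.2.1.1 z.1.2)).
rewrite [tmap id (psiV q p) _]tmapE; [|exact: lin_id|exact: cf_lin].
rewrite psiVE [cassocV _ _ _ _](assocV_b (mbasis_cten (fob_b (fdual p))
  (fob_b (fdual q))) (fob_b q) (fob_b p) (i, j)).
rewrite (push _ (lin_tmap lG (@lin_id _ (X p))) (fun z : fI p * fI q * fI q * fI p =>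
  tmapl_b lG (@lin_id _ (X p)) (dlt k z.2 : X p) (GE z.1.1.1 z.1.1.2 z.1.2))).
rewrite (lin_bigsum _ _ _ (cf_lin (ev p))); apply: eq_sum => z.
by rewrite (linZ _ _ (cf_lin (ev p))) [ev p _]evalfE mulrA.
Qed.

(** The twist f is the coefficient matrix of the comparison [th]. *)
Lemma thE (p q : fmat A) i j : th p q (dlt k i \ox dlt k j) =
  \sum_(z : fI q * fI p) f_form (q j z.1) (p i z.2) *: dlt k z.
Proof.
pose V := cten (X' p) (X' q); pose W := fob (fdual (fprod q p)).
have l1 : lin (fun t => clu W (tmap (nest p q) (fun x : W => x) t)) by clin.
change (clu W (tmap (nest p q) id (cassocV V (X (fprod q p)) W
  (tmap id (coev (fprod q p)) (cruV V (dlt k i \ox dlt k j)))))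
  = \sum_(z : fI q * fI p) f_form (q j z.1) (p i z.2) *: dlt k z).
have -> := @coev_alV _ _ (fprod q p) V _ _ _ (mbasis_cten (fob_b (fdual p))
  (fob_b (fdual q))) (i, j).
rewrite (lin_bigsum _ _ _ l1).
under eq_bigr => x _ do (rewrite (linZ _ _ l1) tmapE ?[clu _ _]cluE;
  [|exact: cf_lin|exact: lin_id]).
etransitivity.
  by refine (eq_sum _); intro; rewrite nestE scalerA mulr_sumr; distr_scale.
rewrite -sum_pair'; etransitivity; [flatten|]; rewrite /= /mdual /mprod /=.
symmetry; etransitivity; [flatten|]; cbn [fst snd].
have mp := fmP p; have mq := fmP q.
etransitivity.
  do 2 (refine (eq_sum _); intro).
  by refine (etrans (congr1 (fun z => z *: _) _) _);
    [rewrite /f_form; sweedler_expand|distr_scale].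
etransitivity.
  do 10 (refine (eq_sum _); intro).
  by refine (etrans (congr1 (fun z => z *: _) _) _);
    [rewrite mulrC; refine (etrans (congr1 (fun z => z * _) _) _);
      [rewrite /gamma_form; sweedler_expand|distr_mul]|distr_scale].
cbv beta.
pulls [:: (0, 8); (0, 8); (0, 5); (0, 5); (0, 0); (0, 1); (0, 2); (0, 2); (0, 0);
  (0, 0); (0, 1); (0, 4); (0, 4); (0, 1); (0, 0); (0, 1); (0, 0)]%N.
congr (_ *: _); ring.
Qed.

Lemma mulf_bilin : bilin (und_mulf sigma).
Proof.
split=> ?; first by apply: lin_sweedler; mlin.
by apply: lin_sweedlerF; nlin_red; intros_lin; apply: lin_sweedler; mlin.
Qed.
Lemma lin_mulU : lin (und_mul sigma).
Proof. exact: lin_tlift mulf_bilin. Qed.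
Lemma mulUE a b : und_mul sigma (a \ox b) = und_mulf sigma a b.
Proof. exact: (tliftE mulf_bilin). Qed.

(** The product of the generators of X and Y: bring [X' X Y' Y] into the order
    [X' Y' Y X], compare [X' Y'] with the dual of [Y X], and apply the
    generator of the latter. *)
Definition mcomp (p q : fmat A) : chom (cten (cten (X' p) (X p)) (cten (X' q) (X q)))
  (cund A) :=
  ((inc (fprod q p) : hom (fo (fdual (fprod q p)) ⊗ fo (fprod q p)) (cund A : C))
   ∘ tenm (th p q : hom (fo (fdual p) ⊗ fo (fdual q)) (fo (fdual (fprod q p))))
       ((psi q p : hom (fo q ⊗ fo p) (fo (fprod q p))) ∘ c (fo p) (fo q))
   ∘ alV (fo (fdual p)) (fo (fdual q)) (fo p ⊗ fo q)
   ∘ fo (fdual p) ∙ (al (fo (fdual q)) (fo p) (fo q) ∘ c (fo p) (fo (fdual q)) · fo q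
        ∘ alV (fo p) (fo (fdual q)) (fo q))
   ∘ al (fo (fdual p)) (fo p) (fo (fdual q) ⊗ fo q))%cat.

Lemma mulU_inc (p q : fmat A) i x j y :
  und_mulf sigma (p i x) (q j y) = mcomp p q ((dlt k i \ox dlt k x) \ox
    (dlt k j \ox dlt k y)).
Proof.
pose G t := cassoc (X' q) (X p) (X q) (tmap (cbr hs (X p) (X' q)) (fun x : X q => x)
  (cassocV (X p) (X' q) (X q) t)).
have lG : lin G by rewrite /G; clin.
pose T t := inc (fprod q p) (tmap (th p q) (fun t => psi q p (cbr hs (X p) (X q) t)) t).
have lT : lin T by rewrite /T; clin.
have GE x' j' y' : G (dlt k x' \ox (dlt k j' \ox dlt k y')) =
  \sum_(w : fI p * fI q * fI q * (fI p * fI q) * (fI q * fI p * fI q))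
    (PhiV (p w.1.1.1.1 x') (S (q j' w.1.1.1.2)) (q w.1.1.2 y')
     * Sig (p w.1.2.1 w.1.1.1.1) (S (q w.1.1.1.2 w.1.2.2))
     * Phi (S (q w.1.2.2 w.2.1.1)) (p w.2.1.2 w.1.2.1) (q w.2.2 w.1.1.2))
    *: (dlt k w.2.1.1 \ox (dlt k w.2.1.2 \ox dlt k w.2.2)).
  rewrite /G [cassocV _ _ _ _](assocV_b (fob_b p) (fob_b (fdual q)) (fob_b q)).
  rewrite (push _ (lin_tmap (cf_lin (cbr hs (X p) (X' q))) (@lin_id _ (X q)))
    (fun z : fI p * fI q * fI q =>
    tmapl_b (cf_lin (cbr hs (X p) (X' q))) (@lin_id _ (X q)) (dlt k z.2 : X q)
      (braid_b sigma (fob_b p) (fob_b (fdual q)) z.1.1 z.1.2))).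
  by rewrite (push _ (cf_lin (cassoc (X' q) (X p) (X q)))
    (fun z : fI p * fI q * fI q * (fI p * fI q) =>
    assoc_b (fob_b (fdual q)) (fob_b p) (fob_b q) z.2.2 z.2.1 z.1.2)).
have TE i' j' x' y' : T ((dlt k i' \ox dlt k j') \ox (dlt k x' \ox dlt k y')) =
  \sum_(w : fI q * fI p * (fI p * fI q)) (f_form (q j' w.1.1) (p i' w.1.2) * Sig
    (p w.2.1 x') (q w.2.2 y'))
    *: (q w.1.1 w.2.2 ** p w.1.2 w.2.1).
  rewrite /T tmapE; [|exact: cf_lin|by clin].
  rewrite thE [cbr _ _ _ _](braid_b sigma (fob_b p) (fob_b q)).
  rewrite (lin_bigsum _ _ _ (cf_lin (psi q p))).
  rewrite (lin_bigsum (f := fun t => t \ox _)); last by lin.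
  rewrite (lin_bigsum _ _ _ (cf_lin (inc (fprod q p)))) [RHS]sum_pair; apply: eq_sum
    => z.
  rewrite (linZ (f := fun t => t \ox _)); last by lin.
  rewrite (lin_bigsum (f := otimes _)); last by lin.
  rewrite (linZ _ _ (cf_lin (inc (fprod q p))))
    (lin_bigsum _ _ _ (cf_lin (inc (fprod q p)))) scaler_sumr.
  apply: eq_sum => w; rewrite (linZ _ _ (cf_lin (psi q p))) (linZ (f := otimes _));
    last by lin.
  by rewrite (linZ _ _ (cf_lin (inc (fprod q p)))) psiE incE scalerA.
change (und_mulf sigma (p i x) (q j y) = T (cassocV (X' p) (X' q) (cten (X p) (X q))
  (tmap id G
  (cassoc (X' p) (X p) (cten (X' q) (X q)) ((dlt k i \ox dlt k x) \ox
    (dlt k j \ox dlt k y)))))).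
rewrite [cassoc _ _ _ _](assoc_b (fob_b (fdual p)) (fob_b p)
  (mbasis_cten (fob_b (fdual q)) (fob_b q)) i x (j, y)).
rewrite (push _ (lin_tmap (@lin_id _ (X' p)) lG) (fun z : fI p * fI p * (fI q * fI q) =>
  tmapr_b (@lin_id _ (X' p)) lG (dlt k z.1.1 : X' p) (GE z.1.2 z.2.1 z.2.2))).
rewrite (push _ (cf_lin (cassocV (X' p) (X' q) (cten (X p) (X q))))
  (fun z : fI p * fI p * (fI q * fI q) *
   (fI p * fI q * fI q * (fI p * fI q) * (fI q * fI p * fI q)) =>
  assocV_b (fob_b (fdual p)) (fob_b (fdual q)) (mbasis_cten (fob_b p) (fob_b q))
    z.1.1.1 z.2.2.1.1 (z.2.2.1.2, z.2.2.2))).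
rewrite (push _ lT (fun z : fI p * fI p * (fI q * fI q) *
   (fI p * fI q * fI q * (fI p * fI q) * (fI q * fI p * fI q)) *
     (fI p * fI q * (fI p * fI q)) =>
  TE z.2.1.1 z.2.1.2 z.2.2.1 z.2.2.2)).
have mp := fmP p; have mq := fmP q.
symmetry; etransitivity; [flatten|]; rewrite /= /mdual /mprod /=; symmetry.
etransitivity; [rewrite /und_mulf; sweedler_expand|]; cbv beta.
pull 0%N 0%N as u1. pull 0%N 11%N as u2. pull 0%N 15%N as u3. pull 1%N 12%N as u5.
pull 1%N 9%N as u6. pull 1%N 6%N as u7. pull 1%N 3%N as u8. pull 1%N 0%N as u9.
pull 1%N 0%N as v1. pull 1%N 1%N as v2. pull 1%N 2%N as v3. pull 1%N 2%N as v4.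
pull 1%N 3%N as v5. pull 1%N 4%N as v6. pull 2%N 3%N as v8. pull 2%N 2%N as v9.
pull 2%N 1%N as v10. pull 2%N 0%N as v11.
(* The factors common to both sides. The formula has [sigma (a4, b7)] times [a5
   b8], the composite has [b7 a4] times [sigma (a5, b8)]; sigma exchanges
   them. *)
pose K := Phi (S (p i u1)) (p u9 x) (S (q j v1) ** q v11 y) * f_form (q v5 v6)
  (p u2 u3)
  * Sig (p u7 u8) (S (q v2 v3)) * PhiV (S (p u1 u2)) (S (q v4 v5))
    (p u5 u6 ** q v8 v9)
  * PhiV (p u8 u9) (S (q v1 v2)) (q v10 v11) * Phi (S (q v3 v4))
    (p u6 u7) (q v9 v10).
transitivity (K *: \sum_s \sum_t Sig (p u3 s) (q v6 t) *: (p s u5 ** q t v8)).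
  rewrite scaler_sumr; apply: eq_sum => s; rewrite scaler_sumr; apply: eq_sum => t.
  rewrite scalerA; congr (_ *: _); rewrite /K; ring.
rewrite -(sig_comm hs (fob_b p) (fob_b q)).
rewrite scaler_sumr; apply: eq_sum => s; rewrite scaler_sumr; apply: eq_sum => t.
rewrite scalerA; congr (_ *: _); rewrite /K; ring.
Qed.
End Formulas.

(** * The Hopf algebra structure on a coend *)

Local Open Scope cat_scope.
Section Coend.
Variables (C : moncat) (c : braiding C).
Variable cV : forall X Y : C, hom (Y ⊗ X) (X ⊗ Y).
Hypothesis cK : forall X Y, cV X Y ∘ br c X Y = idm.
Hypothesis cVK : forall X Y, br c X Y ∘ cV X Y = idm.
Variables (P : Type) (obj : P -> C) (dl : P -> P).
Local Notation L p := (obj p).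
Local Notation L' p := (obj (dl p)).
Variable e : forall p, hom (L' p ⊗ L p) one.
Variable n : forall p, hom one (L p ⊗ L' p).
Hypothesis zigl : forall p,
  ru (L p) ∘ L p ∙ e p ∘ al (L p) (L' p) (L p) ∘ n p · L p ∘ luV (L p) = idm.
Hypothesis zigr : forall p,
  lu (L' p) ∘ e p · L' p ∘ alV (L' p) (L p) (L' p) ∘ L' p ∙ n p
    ∘ ruV (L' p) = idm.
Variables (U : C) (m : hom (U ⊗ U) U) (D : hom U (U ⊗ U))
  (et : hom one U) (ep : hom U one) (S : hom U U).
Variable i : forall p, hom (L' p ⊗ L p) U.
Variable delta : forall X : C, hom X (X ⊗ U).
Hypothesis delta_nat : forall X Y (f : hom X Y), delta Y ∘ f = f · U ∘ delta X.
(** The coaction and the generators determine each other through the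
    duality. *)
Hypothesis delta_obj : forall p,
  delta (L p) = L p ∙ i p ∘ al _ _ _ ∘ n p · L p ∘ luV (L p).

(** The universal coaction on the last letter of a word. *)
Definition d V X : hom (V ⊗ X) (V ⊗ X ⊗ U) := spl (delta X) V.

Lemma d_nat V W X (f : hom V W) : d W X ∘ f · X = f · X · U ∘ d V X.
Proof. exact: spl_nat. Qed.
Lemma d_natr V X Y (f : hom X Y) : d V Y ∘ V ∙ f = V ∙ f · U ∘ d V X.
Proof.
by rewrite /d !splE !compA -wlM delta_nat wlM (r22 _ (alV_natm _ _ _)).
Qed.

Lemma d_obj V p : d V (L p) = mrg (i p) (V ⊗ L p) ∘ cre (n p) V · L p.
Proof.
apply: (injl (alK _ _ _)).
rewrite /d splE delta_obj (r20 _ (alVK _ _ _)) mrgE creE splE !whM !wlM !compA.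
rewrite (r22 _ (al_natr _ _ _)) (r32 _ (pentagonV _ _ _ _)).
by rewrite (r22 _ (al_natm _ _ _)) al_luV.
Qed.

(** The generators are recovered from the coaction: act on X and evaluate the
    remaining strand. *)
Lemma mrg_iE V p : mrg (i p) V = kil (e p) V · U ∘ d (V ⊗ L' p) (L p).
Proof.
rewrite d_obj -(r22 _ (mrg_nat _ _)) -whM (zigzagr (zigr p)).
by rewrite tenm1 compm1.
Qed.

(** The generators are jointly epimorphic, also in the middle of a word. *)
Hypothesis cover : forall V W Y Z (f g : hom (V ⊗ U ⊗ Y ⊗ Z) W),
  (forall p, f ∘ mrg (i p) V · Y · Z = g ∘ mrg (i p) V · Y · Z) -> f = g.

Lemma cover1 V W Y (f g : hom (V ⊗ U ⊗ Y) W) :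
  (forall p, f ∘ mrg (i p) V · Y = g ∘ mrg (i p) V · Y) -> f = g.
Proof.
move=> E; apply: (injr (ruVK _)); apply: cover => p.
by rewrite !compA ru_nat -!compA E.
Qed.
Lemma cover0 V W (f g : hom (V ⊗ U) W) :
  (forall p, f ∘ mrg (i p) V = g ∘ mrg (i p) V) -> f = g.
Proof.
move=> E; apply: (injr (ruVK _)); apply: cover1 => p.
by rewrite !compA ru_nat -!compA E.
Qed.

Section Unique.
Variables (F : C -> C) (Fm : forall V W, hom V W -> hom (F V) (F W)).

(** A natural family on words ending in [U] is determined by its composites
    with the coaction, since generators are a coaction followed by an
    evaluation, and naturality in [V] moves the evaluation out of the way. *)
Lemma uniq1 (g h : forall V, hom (V ⊗ U) (F V)) :
  (forall V W (f : hom V W), Fm f ∘ g V = g W ∘ f · U) ->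
  (forall V W (f : hom V W), Fm f ∘ h V = h W ∘ f · U) ->
  (forall V p, g (V ⊗ L p) ∘ d V (L p) = h (V ⊗ L p) ∘ d V (L p)) ->
  forall V, g V = h V.
Proof.
move=> gn hn E V; apply: cover0 => p.
by rewrite mrg_iE -!compA -gn -hn !compA E.
Qed.
Lemma uniq1w Y (g h : forall V, hom (V ⊗ U ⊗ Y) (F V)) :
  (forall V W (f : hom V W), Fm f ∘ g V = g W ∘ f · U · Y) ->
  (forall V W (f : hom V W), Fm f ∘ h V = h W ∘ f · U · Y) ->
  (forall V p, g (V ⊗ L p) ∘ d V (L p) · Y = h (V ⊗ L p) ∘ d V (L p) · Y) ->
  forall V, g V = h V.
Proof.
move=> gn hn E V; apply: cover1 => p.
by rewrite mrg_iE !whM -!compA -gn -hn !compA E.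
Qed.
Lemma uniq1ww Y Z (g h : forall V, hom (V ⊗ U ⊗ Y ⊗ Z) (F V)) :
  (forall V W (f : hom V W), Fm f ∘ g V = g W ∘ f · U · Y · Z) ->
  (forall V W (f : hom V W), Fm f ∘ h V = h W ∘ f · U · Y · Z) ->
  (forall V p, g (V ⊗ L p) ∘ d V (L p) · Y · Z = h (V ⊗ L p) ∘ d V (L p) · Y · Z) ->
  forall V, g V = h V.
Proof.
move=> gn hn E V; apply: cover => p.
by rewrite mrg_iE !whM -!compA -gn -hn !compA E.
Qed.
End Unique.

(** Takes a copy of [U] produced by the coaction across the next letter. *)
Definition s V X : hom (V ⊗ U ⊗ X) (V ⊗ X ⊗ U) := bV cV V X U.
Lemma s_nat V W X (f : hom V W) : s W X ∘ f · U · X = f · X · U ∘ s V X.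
Proof. exact: (bV_nat cK cVK). Qed.

(** The two copies of [U] are produced by the coaction on [L q] and on [L p];
    the first one has to cross [L p] by [s]. *)
Lemma uniq2w Z (F : C -> C) (Fm : forall V W, hom V W -> hom (F V) (F W))
    (g h : forall V, hom (V ⊗ U ⊗ U ⊗ Z) (F V)) :
  (forall V W (f : hom V W), Fm _ _ f ∘ g V = g W ∘ f · U · U · Z) ->
  (forall V W (f : hom V W), Fm _ _ f ∘ h V = h W ∘ f · U · U · Z) ->
  (forall V q p, let T := (d (V ⊗ L q) (L p) · U ∘ s (V ⊗ L q) (L p)
      ∘ d V (L q) · L p) · Z in
     g (V ⊗ L q ⊗ L p) ∘ T = h (V ⊗ L q ⊗ L p) ∘ T) ->
  forall V, g V = h V.
Proof.
move=> gn hn E; apply: (uniq1ww gn hn) => V p.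
apply: (injr (w20 Z (bK cK V (L p) U))); rewrite -/(s _ _) !compA.
move: V; apply: (@uniq1ww (fun V => F (V ⊗ L p)) (fun V W f => Fm _ _ (f · L p)) _ _
  (fun V => g (V ⊗ L p) ∘ d V (L p) · U · Z ∘ s V (L p) · Z)
  (fun V => h (V ⊗ L p) ∘ d V (L p) · U · Z ∘ s V (L p) · Z)).
- move=> V W f; rewrite -compA gn !compA -(r22 _ (w22 Z (w22 U (d_nat _ _)))).
  by rewrite -(w22 Z (s_nat _ _)).
- move=> V W f; rewrite -compA hn !compA -(r22 _ (w22 Z (w22 U (d_nat _ _)))).
  by rewrite -(w22 Z (s_nat _ _)).
by move=> V q; have := E V q p; rewrite /= !whM !compA.
Qed.
Lemma uniq2 (F : C -> C) (Fm : forall V W, hom V W -> hom (F V) (F W))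
    (g h : forall V, hom (V ⊗ U ⊗ U) (F V)) :
  (forall V W (f : hom V W), Fm _ _ f ∘ g V = g W ∘ f · U · U) ->
  (forall V W (f : hom V W), Fm _ _ f ∘ h V = h W ∘ f · U · U) ->
  (forall V q p, let T := d (V ⊗ L q) (L p) · U ∘ s (V ⊗ L q) (L p)
      ∘ d V (L q) · L p in
     g (V ⊗ L q ⊗ L p) ∘ T = h (V ⊗ L q ⊗ L p) ∘ T) ->
  forall V, g V = h V.
Proof.
move=> gn hn E; apply: (uniq1w gn hn) => V p.
apply: (injr (bK cK V (L p) U)); rewrite -/(s _ _) !compA.
move: V; apply: (@uniq1w (fun V => F (V ⊗ L p)) (fun V W f => Fm _ _ (f · L p)) _
  (fun V => g (V ⊗ L p) ∘ d V (L p) · U ∘ s V (L p))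
  (fun V => h (V ⊗ L p) ∘ d V (L p) · U ∘ s V (L p))).
- move=> V W f; rewrite -compA gn !compA -(r22 _ (w22 U (d_nat _ _))).
  by rewrite -(s_nat _ _).
- move=> V W f; rewrite -compA hn !compA -(r22 _ (w22 U (d_nat _ _))).
  by rewrite -(s_nat _ _).
by move=> V q; have := E V q p; rewrite /= !compA.
Qed.
Lemma uniq3 (F : C -> C) (Fm : forall V W, hom V W -> hom (F V) (F W))
    (g h : forall V, hom (V ⊗ U ⊗ U ⊗ U) (F V)) :
  (forall V W (f : hom V W), Fm _ _ f ∘ g V = g W ∘ f · U · U · U) ->
  (forall V W (f : hom V W), Fm _ _ f ∘ h V = h W ∘ f · U · U · U) ->
  (forall V r q p, let T := d (V ⊗ L r ⊗ L q) (L p) · U · U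
      ∘ s (V ⊗ L r ⊗ L q) (L p) · U ∘ s (V ⊗ L r ⊗ L q ⊗ U) (L p)
      ∘ (d (V ⊗ L r) (L q) · U ∘ s (V ⊗ L r) (L q) ∘ d V (L r) · L q) · L p in
     g (V ⊗ L r ⊗ L q ⊗ L p) ∘ T = h (V ⊗ L r ⊗ L q ⊗ L p) ∘ T) ->
  forall V, g V = h V.
Proof.
move=> gn hn E; apply: (uniq1ww gn hn) => V p.
apply: (injr (w20 U (bK cK V (L p) U))).
apply: (injr (bK cK (V ⊗ U) (L p) U)); rewrite -/(s _ _) -/(s (V ⊗ U) _) !compA.
move: V; apply: (@uniq2w _ (fun V => F (V ⊗ L p)) (fun V W f => Fm _ _ (f · L p))
  (fun V => g (V ⊗ L p) ∘ d V (L p) · U · U ∘ s V (L p) · U ∘ s (V ⊗ U) (L p))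
  (fun V => h (V ⊗ L p) ∘ d V (L p) · U · U ∘ s V (L p) · U ∘ s (V ⊗ U) (L p))).
- move=> V W f; rewrite -compA gn !compA -(r22 _ (w22 U (w22 U (d_nat _ _)))).
  by rewrite -(r22 _ (w22 U (s_nat _ _))) -(s_nat _ _).
- move=> V W f; rewrite -compA hn !compA -(r22 _ (w22 U (w22 U (d_nat _ _)))).
  by rewrite -(r22 _ (w22 U (s_nat _ _))) -(s_nat _ _).
by move=> V r q; have := E V r q p; rewrite /= !whM !compA.
Qed.

(** The structure maps acting at the end of a word. *)
Definition mu V := mrg m V.
Definition Dl V := spl D V.
Definition eta V := cre1 et V.
Definition eps V := kil1 ep V.
Definition I V p := mrg (i p) V.
Definition sn V : hom (V ⊗ U) (V ⊗ U) := V ∙ S.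

Lemma mu_nat V W (f : hom V W) : mu W ∘ f · U · U = f · U ∘ mu V.
Proof. exact: mrg_nat. Qed.
Lemma Dl_nat V W (f : hom V W) : Dl W ∘ f · U = f · U · U ∘ Dl V.
Proof. exact: spl_nat. Qed.
Lemma eta_nat V W (f : hom V W) : eta W ∘ f = f · U ∘ eta V.
Proof. exact: cre1_nat. Qed.
Lemma eps_nat V W (f : hom V W) : eps W ∘ f · U = f ∘ eps V.
Proof. exact: kil1_nat. Qed.
Lemma I_nat V W p (f : hom V W) : I W p ∘ f · L' p · L p = f · U ∘ I V p.
Proof. exact: mrg_nat. Qed.

Hypothesis ep_i : forall p, ep ∘ i p = e p.
Hypothesis D_i : forall p, D ∘ i p
  = tenm (i p) (i p) ∘ al _ _ _ ∘ cre (n p) (L' p) · L p.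

(** A natural family on words ending in X is determined by its composites with
    the evaluation against X': append X X' by a coevaluation, and straighten
    the strand. *)
Lemma strip1 p (F : C -> C) (Fm : forall V W, hom V W -> hom (F V) (F W))
    (g h : forall V, hom (V ⊗ L p) (F (V ⊗ L p))) :
  (forall V (f : hom V V), f = idm -> Fm V V f = idm) ->
  (forall V W T (f : hom W T) (k : hom V W), Fm _ _ (f ∘ k) = Fm _ _ f ∘ Fm _ _ k) ->
  (forall V W (f : hom V W), Fm _ _ (f · L p) ∘ g V = g W ∘ f · L p) ->
  (forall V W (f : hom V W), Fm _ _ (f · L p) ∘ h V = h W ∘ f · L p) ->
  (forall V, Fm _ _ (kil (e p) V) ∘ g (V ⊗ L' p) = Fm _ _ (kil (e p) V) ∘ h
    (V ⊗ L' p)) ->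
  forall V, g V = h V.
Proof.
move=> F1 FM gn hn E V.
have zz k : (forall V W (f : hom V W), Fm _ _ (f · L p) ∘ k V = k W ∘ f · L p) ->
  k V = Fm _ _ (kil (e p) (V ⊗ L p)) ∘ k (V ⊗ L p ⊗ L' p) ∘ cre (n p) V · L p.
  move=> kn; rewrite -kn -compA -FM (zigzagl (zigl p)).
  by rewrite F1 ?comp1m.
by rewrite (zz g) // (zz h) // -!compA E.
Qed.

Lemma eps_d V p : eps (V ⊗ L p) ∘ d V (L p) = idm.
Proof.
move: V; apply: (@strip1 p id (fun V W f => f) (fun V => eps (V ⊗ L p) ∘ d V (L p))
  (fun V => idm)) => //.
- by move=> V W f; rewrite !compA d_nat -!compA eps_nat.
- by move=> V W f; rewrite comp1m compm1.
move=> V; rewrite compm1 -compA -eps_nat compA -mrg_iE /eps kil1E mrgE.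
by rewrite !compA -[V ∙ ep ∘ _]compA -wlM ep_i kilE mrgE.
Qed.

Lemma Dl_I V p : Dl V ∘ I V p
  = I (V ⊗ U) p ∘ I V p · L' p · L p ∘ cre (n p) (V ⊗ L' p) · L p.
Proof.
apply: (injl (alK _ _ _)).
rewrite /Dl /I splE !compA (r20 _ (alVK _ _ _)) {1}mrgE.
rewrite -[V ∙ D ∘ _]compA -wlM D_i !wlM !compA.
have creW : al V (L' p ⊗ L p) (L' p) ∘ al V (L' p) (L p) · L' p
    ∘ cre (n p) (V ⊗ L' p) = V ∙ cre (n p) (L' p).
  rewrite !creE !splE !wlM !compA (r23 _ (pentagonV2 _ _ _ _)).
  by rewrite (r20 _ (alVK _ _ _)) (r22 _ (al_natr _ _ _)) al_ruV.
rewrite -(al_natm _ _ (cre (n p) (L' p))) -creW !whM.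
rewrite -(r23 _ (pentagon _ _ _ _)).
rewrite !mrgE !whM !compA (r22 _ (al_natr _ _ _)).
have -> : tenm (i p) (i p) = U ∙ i p ∘ i p · (L' p ⊗ L p).
  by rewrite -tenmM comp1m compm1.
by rewrite wlM !compA -(r22 _ (al_natm _ _ _)) -(r22 _ (al_natl _ _ _)).
Qed.

(** The universal coaction is coassociative: both sides evaluated against the
    dual are the comultiplication on a generator. *)
Lemma Dl_d V p : Dl (V ⊗ L p) ∘ d V (L p) = d V (L p) · U ∘ d V (L p).
Proof.
move: V; apply: (@strip1 p (fun X => X ⊗ U ⊗ U) (fun V W f => f · U · U)
  (fun V => Dl (V ⊗ L p) ∘ d V (L p)) (fun V => d V (L p) · U ∘ d V (L p))).
- by move=> V f ->; rewrite !tenm1.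
- by move=> V W T f k; rewrite !whM.
- by move=> V W f; rewrite !compA d_nat -!compA Dl_nat.
- by move=> V W f; rewrite !compA d_nat -!compA (w22 U (d_nat _ _)).
move=> V; rewrite -compA -Dl_nat compA -mrg_iE Dl_I /I !mrg_iE !whM !compA.
rewrite (r22 _ (d_nat _ _)) (r22 _ (w22 U (kil_nat _ _))).
rewrite (r22 _ (d_nat _ _)) (r22 _ (w22 U (kil_nat _ _))) d_nat.
by rewrite (r20 _ (w20 U (zigzagl (zigl p) _))).
Qed.

(** Act on [Y], then on [X], and multiply the two copies of [U]. *)
Definition delta2 V Y X : hom (V ⊗ Y ⊗ X) (V ⊗ Y ⊗ X ⊗ U) :=
  locked (mu (V ⊗ Y ⊗ X) ∘ d (V ⊗ Y) X · U ∘ s (V ⊗ Y) X ∘ d V Y · X).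
Lemma delta2E V Y X :
  delta2 V Y X = mu (V ⊗ Y ⊗ X) ∘ d (V ⊗ Y) X · U ∘ s (V ⊗ Y) X ∘ d V Y · X.
Proof. by rewrite /delta2 -lock. Qed.

Variables (pr : P -> P -> P).
Variable psi : forall q p, hom (L q ⊗ L p) (L (pr q p)).
Variable psiV : forall q p, hom (L (pr q p)) (L q ⊗ L p).
Hypothesis psiK : forall q p, psiV q p ∘ psi q p = idm.
Variable th : forall p q, hom (L' p ⊗ L' q) (L' (pr q p)).
Hypothesis e_pr : forall q p, e (pr q p) ∘ tenm (th p q) (psi q p)
  = e p ∘ (ru (L' p) ∘ L' p ∙ e q ∘ al (L' p) (L' q) (L q)) · L p
    ∘ alV (L' p ⊗ L' q) (L q) (L p).
Hypothesis m_i : forall p q, m ∘ tenm (i p) (i q)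
  = i (pr q p) ∘ tenm (th p q) (psi q p ∘ br c (L p) (L q))
    ∘ alV (L' p) (L' q) (L p ⊗ L q)
    ∘ L' p ∙ (al (L' q) (L p) (L q) ∘ br c (L p) (L' q) · L q
              ∘ alV (L p) (L' q) (L q))
    ∘ al (L' p) (L p) (L' q ⊗ L q).

Lemma tenm_swap (X X' Y Y' : C) (f : hom X X') (g : hom Y Y') :
  tenm f g = f · Y' ∘ X ∙ g.
Proof. by rewrite -tenmM comp1m compm1. Qed.
Lemma tenm_swap' (X X' Y Y' : C) (f : hom X X') (g : hom Y Y') :
  tenm f g = X' ∙ g ∘ f · Y.
Proof. by rewrite -tenmM comp1m compm1. Qed.

Lemma kil_pr V q p :
  kil (e (pr q p)) V ∘ V ∙ th p q · L (pr q p) ∘ (V ⊗ (L' p ⊗ L' q)) ∙ psi q p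
   ∘ al V (L' p) (L' q) · (L q ⊗ L p) ∘ al (V ⊗ L' p ⊗ L' q) (L q) (L p)
  = kil (e p) V ∘ kil (e q) (V ⊗ L' p) · L p.
Proof.
rewrite kilE mrgE !compA.
rewrite (r22 _ (al_natm _ _ _)) (r22 _ (al_natr _ _ _)) .
rewrite -[V ∙ (_ · _) ∘ _]compA -wlM -tenm_swap.
rewrite -[V ∙ e _ ∘ _]compA -wlM e_pr.
set A := ru (L' p) ∘ _.
have -> : kil (e q) (V ⊗ L' p) = V ∙ A ∘ al _ _ _ ∘ al _ _ _ · L q.
  rewrite kilE mrgE /A !wlM !compA -pentagon.
  by rewrite -(r22 _ (al_natr _ _ _)) (r21 _ (ru_al _ _)).
clearbody A; rewrite !wlM !compA -al_natl (r23 _ (pentagon _ _ _ _)).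
rewrite -[V ∙ alV _ _ _ ∘ _]compA -wlM alK tenm1 comp1m.
by rewrite -(r22 _ (al_natm _ _ _)) -!whM kilE mrgE !compA.
Qed.

(** The generator of [L q ⊗ L p], starting from the word X' Y' Y X. *)
Definition J V q p : hom (V ⊗ L' p ⊗ L' q ⊗ L q ⊗ L p) (V ⊗ U) :=
  locked (V ∙ (i (pr q p) ∘ tenm (th p q) (psi q p))
    ∘ al V (L' p ⊗ L' q) (L q ⊗ L p)
    ∘ al V (L' p) (L' q) · (L q ⊗ L p) ∘ al (V ⊗ L' p ⊗ L' q) (L q) (L p)).
Lemma J_def V q p : J V q p = V ∙ (i (pr q p) ∘ tenm (th p q) (psi q p))
    ∘ al V (L' p ⊗ L' q) (L q ⊗ L p)
    ∘ al V (L' p) (L' q) · (L q ⊗ L p) ∘ al (V ⊗ L' p ⊗ L' q) (L q) (L p).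
Proof. by rewrite /J -lock. Qed.

Lemma J_E V q p : J V q p
  = (kil (e p) V ∘ kil (e q) (V ⊗ L' p) · L p) · U
    ∘ alV _ _ _ · U ∘ d (V ⊗ L' p ⊗ L' q) (L q ⊗ L p)
    ∘ al (V ⊗ L' p ⊗ L' q) (L q) (L p).
Proof.
rewrite -kil_pr !whM !compA (r20 _ (w20 _ (alVK _ _ _))).
rewrite -(r22 _ (d_nat _ _)) -(r22 _ (d_natr _ _)) -(r22 _ (d_nat _ _)).
rewrite -[kil _ _ · U ∘ _]compA -mrg_iE mrgE J_def (tenm_swap (th p q)) !wlM !compA.
by rewrite -(r22 _ (al_natr _ _ _)) -(r22 _ (al_natm _ _ _)).
Qed.

(** The product of two generators is the generator of the tensor product, after
    both strands of the second have been braided past the inner strand of the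
    first. *)
Lemma mu_I V q p : mu V ∘ I (V ⊗ U) q ∘ I V p · L' q · L q
  = J V q p ∘ b c (V ⊗ L' p ⊗ L' q) (L p) (L q)
    ∘ b c (V ⊗ L' p) (L p) (L' q) · L q.
Proof.
rewrite /mu /I 3!mrgE !whM !compA.
rewrite (r22 _ (al_natr _ _ _)) (r22 _ (al_natl _ _ _)) (r22 _ (al_natm _ _ _)).
have -> : forall W (x : hom W _), V ∙ m ∘ V ∙ (U ∙ i q) ∘ V ∙ (i p · (L' q ⊗ L q)) ∘ x
  = V ∙ (m ∘ tenm (i p) (i q)) ∘ x.
  by move=> W x; rewrite (tenm_swap' (i p) (i q)) !wlM !compA.
rewrite m_i !wlM !compA al_natl -(r23 _ (pentagon _ _ _ _)) pentagon.
rewrite (r22 _ (al_natr _ _ _)) (r20 (_ ∘ _) (_ : V ∙ (L' p ∙ alV _ _ _) ∘ V ∙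
  (L' p ∙ al _ _ _) = idm)); last first.
  by rewrite -!wlM alK !tenm1.
rewrite -(r22 _ (al_natr _ _ _)) -(r22 _ (al_natm _ _ _)) -(w22 _ (al_b c _ _ _)).
rewrite -(r22 _ (al_natr _ _ _)) -(r23 _ (pentagon _ _ _ _)) (r23 _ (pentagon _ _ _ _)).
rewrite (r20 _ (_ : V ∙ alV _ _ _ ∘ V ∙ al _ _ _ = idm)); last first.
  by rewrite -wlM alK tenm1.
rewrite J_def wlM !compA (r22 _ (al_b _ _ _ _)) (r22 _ (swap _ _))
  (r22 _ (al_natr _ _ _)).
by rewrite -[V ∙ tenm _ _ ∘ _ in RHS]compA -wlM -tenmM compm1.
Qed.

Lemma kil_delta2 V q p :
  kil (e p) V · U ∘ kil (e q) (V ⊗ L' p) · L p · U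
    ∘ delta2 (V ⊗ L' p ⊗ L' q) (L q) (L p) = J V q p.
Proof.
have -> : J V q p = mu V ∘ I (V ⊗ U) q ∘ I V p · L' q · L q
   ∘ bV cV (V ⊗ L' p) (L p) (L' q) · L q ∘ bV cV (V ⊗ L' p ⊗ L' q) (L p) (L q).
  rewrite (r33 _ (mu_I _ _ _)) (r20 _ (w20 _ (bVK cVK _ _ _))).
  by rewrite (bVK cVK) compm1.
rewrite (r22 _ (I_nat _ _)) (bV_mrgr cK cVK) -/(s _ _) /I.
rewrite delta2E -(r22 _ (mu_nat _)) -(r22 _ (w22 _ (d_nat _ _))) -(r22 _ (s_nat _ _)).
rewrite -whM -mrg_iE -(r22 _ (mu_nat _)).
by rewrite -[_ · U · U ∘ _]compA -whM -mrg_iE.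
Qed.

(** The universal coaction is multiplicative. Evaluating both letters against
    their duals loses nothing, and turns the left side into a product of two
    generators, the right side into the generator of the tensor product
    ([kil_delta2], [J_E]). *)
Lemma delta2_pr V q p :
  al V (L q) (L p) · U ∘ delta2 V (L q) (L p)
  = d V (L q ⊗ L p) ∘ al V (L q) (L p).
Proof.
apply: (injl (w20 U (alVK _ _ _))); rewrite (r20 _ (w20 _ (alK _ _ _))).
(* Both sides are composed with two snakes: create the duals of both letters
   with [N], and evaluate them after the family [k]. *)
pose N V := cre (n p) (V ⊗ L q) · L' q ∘ cre (n q) V.
have zz (k : forall V, hom (V ⊗ L q ⊗ L p) (V ⊗ L q ⊗ L p ⊗ U)) :
  (forall V W (f : hom V W), f · L q · L p · U ∘ k V = k W ∘ f · L q · L p) ->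
  k V = kil (e p) (V ⊗ L q ⊗ L p) · U
    ∘ kil (e q) (V ⊗ L q ⊗ L p ⊗ L' p) · L p · U
    ∘ k (V ⊗ L q ⊗ L p ⊗ L' p ⊗ L' q) ∘ N V · L q · L p.
  have Z : kil (e p) (V ⊗ L q ⊗ L p) ∘ kil (e q) (V ⊗ L q ⊗ L p ⊗ L' p) · L p
      ∘ N V · L q · L p = idm.
    rewrite /N !whM (r22 _ (w22 _ (kil_nat _ _))).
    by rewrite -[kil _ _ · L p ∘ _]whM (zigzagl (zigl q)) tenm1 compm1
      (zigzagl (zigl p)).
  by move=> kn; rewrite -kn -[LHS]comp1m -tenm1 -Z !whM !compA.
rewrite (zz (fun V => delta2 V (L q) (L p))); last first.
  move=> V' W f; rewrite !delta2E -(r22 _ (mu_nat _)) -(r22 _ (w22 _ (d_nat _ _))).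
  by rewrite -(r22 _ (s_nat _ _)) !compA -(w22 _ (d_nat _ _)).
rewrite (zz (fun V => alV V (L q) (L p) · U ∘ d V (L q ⊗ L p) ∘ al V (L q) (L p))).
  by rewrite -!compA; congr (_ ∘ _); rewrite !compA kil_delta2 J_E !whM !compA.
move=> V' W f; rewrite -(r22 _ (w22 _ (alV_natl _ _ _))) -(r22 _ (d_nat _ _)).
by rewrite !compA al_natl.
Qed.

(** By naturality the properties of the coaction pass from the objects [L p] to
    their retracts, among which are their tensor products and the unit. *)
Definition retract X := exists p (r : hom X (L p)) (r' : hom (L p) X), r' ∘ r = idm.

Lemma retract_obj p : retract (L p).
Proof. by exists p, idm, idm; rewrite comp1m. Qed.
Lemma retract_pr q p : retract (L q ⊗ L p).
Proof. by exists (pr q p), (psi q p), (psiV q p). Qed.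

Lemma eps_d_retract V X : retract X -> eps (V ⊗ X) ∘ d V X = idm.
Proof.
move=> [p [r [r' rr]]].
rewrite -[d V X]compm1 -tenm1 -rr wlM (r22 _ (d_natr _ _)) (r22 _ (eps_nat _)).
by rewrite (r20 _ (eps_d _ _)) -wlM rr tenm1.
Qed.
Lemma Dl_d_retract V X : retract X -> Dl (V ⊗ X) ∘ d V X = d V X · U ∘ d V X.
Proof.
move=> [p [r [r' rr]]].
rewrite -[LHS]compm1 -[RHS]compm1 -tenm1 -rr wlM !compA (r22 _ (d_natr _ _)).
rewrite (r22 _ (Dl_nat _)) (r22 _ (Dl_d _ _)).
by rewrite (r22 _ (w22 _ (d_natr _ _))).
Qed.

Lemma s_natr V X Y (f : hom X Y) : s V Y ∘ (V ⊗ U) ∙ f = V ∙ f · U ∘ s V X.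
Proof.
apply: (injl (bK cK V Y U)); rewrite (r20 _ (bVK cVK _ _ _)).
by rewrite (r22 _ (b_natl _ _ _ _)) (bVK cVK) compm1.
Qed.
Lemma delta2_natl V Y Y' X (f : hom Y Y') :
  delta2 V Y' X ∘ V ∙ f · X = V ∙ f · X · U ∘ delta2 V Y X.
Proof.
rewrite !delta2E !compA (w22 _ (d_natr _ _)) (r22 _ (s_nat _ _)).
by rewrite (r22 _ (w22 _ (d_nat _ _))) (r22 _ (mu_nat _)).
Qed.
Lemma delta2_natr V Y X X' (f : hom X X') :
  delta2 V Y X' ∘ (V ⊗ Y) ∙ f = (V ⊗ Y) ∙ f · U ∘ delta2 V Y X.
Proof.
rewrite !delta2E !compA swap (r22 _ (s_natr _ _)).
by rewrite (r22 _ (w22 _ (d_natr _ _))) (r22 _ (mu_nat _)).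
Qed.
Lemma delta2_retract V Y X : retract Y -> retract X ->
  al V Y X · U ∘ delta2 V Y X = d V (Y ⊗ X) ∘ al V Y X.
Proof.
move=> [q [r [r' rr]]] [p [t [t' tt]]].
have E : V ∙ r' · X ∘ (V ⊗ L q) ∙ t' ∘ (V ⊗ L q) ∙ t ∘ V ∙ r · X = idm.
  by rewrite -[_ ∙ t' ∘ _]compA -wlM tt tenm1 comp1m -whM -wlM rr !tenm1.
move: (_ ∙ t ∘ _) E => w E; rewrite -[delta2 V Y X]compm1 -[al V Y X in RHS]compm1 -E.
rewrite (r22 _ (delta2_natl _ _ _)) (r22 _ (delta2_natr _ _ _)).
rewrite (r22 _ (w22 _ (al_natm _ _ _))) (r22 _ (w22 _ (al_natr _ _ _))).
rewrite (r22 _ (delta2_pr _ _ _)) (r22 _ (al_natm _ _ _)) (r22 _ (al_natr _ _ _)).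
by rewrite (r22 _ (d_natr _ _)) (r22 _ (d_natr _ _)).
Qed.

(** Both sides compute the universal coaction on a threefold tensor product. *)
Lemma mu_assoc V : mu V ∘ mu V · U = mu V ∘ mu (V ⊗ U).
Proof.
move: V; apply: (uniq3 (F := fun V => V ⊗ U) (Fm := fun V W f => f · U)).
- by move=> V W f; rewrite !compA (w22 _ (mu_nat _)) (r22 _ (mu_nat _)).
- by move=> V W f; rewrite !compA mu_nat (r22 _ (mu_nat _)).
move=> V r q p T; rewrite {}/T !whM !compA.
rewrite [in LHS](r22 _ (s_nat _ _)).
have -> : forall W (x : hom W _),
   mu (V ⊗ L r ⊗ L q ⊗ L p) · U ∘ d (V ⊗ L r ⊗ L q) (L p) · U · U
   ∘ s (V ⊗ L r ⊗ L q) (L p) · U ∘ d (V ⊗ L r) (L q) · L p · U ∘ x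
   = delta2 (V ⊗ L r) (L q) (L p) · U ∘ x.
  by move=> W x; rewrite delta2E !whM !compA.
apply: (injl (w20 U (alK _ _ _))); apply: (injl (w20 U (alK _ _ _))).
rewrite -(r22 _ (mu_nat _)) (r22 _ (w22 _ (delta2_retract _ (retract_obj q)
  (retract_obj p)))).
rewrite -(r23 _ (bV_hexr cK cVK _ _ _ _)) -/(s _ _) al_natl.
have -> : forall W (x : hom W _), mu (V ⊗ L r ⊗ (L q ⊗ L p))
    ∘ d (V ⊗ L r) (L q ⊗ L p) · U ∘ s (V ⊗ L r) (L q ⊗ L p)
    ∘ d V (L r) · (L q ⊗ L p) ∘ x = delta2 V (L r) (L q ⊗ L p) ∘ x.
  by move=> W x; rewrite delta2E !compA.
rewrite (r22 _ (delta2_retract _ (retract_obj r) (retract_pr q p))) pentagon.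
rewrite [in RHS](r22 _ (mu_nat _)) (r32 _ (bV_mrgr cK cVK _ _ _)) -/(s _ _).
have -> : mrg m (V ⊗ L r ⊗ L q) · L p ∘ d (V ⊗ L r) (L q) · U · L p
    ∘ s (V ⊗ L r) (L q) · L p ∘ d V (L r) · L q · L p
  = delta2 V (L r) (L q) · L p by rewrite delta2E !whM.
have := pentagon V (L r) (L q) (L p).
move/(congr1 (fun z => z · U)); rewrite !whM => E; rewrite (r23 _ E) {E}.
rewrite -(r22 _ (mu_nat _)) -(r22 _ (w22 _ (d_nat _ _))) -(r22 _ (s_nat _ _)).
rewrite (w22 _ (delta2_retract _ (retract_obj r) (retract_obj q))).
have -> : forall W (x : hom W _), mu (V ⊗ (L r ⊗ L q) ⊗ L p)
    ∘ d (V ⊗ (L r ⊗ L q)) (L p) · U ∘ s (V ⊗ (L r ⊗ L q)) (L p)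
    ∘ d V (L r ⊗ L q) · L p ∘ x = delta2 V (L r ⊗ L q) (L p) ∘ x.
  by move=> W x; rewrite delta2E !compA.
rewrite (r22 _ (delta2_retract _ (retract_pr r q) (retract_obj p))).
by rewrite -(r22 _ (d_natr _ _)).
Qed.

(** Composed with the coactions on two letters, both sides become the universal
    coaction of their tensor product applied twice. *)
Lemma Dl_mu V : Dl V ∘ mu V
  = mu (V ⊗ U) ∘ mu V · U · U ∘ b c (V ⊗ U) U U · U ∘ Dl (V ⊗ U ⊗ U) ∘ Dl V · U.
Proof.
move: V; apply: (uniq2 (F := fun V => V ⊗ U ⊗ U) (Fm := fun V W f => f · U · U)).
- by move=> V W f; rewrite !compA mu_nat (r22 _ (Dl_nat _)).
- move=> V W f; rewrite !compA (w22 _ (Dl_nat _)) (r22 _ (Dl_nat _)).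
  rewrite (r22 _ (w22 _ (b_nat _ _ _ _))) (r22 _ (w22 _ (w22 _ (mu_nat _)))).
  by rewrite [in RHS](r22 _ (mu_nat _)).
move=> V q p T; rewrite {}/T !compA -delta2E.
have DT : Dl (V ⊗ L q ⊗ L p) ∘ delta2 V (L q) (L p)
    = delta2 V (L q) (L p) · U ∘ delta2 V (L q) (L p).
  apply: (injl (w20 U (w20 U (alK _ _ _)))).
  rewrite -(r22 _ (Dl_nat _)) (delta2_retract _ (retract_obj q) (retract_obj p)).
  rewrite (r22 _ (Dl_d_retract _ (retract_pr q p))).
  rewrite (r22 _ (w22 _ (delta2_retract _ (retract_obj q) (retract_obj p)))).
  by rewrite (delta2_retract _ (retract_obj q) (retract_obj p)).
rewrite {}DT (r22 _ (w22 _ (Dl_d _ _))) (r22 _ (Dl_nat _)) (r22 _ (Dl_nat _)).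
rewrite (r23 _ (bV_splr cK cVK _ _ _)) -/(s _ _) -[spl D _]/(Dl _).
rewrite (w22 _ (Dl_d _ _)) (r22 _ (w22 _ (b_nat _ _ _ _))).
have := bV_spll cK cVK (V ⊗ L q) U (delta (L p)).
move/(congr1 (fun z => z · U)); rewrite !whM -/(s _ _) => E.
rewrite -(r23 _ E) {E} (r22 _ (s_nat _ _)) (r22 _ (w22 _ (d_nat _ _))).
have -> : forall W (x : hom W _), mu (V ⊗ L q ⊗ L p) · U · U
    ∘ d (V ⊗ L q) (L p) · U · U · U ∘ s (V ⊗ L q) (L p) · U · U
    ∘ d V (L q) · L p · U · U ∘ x = delta2 V (L q) (L p) · U · U ∘ x.
  by move=> W x; rewrite delta2E !whM !compA.
by rewrite (r22 _ (mu_nat _)) -delta2E.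
Qed.

Lemma Dl_coassoc V : Dl (V ⊗ U) ∘ Dl V = Dl V · U ∘ Dl V.
Proof.
move: V; apply: (uniq1 (F := fun V => V ⊗ U ⊗ U ⊗ U)
  (Fm := fun V W f => f · U · U · U)).
- by move=> V W f; rewrite !compA Dl_nat (r22 _ (Dl_nat _)).
- by move=> V W f; rewrite !compA Dl_nat (r22 _ (w22 _ (Dl_nat _))).
move=> V p; rewrite !compA Dl_d (r22 _ (Dl_nat _)) Dl_d.
by rewrite (r22 _ (w22 _ (Dl_d _ _))).
Qed.
Lemma Dl_counitl V : eps V · U ∘ Dl V = idm.
Proof.
move: V; apply: (uniq1 (F := fun V => V ⊗ U) (Fm := fun V W f => f · U)).
- by move=> V W f; rewrite !compA Dl_nat (r22 _ (w22 _ (eps_nat _))).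
- by move=> V W f; rewrite comp1m compm1.
by move=> V p; rewrite !compA Dl_d (r20 _ (w20 _ (eps_d _ _))) comp1m.
Qed.
Lemma Dl_counitr V : eps (V ⊗ U) ∘ Dl V = idm.
Proof.
move: V; apply: (uniq1 (F := fun V => V ⊗ U) (Fm := fun V W f => f · U)).
- by move=> V W f; rewrite !compA Dl_nat (r22 _ (eps_nat _)).
- by move=> V W f; rewrite comp1m compm1.
by move=> V p; rewrite !compA Dl_d (r22 _ (eps_nat _)) eps_d compm1 comp1m.
Qed.

Lemma eps_delta2 V Y X : retract Y -> retract X -> retract (Y ⊗ X) ->
  eps (V ⊗ Y ⊗ X) ∘ delta2 V Y X = idm.
Proof.
move=> gY gX gYX; apply: (injl (alK _ _ _)).
by rewrite -(r22 _ (eps_nat _)) delta2_retract // (r20 _ (eps_d_retract _ gYX)) compm1.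
Qed.
Lemma eps_mu V : eps V ∘ mu V = eps V ∘ eps (V ⊗ U).
Proof.
move: V; apply: (uniq2 (F := fun V => V) (Fm := fun V W f => f)).
- by move=> V W f; rewrite !compA mu_nat (r22 _ (eps_nat _)).
- by move=> V W f; rewrite !compA eps_nat (r22 _ (eps_nat _)).
move=> V q p T; rewrite {}/T !compA -delta2E eps_delta2 //; try exact: retract_obj.
  rewrite (r22 _ (eps_nat _)) (r20 _ (eps_d _ _)) (r21 _ (bV_kil1r cVK _ _ _)).
  by rewrite -whM eps_d tenm1.
exact: retract_pr.
Qed.

Hypothesis retract_one : retract one.
Hypothesis delta_one : delta one = one ∙ et ∘ ruV one.

Lemma d_one V : d V one = eta (V ⊗ one).
Proof.
by rewrite /d splE /eta cre1E delta_one wlM (r22 _ (alV_natr _ _ _)) ruV_al.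
Qed.

(** Compare the universal coactions on [one ⊗ X] and on [X]. *)
Lemma mu_unitr V : mu V ∘ eta (V ⊗ U) = idm.
Proof.
move: V; apply: (uniq1 (F := fun V => V ⊗ U) (Fm := fun V W f => f · U)).
- by move=> V W f; rewrite !compA (eta_nat (f · U)) (r22 _ (mu_nat _)).
- by move=> V W f; rewrite comp1m compm1.
move=> V p; rewrite !compA eta_nat comp1m.
have E : ru V · L p · U ∘ delta2 V one (L p) = d V (L p) ∘ ru V · L p.
  rewrite -[ru V · L p]triangle !whM !compA (delta2_retract _ retract_one
    (retract_obj p)).
  by rewrite -(r22 _ (d_natr _ _)).
move: E; rewrite delta2E d_one (bV_cre1r cK) => E.
apply: (injr (w20 (L p) (ruVK V))); rewrite -E -/(eta _) -(r22 _ (mu_nat _)).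
by rewrite -(r22 _ (w22 _ (d_nat _ _))) -[in RHS]eta_nat !compA.
Qed.
(** Compare the universal coactions on [X ⊗ one] and on [X]. *)
Lemma mu_unitl V : mu V ∘ eta V · U = idm.
Proof.
move: V; apply: (uniq1 (F := fun V => V ⊗ U) (Fm := fun V W f => f · U)).
- by move=> V W f; rewrite !compA (w22 _ (eta_nat f)) (r22 _ (mu_nat _)).
- by move=> V W f; rewrite comp1m compm1.
move=> V p; rewrite !compA comp1m.
have E : ru (V ⊗ L p) · U ∘ delta2 V (L p) one = d V (L p) ∘ ru (V ⊗ L p).
  rewrite -[ru (V ⊗ L p)]ru_al !whM !compA (delta2_retract _ (retract_obj p)
    retract_one).
  by rewrite -(r22 _ (d_natr _ _)).
move: E; rewrite delta2E d_one => E.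
apply: (injr (ruVK _)); rewrite -E -(r22 _ (mu_nat _)).
rewrite (r22 _ (w22 _ (esym (eta_nat _)))).
have -> : ru (V ⊗ L p) · U ∘ s (V ⊗ L p) one ∘ d V (L p) · one
    = d V (L p) ∘ ru (V ⊗ L p).
  have rs : ru (V ⊗ L p) · U ∘ s (V ⊗ L p) one = ru (V ⊗ L p ⊗ U).
    by rewrite -(ru_bl c) compA (bVK cVK) compm1.
  by rewrite (r21 _ rs) ru_nat.
by rewrite !compA.
Qed.

Hypothesis S_i : forall p, S ∘ i p = ru U ∘ U ∙ e p ∘ al U (L' p) (L p)
  ∘ cV U (L' p) · L p ∘ delta (L' p) · L p.

(** Takes a copy of [U] back across the preceding letter. *)
Definition rr V X : hom (V ⊗ X ⊗ U) (V ⊗ U ⊗ X) := bV cV V U X.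

Lemma sn_I V p : sn V ∘ I V p
  = kil (e p) (V ⊗ U) ∘ rr V (L' p) · L p ∘ d V (L' p) · L p.
Proof.
rewrite /sn /I mrgE -[V ∙ S ∘ _]compA -wlM S_i !wlM !compA.
rewrite /rr bVE /d splE mrgE kilE mrgE !whM !compA.
rewrite (r20 _ (w20 _ (alVK _ _ _))) -(al_natm _ _ (delta _)).
rewrite -(r22 _ (al_natm _ _ _)) -ru_al !compA (r22 _ (al_natr _ _ _)).
by rewrite (r32 _ (pentagonV _ _ _ _)).
Qed.

(** The pairing of X with its dual in the opposite order. *)
Definition lam p : hom (L p ⊗ L' p) one := e p ∘ cV (L' p) (L p).

Lemma lam_b V p : kil (lam p) V ∘ b c V (L' p) (L p) = kil (e p) V.
Proof.
rewrite !kilE !mrgE bE mrgE !compA (r20 _ (alVK _ _ _)).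
by rewrite -[V ∙ lam p ∘ _]compA -wlM /lam compA cK compm1.
Qed.

(** Naturality of the coaction with respect to [g]; on the unit object the
    coaction is the unit of [U]. *)
Lemma kil_delta2_one V Y X (g : hom (Y ⊗ X) one) : retract Y -> retract X ->
  kil g V · U ∘ delta2 V Y X = eta V ∘ kil g V.
Proof.
move=> gY gX.
rewrite kilE mrgE !whM !compA delta2_retract // -(r22 _ (d_natr _ _)) d_one.
by rewrite -(r22 _ (eta_nat _)).
Qed.

Lemma b_dr V W X : d V X · W ∘ b c V W X
  = b c (V ⊗ X) W U ∘ b c V W X · U ∘ d (V ⊗ W) X.
Proof. exact: b_splr. Qed.
Lemma b_dl V W X : d (V ⊗ W) X ∘ b c V X W
  = b c V X W · U ∘ b c (V ⊗ X) U W ∘ d V X · W.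
Proof. exact: b_spll. Qed.

(** Naturality of the coaction with respect to the pairing [lam]. *)
Lemma antipodel_core V p :
  mu V ∘ I (V ⊗ U) p ∘ rr V (L' p) · L p ∘ d V (L' p) · L p = eta V ∘ kil (e p) V.
Proof.
rewrite -lam_b -(r22 _ (kil_delta2_one _ _ (retract_obj _) (retract_obj _))).
rewrite delta2E !compA b_dr (r20 _ (bK cK _ _ _)) (r22 _ (w22 _ (b_dl _ _ _))).
rewrite -(r22 _ (mu_nat _)) (r21 _ (w21 U (w21 U (lam_b V p)))).
rewrite whM !compA -(r22 _ (w22 _ (bV_kilr cVK _ _ _))) -/(rr _ _).
rewrite /I mrg_iE !compA; congr (_ ∘ _ ∘ _).
by rewrite !(r22 _ (d_nat _ _)) d_nat.
Qed.

Lemma eps_I V p : eps V ∘ I V p = kil (e p) V.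
Proof.
by rewrite /eps /I kil1E kilE !mrgE !compA -[V ∙ ep ∘ _]compA -wlM ep_i.
Qed.

(** On a generator the middle coevaluation of the comultiplication and the
    evaluation of the antipode cancel, leaving [antipodel_core]. *)
Lemma antipodel V : mu V ∘ sn V · U ∘ Dl V = eta V ∘ eps V.
Proof.
apply: cover0 => p; rewrite -/(I V p) !compA Dl_I -(r22 _ (I_nat _ _)) eps_I.
move: (congr1 (fun z => z · L' p · L p) (sn_I V p)); rewrite !whM => E.
rewrite (r23 _ E) {E} -(w22 _ (cre_nat _ _)) -(r22 _ (w22 _ (cre_nat _ _))).
by rewrite (r20 _ (w20 _ (zigzagr (zigr p) _))) antipodel_core.
Qed.

(** Naturality of the coaction with respect to [g]. *)
Lemma delta2_cre_one V Y X (g : hom one (Y ⊗ X)) : retract Y -> retract X ->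
  delta2 V Y X ∘ cre g V = cre g V · U ∘ eta V.
Proof.
move=> gY gX; apply: (injl (w20 U (alK _ _ _))).
rewrite (r22 _ (delta2_retract _ gY gX)) creE splE !whM !compA (r20 _ (alVK _ _ _)).
rewrite (r20 _ (w20 _ (alVK _ _ _))) (r22 _ (d_natr _ _)) d_one.
by rewrite (eta_nat (ruV V)).
Qed.

(** The mirror image of [antipodel_core], with naturality with respect to the
    coevaluation braided once, [nu]. *)
Lemma antipoder_core W p :
  mu (W ⊗ L p) · L' p ∘ rr (W ⊗ L p ⊗ U) (L' p) ∘ d (W ⊗ L p ⊗ U) (L' p)
    ∘ d W (L p) · L' p ∘ cre (n p) W
  = eta (W ⊗ L p) · L' p ∘ cre (n p) W.
Proof.
pose nu := br c (L p) (L' p) ∘ n p.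
have nuE : cre (n p) W = bV cV W (L p) (L' p) ∘ cre nu W.
  have En : W ∙ n p = W ∙ cV _ _ ∘ W ∙ nu by rewrite -wlM /nu -compA cK comp1m.
  by rewrite !creE !splE bVE mrgE !compA (r20 _ (alVK _ _ _)) En !compA.
(* The produced copy of [U] follows its letter through an inverse braiding. *)
have bVd V X Y : d V X · Y ∘ bV cV V X Y
    = bV cV (V ⊗ X) U Y ∘ bV cV V X Y · U ∘ d (V ⊗ Y) X.
  apply: (injl (bK cK _ _ _)); apply: (injl (w20 U (bK cK _ _ _))).
  rewrite (r20 _ (bVK cVK _ _ _)) (r20 _ (w20 _ (bVK cVK _ _ _))).
  by rewrite -(r23 _ (b_dl _ _ _)) (bVK cVK) compm1.
have bVd2 V X Y : d (V ⊗ Y) X ∘ bV cV V Y X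
    = bV cV V Y X · U ∘ bV cV (V ⊗ X) Y U ∘ d V X · Y.
  exact: (bV_splr cK cVK).
rewrite {1}nuE (r23 _ (bVd _ _ _)) (r23 _ (bVd2 _ _ _)).
move: (congr1 (fun z => z · U) (bVd2 W (L' p) (L p))); rewrite !whM => E.
rewrite (r23 _ E) {E} (r22 _ (bV_nat cK cVK _ _ _)) -(r22 _ (d_nat _ _)).
rewrite (r23 _ (bV_spll cK cVK _ _ _)) (r20 _ (bK cK _ _ _)) -/(s _ _).
rewrite (r32 _ (bV_mrgl cK cVK _ _ m)) -/(mu _) -/(d _ _) (r22 _ (mu_nat _)).
have -> : forall T (x : hom T _), mu (W ⊗ L' p ⊗ L p)
    ∘ d (W ⊗ L' p) (L p) · U ∘ s (W ⊗ L' p) (L p) ∘ d W (L' p) · L p ∘ x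
    = delta2 W (L' p) (L p) ∘ x by move=> T x; rewrite delta2E !compA.
rewrite (delta2_cre_one _ _ (retract_obj _) (retract_obj _)).
rewrite -[bV cV W _ _ · U ∘ _]compA -whM -nuE -eta_nat.
by rewrite -(r21 _ (bV_cre1l cK _ _ et)).
Qed.

Lemma antipoder V : mu V ∘ sn (V ⊗ U) ∘ Dl V = eta V ∘ eps V.
Proof.
apply: cover0 => p; rewrite -/(I V p) !compA Dl_I eps_I (r23 _ (sn_I _ _)).
rewrite /I mrg_iE !whM !compA (r22 _ (w22 _ (d_nat _ _))).
rewrite (r22 _ (w22 _ (bV_nat cK cVK _ _ _))) (r22 _ (kil_nat _ _)).
rewrite (r22 _ (mu_nat _)) -(r22 _ (kil_nat _ _)).
move: (congr1 (fun z => z · L p) (antipoder_core (V ⊗ L' p) p)).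
rewrite !whM => ->; rewrite (r22 _ (kil_nat _ _)).
by rewrite (zigzagl (zigl p)) compm1 -eta_nat.
Qed.

(** The identities on words yield those of the category on putting the unit
    object for the initial letter; [mu1] to [eps1] remove it. *)
Lemma mu1 : lu U ∘ mu one = m ∘ lu U · U.
Proof. by rewrite /mu mrgE (r22 _ (lu_nat _)) lu_al. Qed.
Lemma Dl1 : lu U · U ∘ Dl one = D ∘ lu U.
Proof. by rewrite /Dl splE -lu_al compA (r20 _ (alVK _ _ _)) lu_nat. Qed.
Lemma eta1 : lu U ∘ eta one = et.
Proof. by rewrite /eta cre1E (r22 _ (lu_nat _)) lu_one ruVK compm1. Qed.
Lemma eps1 : eps one = ep ∘ lu U.
Proof. by rewrite /eps kil1E -lu_one lu_nat. Qed.
Lemma epi_lu (X Y Z : C) (f g : hom (X ⊗ Y) Z) :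
  f ∘ lu X · Y = g ∘ lu X · Y -> f = g.
Proof. exact: injr (w20 Y (luVK X)). Qed.
Lemma epi_luu (X Y Z T : C) (f g : hom (X ⊗ Y ⊗ T) Z) :
  f ∘ lu X · Y · T = g ∘ lu X · Y · T -> f = g.
Proof. exact: injr (w20 T (w20 Y (luVK X))). Qed.
Lemma epi_lu0 (X Z : C) (f g : hom X Z) : f ∘ lu X = g ∘ lu X -> f = g.
Proof. exact: injr (luVK X). Qed.

Lemma mA : m ∘ m · U = m ∘ U ∙ m ∘ al U U U.
Proof.
apply: epi_luu; have := congr1 (comp (lu U)) (mu_assoc one).
rewrite (r22 _ mu1) (r22 _ mu1) -mu_nat -whM mu1 whM !compA => ->.
by rewrite /mu mrgE compA.
Qed.
Lemma m1l : m ∘ et · U = lu U.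
Proof.
have := congr1 (comp (lu U)) (mu_unitl one).
by rewrite (r22 _ mu1) -whM eta1 compm1.
Qed.
Lemma m1r : m ∘ U ∙ et = ru U.
Proof.
apply: (injr (ruK U)); apply: epi_lu0.
have := congr1 (comp (lu U)) (mu_unitr one).
by rewrite (r22 _ mu1) -eta_nat /eta cre1E compm1 ruVK comp1m !compA.
Qed.
Lemma Dassoc : al U U U ∘ D · U ∘ D = U ∙ D ∘ D.
Proof.
apply: epi_lu0; have := congr1 (comp (lu U · U · U)) (Dl_coassoc one).
rewrite -(r22 _ (Dl_nat _)) Dl1 (r22 _ (w22 _ Dl1)) Dl1 /Dl splE !compA => <-.
by rewrite (r20 _ (alVK _ _ _)).
Qed.
Lemma D1l : lu U ∘ ep · U ∘ D = idm.
Proof.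
apply: epi_lu0; have := congr1 (comp (lu U)) (Dl_counitl one).
by rewrite eps1 whM !compA Dl1 compm1 comp1m.
Qed.
Lemma D1r : ru U ∘ U ∙ ep ∘ D = idm.
Proof.
apply: epi_lu0; have := congr1 (comp (lu U)) (Dl_counitr one).
by rewrite -(r22 _ (eps_nat _)) Dl1 /eps kil1E !compA compm1 comp1m.
Qed.
Lemma epm : ep ∘ m = lu one ∘ tenm ep ep.
Proof.
apply: epi_lu; rewrite !compA -mu1 (r21 _ (esym eps1)) eps_mu eps1.
rewrite compA -eps_nat /eps kil1E (tenm_swap ep) lu_one.
by rewrite !compA -(r22 _ (ru_nat _)).
Qed.
Lemma mSD : m ∘ S · U ∘ D = et ∘ ep.
Proof.
apply: epi_lu0; have := congr1 (comp (lu U)) (antipodel one).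
rewrite (r22 _ mu1) (r21 _ eta1) eps1 /sn.
have /(w22 U) E : lu U ∘ one ∙ S = S ∘ lu U by rewrite lu_nat.
by rewrite (r22 _ E) Dl1 !compA.
Qed.
Lemma mDS : m ∘ U ∙ S ∘ D = et ∘ ep.
Proof.
apply: epi_lu0; have := congr1 (comp (lu U)) (antipoder one).
by rewrite (r22 _ mu1) (r21 _ eta1) eps1 /sn (r22 _ (swap _ _)) Dl1 !compA.
Qed.
Lemma Dm : D ∘ m = tenm m m ∘ alV U U (U ⊗ U) ∘ U ∙ al U U U
  ∘ U ∙ (br c U U · U) ∘ U ∙ alV U U U ∘ al U U (U ⊗ U) ∘ tenm D D.
Proof.
apply: epi_lu; have := congr1 (comp (lu U · U)) (Dl_mu one).
rewrite (r22 _ Dl1) mu1 -(r22 _ (mu_nat _)).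
rewrite (r22 _ (w22 U (w22 U mu1))) -(r22 _ (w22 _ (b_nat _ _ _ _))).
rewrite -(r22 _ (Dl_nat _)) (w22 U Dl1) !compA => ->.
rewrite /mu mrgE /Dl splE !compA (r22 _ (al_natl _ _ _)).
rewrite (r21 _ (esym (tenm_swap' m m))) (r21 _ (esym (tenm_swap' D D))).
congr (_ ∘ _); move: (tenm D D ∘ lu U · U) => x.
rewrite bE mrgE !whM !compA (r23 _ (pentagonV2 _ _ _ _)) -(r22 _ (alV_natm _ _ _)).
apply: (injl (alK _ _ _)); rewrite (r20 _ (alVK _ _ _)).
by rewrite (r32 _ (pentagonV _ _ _ _)) (r20 _ (alVK _ _ _)).
Qed.
End Coend.
Local Close Scope cat_scope.

(** * The transmuted Hopf algebra of comodules *)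

Section Transpose.
Local Open Scope cat_scope.
Variables (C : moncat) (X X' : C) (e : hom (X' ⊗ X) one) (n : hom one (X ⊗ X')).
Hypothesis zigl : ru X ∘ X ∙ e ∘ al X X' X ∘ n · X ∘ luV X = idm.
(** A pairing is recovered from its transpose by a snake identity. *)
Lemma transpose_ev (V : C) (g : hom (V ⊗ X) one) :
  e ∘ (lu X' ∘ g · X' ∘ alV V X X' ∘ V ∙ n ∘ ruV V) · X = g.
Proof.
have -> : lu X' ∘ g · X' ∘ alV V X X' ∘ V ∙ n ∘ ruV V = lu X' ∘ g · X' ∘ cre n V.
  by rewrite creE splE !compA.
rewrite !whM -lu_al !compA -(r22 _ (lu_nat _)) lu_one.
transitivity ((kil e one ∘ g · X' · X) ∘ cre n V · X).
  by rewrite kilE mrgE !compA.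
by rewrite kil_nat compA (zigzagl zigl) compm1.
Qed.
End Transpose.

Section Final.
Variables (k : fieldType) (A : dualQuasiHopf k).
Variables (sigma : {scalar (A \ox A)%type}) (hs : co_quasi_triangular sigma).
Local Notation PhiV a b c := (dqh_phiV A (a \ox b \ox c)).
Local Notation oA := (dqh_one A).
Local Notation S := (dqh_S A).
Local Notation alpha := (dqh_alpha A).
Local Notation beta := (dqh_beta A).
Let HH := dqh_axioms A.
Let HA := dqh_bialg (dqh_axioms A).
Local Notation C := (comcat A).
Local Notation c := (combr hs).
Local Notation X p := (fob p).
Local Notation X' p := (fob (fdual p)).
Local Notation U := (cund A : C).

(** The structure maps are linear maps on A given by formulas; their
    compatibility with the coactions is inherited from the composites of
    structural morphisms that they induce on coefficients. *)
Lemma und_mor (N : comod A) (f : A -> N) (g : forall p, chom (cten (X' p) (X p)) N) :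
  lin f -> (forall (p : fmat A) i j, f (p i j) = g p (dlt k i \ox dlt k j)) ->
  @is_comorphism k A (cund A) N f.
Proof.
move=> lf E; split=> //; apply: ext_A.
- by apply: lin_comp => //; exact: coact_lin.
- by apply: lin_comp; [exact: lin_tmap|exact: (coact_lin (M := cund A))].
move=> p i j; rewrite (mb_coact (cund_b p) (i, j)) E (cfP (g p)).2.
rewrite (mb_coact (mbasis_tens (fob_b (fdual p)) (fob_b p)) (i, j)).
have lg := cf_lin (g p).
rewrite (lin_bigsum _ _ _ (lin_tmap lg (@lin_id _ A)))
  (lin_bigsum _ _ _ (lin_tmap lf (@lin_id _ A))).
by apply: eq_sum => x; rewrite (tmapE _ _ lg (@lin_id _ A))
  (tmapE _ _ lf (@lin_id _ A)) E.
Qed.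
Lemma und2_mor (N : comod A) (f : A \ox A -> N)
  (g : forall p q, chom (cten (cten (X' p) (X p)) (cten (X' q) (X q))) N) :
  lin f -> (forall (p q : fmat A) i x j y, f (p i x \ox q j y) = g p q
    ((dlt k i \ox dlt k x) \ox (dlt k j \ox dlt k y))) ->
  @is_comorphism k A (cten (cund A) (cund A)) N f.
Proof.
move=> lf E; split=> //.
have l1 : lin (fun t => coact (f t)) by apply: lin_comp => //; exact: coact_lin.
have l2 : lin (fun t => tmap f id (@coact _ _ (cten (cund A) (cund A)) t)).
  by apply: lin_comp; [exact: lin_tmap|exact: (coact_lin
    (M := cten (cund A) (cund A)))].
apply: (extT l1 l2) => a b.
move: a; apply: (ext_A (linD_ext' b l1) (linD_ext' b l2)) => p i x.
move: b; apply: (ext_A (linD_ext _ l1) (linD_ext _ l2)) => q j y.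
rewrite (mb_coact (mbasis_tens (cund_b p) (cund_b q)) ((i, x), (j, y))) E
  (cfP (g p q)).2.
rewrite (mb_coact (mbasis_cten (mbasis_cten (fob_b (fdual p)) (fob_b p))
  (mbasis_cten (fob_b (fdual q)) (fob_b q))) ((i, x), (j, y))).
have lg := cf_lin (g p q).
rewrite (lin_bigsum _ _ _ (lin_tmap lg (@lin_id _ A)))
  (lin_bigsum _ _ _ (lin_tmap lf (@lin_id _ A))).
by apply: eq_sum => z; rewrite (tmapE _ _ lg (@lin_id _ A))
  (tmapE _ _ lf (@lin_id _ A)) E.
Qed.

Lemma mul_mor : @is_comorphism k A (cten (cund A) (cund A)) (cund A) (und_mul sigma).
Proof.
apply: (und2_mor (g := mcomp hs)); first exact: lin_mulU.
by move=> p q i x j y; rewrite mulUE (mulU_inc hs).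
Qed.
Definition mC : hom (U ⊗ U)%cat U := Chom mul_mor.

Definition comp_D (p : fmat A) : chom (cten (X' p) (X p)) (cten (cund A) (cund A)) :=
  ccomp (ctmap (inc p) (inc p)) (ccomp (cassoc (cten (X' p) (X p)) (X' p) (X p))
    (ccomp (ctmap (cassocV (X' p) (X p) (X' p)) (cid (X p)))
    (ccomp (ctmap (ctmap (cid (X' p)) (coev p)) (cid (X p)))
      (ctmap (cruV (X' p)) (cid (X p)))))).
Lemma comul_mor : @is_comorphism k A (cund A) (cten (cund A) (cund A)) (@und_comul k A).
Proof. exact: (@und_mor (cten (cund A) (cund A)) _ comp_D (@lin_comulU k A)
  (@comulU_inc k A)). Qed.
Definition DC : hom U (U ⊗ U)%cat := Chom comul_mor.

Lemma lin_counitU : @lin k A k^o (@und_counit k A).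
Proof. exact: lin_scalar. Qed.
Lemma counit_mor : @is_comorphism k A (cund A) (cone A) (@und_counit k A).
Proof.
apply: (@und_mor (cone A) (@und_counit k A) (@ev k A) lin_counitU) => p i j.
by rewrite [ev p _]evalfE.
Qed.
Definition epC : hom U (one : C) := Chom counit_mor.

Lemma S_one : S oA = oA.
Proof.
have := @alpha_mat k A (fone A) tt tt; rewrite !sum_unit /= /mone.
by rewrite (dqb_mul1r HA) (dqh_alpha1 HH) !scale1r.
Qed.
Lemma unit_mor : @is_comorphism k A (cone A) (cund A) (@und_unit k A).
Proof.
have l : lin (@und_unit k A) by apply: (@lin_scalel _ _ _ (fun x => x)); exact: lin_id.
split=> //; apply: ext_k.
- exact: (lin_comp (coact_lin (M := cund A)) l).
- exact: (lin_comp (lin_tmap l (@lin_id _ A)) (coact_lin (M := cone A))).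
rewrite (mb_coact (mbasis_cone A) tt) sum_unit (tmapE _ _ l (@lin_id _ A)) /und_unit
  scale1r.
have := mb_coact (cund_b (fone A)) (tt, tt); rewrite sum_pair !sum_unit /mprod /mdual
  /= /mone => ->.
by rewrite S_one (dqb_mul1l HA).
Qed.
Definition etC : hom (one : C) U := Chom unit_mor.

Section Antip.
Variables (SV : A -> A) (SK : cancel S SV) (SVK : cancel SV S).
Definition comp_S (p : fmat A) : chom (cten (X' p) (X p)) (cund A) :=
  ccomp (cru (cund A)) (ccomp (ctmap (cid (cund A)) (ev p))
    (ccomp (cassoc (cund A) (X' p) (X p))
   (ccomp (ctmap (cbrV hs (cund A) (X' p)) (cid (X p)))
     (ctmap (cdelta (X' p)) (cid (X p)))))).
Lemma antipode_mor : @is_comorphism k A (cund A) (cund A)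
  (und_antipode SV (sigmaV sigma)).
Proof. exact: (@und_mor (cund A) _ comp_S (lin_antipodeU sigma SK SVK)
  (antipodeU_inc hs SK SVK)). Qed.
Definition SC : hom U U := Chom antipode_mor.
End Antip.

Definition inC (p : fmat A) : hom (fo (fdual p) ⊗ fo p)%cat U := inc p.
Definition dC (Y : C) : hom Y (Y ⊗ U)%cat := cdelta Y.
Definition psiC (q p : fmat A) : hom (fo q ⊗ fo p)%cat (fo (fprod q p)) := psi q p.
Definition psiVC (q p : fmat A) : hom (fo (fprod q p)) (fo q ⊗ fo p)%cat := psiV q p.
Definition thC (p q : fmat A) : hom (fo (fdual p) ⊗ fo (fdual q))%cat
  (fo (fdual (fprod q p))) := th p q.

Lemma dC_nat (Y Z : C) (f : hom Y Z) : (dC Z ∘ f = f · U ∘ dC Y)%cat.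
Proof. apply: chom_eq => t; exact: coend_coact_nat. Qed.
Lemma dC_obj p : (dC (fo p) = fo p ∙ inC p ∘ al (fo p) (fo (fdual p)) (fo p)
  ∘ coevc p · fo p ∘ luV (fo p))%cat.
Proof. apply: chom_eq => t; exact: coend_coact_fob. Qed.
Lemma psiKC q p : (psiVC q p ∘ psiC q p)%cat = idm.
Proof. apply: chom_eq => t; exact: psiK. Qed.

(** The matrix coefficients span A. *)
Lemma coverC (V W Y Z : C) (f g : hom (V ⊗ U ⊗ Y ⊗ Z)%cat W) :
  (forall p, (f ∘ mrg (inC p) V · Y · Z)%cat = (g ∘ mrg (inC p) V · Y · Z)%cat) -> f =
    g.
Proof.
move=> E; apply: chom_eq.
have lf := cf_lin (f : chom (cten (cten (cten V U) Y) Z) W).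
have lg := cf_lin (g : chom (cten (cten (cten V U) Y) Z) W).
apply: (extT lf lg) => t z; move: t.
apply: (extT (linD_ext' z lf) (linD_ext' z lg)) => t y; move: t.
have lf2 := linD_ext' y (linD_ext' z lf); have lg2 := linD_ext' y (linD_ext' z lg).
apply: (extT lf2 lg2) => v a; move: a.
apply: (ext_A (linD_ext v lf2) (linD_ext v lg2)) => p i j.
(* The generator followed by a reassociation; [t] is a preimage of the
   coefficient. *)
pose t := cassocV V (X' p) (X p) (v \ox (dlt k i \ox dlt k j)).
pose M := ccomp (ctmap (cid V) (inc p)) (cassoc V (X' p) (X p)).
have Mt : M t = v \ox p i j.
  rewrite /M /t; change (tmap (fun x : V => x) (inc p)
    (cassoc V (X' p) (X p) (cassocV V (X' p) (X p) (v \ox (dlt k i \ox dlt k j)))) = v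
      \ox p i j).
  rewrite [cassoc _ _ _ _]assocVK (tmapE _ _ (@lin_id _ V) (cf_lin (inc p))).
  by rewrite incE.
have := congr1 (fun h : chom (cten (cten (cten (cten V (X' p)) (X p)) Y) Z) W => h
  ((t \ox y) \ox z)) (E p).
rewrite mrgE.
change (f (tmap (tmap M (fun x : Y => x)) (fun x : Z => x) ((t \ox y) \ox z)) = g
  (tmap (tmap M (fun x : Y => x)) (fun x : Z => x) ((t \ox y) \ox z)) -> f
    (((v \ox p i j) \ox y) \ox z) = g (((v \ox p i j) \ox y) \ox z)).
rewrite !tmapE; [|clin..].
by rewrite Mt.
Qed.

Lemma ep_iC p : (epC ∘ inC p)%cat = evc p.
Proof.
apply: chom_eq; apply: (ext_ffun2 (cf_lin (ccomp (epC : chom _ _) (inc p)))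
  (cf_lin (ev p))) => i j.
by change (alpha (inc p (dlt k i \ox dlt k j)) = ev p (dlt k i \ox dlt k j)); rewrite
  incE [RHS]evalfE.
Qed.
Lemma D_iC p : (DC ∘ inC p = tenm (inC p) (inC p) ∘ al (fo (fdual p) ⊗ fo p)
  (fo (fdual p)) (fo p)
  ∘ cre (coevc p) (fo (fdual p)) · fo p)%cat.
Proof.
rewrite creE splE.
set h := ((alV (fo (fdual p)) (fo p) (fo (fdual p)) ∘ fo (fdual p) ∙ coevc p) ∘ ruV
  (fo (fdual p)))%cat.
apply: chom_eq.
apply: (ext_ffun2 (cf_lin (ccomp (DC : chom _ _) (inc p)))
  (cf_lin (ccomp (ctmap (inc p) (inc p)) (ccomp
    (cassoc (cten (X' p) (X p)) (X' p) (X p)) (ctmap (h : chom _ _) (cid (X p)))))))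
      => i j.
change (und_comul (inc p (dlt k i \ox dlt k j)) = tmap (inc p) (inc p)
  (cassoc (cten (X' p) (X p)) (X' p) (X p)
  (tmap (fun t => cassocV (X' p) (X p) (X' p) (tmap id (coev p) (cruV (X' p) t))) id
    (dlt k i \ox dlt k j)))).
rewrite incE comulU_inc; congr (tmap _ _ (cassoc _ _ _ _)).
by do 3 tmap_eval; rewrite [RHS]tmapE; [|clin|clin].
Qed.
(** The comparison [th] was defined as the transpose of the nested
    evaluation. *)
Lemma e_prC q p : (evc (fprod q p) ∘ tenm (thC p q) (psiC q p)
  = evc p ∘ (ru (fo (fdual p)) ∘ fo (fdual p) ∙ evc q ∘ al (fo (fdual p))
    (fo (fdual q)) (fo q)) · fo p
    ∘ alV (fo (fdual p) ⊗ fo (fdual q)) (fo q) (fo p))%cat.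
Proof.
have E := transpose_ev (pzigl (fprod q p)) (nest p q).
have -> : (tenm (thC p q) (psiC q p) = thC p q · fo (fprod q p) ∘
  (fo (fdual p) ⊗ fo (fdual q)) ∙ psiC q p)%cat.
  by rewrite -tenmM compm1 comp1m.
rewrite -compA; etransitivity.
  exact: (congr1 (fun z => z ∘ (fo (fdual p) ⊗ fo (fdual q)) ∙ psiC q p)%cat E).
rewrite /nest !compA -wlM psiKC tenm1 compm1 //.
Qed.
Lemma m_iC p q : (mC ∘ tenm (inC p) (inC q)
  = inC (fprod q p) ∘ tenm (thC p q) (psiC q p ∘ c (fo p) (fo q))
    ∘ alV (fo (fdual p)) (fo (fdual q)) (fo p ⊗ fo q)
    ∘ fo (fdual p) ∙ (al (fo (fdual q)) (fo p) (fo q) ∘ c (fo p) (fo (fdual q)) · fo q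
              ∘ alV (fo p) (fo (fdual q)) (fo q))
    ∘ al (fo (fdual p)) (fo p) (fo (fdual q) ⊗ fo q))%cat.
Proof.
change (mC ∘ tenm (inC p) (inC q) = (mcomp hs p q : hom
  ((fo (fdual p) ⊗ fo p) ⊗ (fo (fdual q) ⊗ fo q)) U))%cat.
apply: chom_eq.
have l1 := cf_lin (ccomp (mC : chom _ _) (ctmap (inc p) (inc q))); have l2 := cf_lin
  (mcomp hs p q).
apply: (extT l1 l2) => a b; move: a.
apply: (ext_ffun2 (linD_ext' b l1) (linD_ext' b l2)) => i x; move: b.
apply: (ext_ffun2 (linD_ext _ l1) (linD_ext _ l2)) => j y.
change (und_mul sigma (tmap (inc p) (inc q) ((dlt k i \ox dlt k x) \ox
  (dlt k j \ox dlt k y)))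
  = mcomp hs p q ((dlt k i \ox dlt k x) \ox (dlt k j \ox dlt k y))).
by rewrite -mulU_inc; tmap_eval; rewrite !incE mulUE.
Qed.
Lemma delta_oneC : (dC one = one ∙ etC ∘ ruV one)%cat.
Proof.
apply: chom_eq; apply: (ext_k (cf_lin (cdelta (cone A)))
  (cf_lin (ccomp (ctmap (cid (cone A)) (etC : chom _ _)) (cruV (cone A))))).
change (coend_coact (M := cone A) 1 = tmap (fun x : k^o => x) (@und_unit k A)
  ((1 : k^o) \ox (1 : k^o))).
rewrite (tmapE _ _ (@lin_id _ k^o) (cf_lin (etC : chom (cone A) (cund A)))).
etransitivity; first exact: (coend_coact_b (mbasis_cone A) tt).
rewrite !sum_unit /mone S_one (dqb_phi1 HA) (dqb_one_counit HA) (dqh_beta1 HH) !mulr1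
  scale1r.
by congr (_ \ox _); rewrite /= /und_unit scale1r.
Qed.
(** The unit object is isomorphic to the object of the 1 by 1 matrix with entry
    1. *)
Lemma retract_oneC : retract (C := C) (@fo k A) one.
Proof.
pose r (a : k^o) : fob (fone A) := (a : k) *: (dlt k tt : {ffun unit -> k^o}).
have lr : lin r by apply: (@lin_scalel _ _ _ (fun x => x)); exact: lin_id.
have mr : @is_comorphism k A (cone A) (fob (fone A)) r.
  split=> //; apply: ext_k.
  - exact: (lin_comp (coact_lin (M := fob (fone A))) lr).
  - exact: (lin_comp (lin_tmap lr (@lin_id _ A)) (coact_lin (M := cone A))).
  rewrite (mb_coact (mbasis_cone A) tt) sum_unit (tmapE _ _ lr (@lin_id _ A)) /r
    scale1r.
  by rewrite (mb_coact (fob_b (fone A)) tt) sum_unit.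
pose r' := Chom (@bmap_mor k A (cone A) (fone A) (fun=> (1 : k^o)) (mbasis_cone A)).
exists (fone A), (Chom mr : hom (one : C) (fo (fone A))),
  (r' : hom (fo (fone A)) (one : C)).
apply: chom_eq; apply: (ext_k (cf_lin (ccomp r' (Chom mr))) (cf_lin (cid (cone A)))).
change (lext (fun=> (1 : k^o)) (r 1) = 1).
by rewrite /r scale1r lextE.
Qed.
Lemma S_iC SV (SK : cancel S SV) (SVK : cancel SV S) p :
  (SC SK SVK ∘ inC p = ru U ∘ U ∙ evc p ∘ al U (fo (fdual p)) (fo p)
    ∘ cbrV hs (cund A) (fob (fdual p)) · fo p ∘ dC (fo (fdual p)) · fo p)%cat.
Proof.
apply: chom_eq.
apply: (ext_ffun2 (cf_lin (ccomp (SC SK SVK : chom _ _) (inc p))) (cf_lin (comp_S p)))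
  => i j.
change (und_antipode SV (sigmaV sigma) (inc p (dlt k i \ox dlt k j)) = comp_S p
  (dlt k i \ox dlt k j)).
by rewrite incE (antipodeU_inc hs SK SVK).
Qed.

Lemma PhiV111 : PhiV oA oA oA = 1.
Proof.
have := phi_r (multmat_one A) (multmat_one A) (multmat_one A) tt tt tt tt tt tt.
by rewrite !sum_unit /mone (dqb_phi1 HA) (dqb_one_counit HA) !mul1r.
Qed.
Lemma comul_one : und_comul oA = oA \ox oA.
Proof.
have mp := multmat_one A; change (und_comul (mone A tt tt) = oA \ox oA).
rewrite /und_comul; etransitivity; [sweedler_expand|]; cbv beta; rewrite !sum_unit
  /mone.
rewrite S_one (dqb_mul1l HA) PhiV111 (dqb_phi1 HA) (dqb_one_counit HA) (dqh_beta1 HH).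
by rewrite !mulr1 scale1r.
Qed.
End Final.

Theorem theorem4p5 (k : fieldType) (A : dualQuasiHopf k)
    (sigma : {scalar (A \ox A)%type}) (hsigma : co_quasi_triangular sigma) :
  exists (SV : A -> A) (sigmaV : {scalar (A \ox A)%type}),
    [/\ cancel (dqh_S A) SV, cancel SV (dqh_S A),
        convolution_inverse sigma sigmaV &
        @is_braided_Hopf_algebra k A sigma (und A)
          (und_mul sigma) (@und_unit k A) (@und_comul k A) (@und_counit k A)
          (und_antipode SV sigmaV)].
Proof.
have [SV [SK SVK]] := antipode_bij hsigma.
exists SV, (sigmaV sigma); split=> //; first exact: sigmaV_inv.
have cK := cbrK hsigma; have cVK := cbrVK hsigma.
have zl := @pzigl k A; have zr := @pzigr k A; have cov := @coverC k A.
have dn := @dC_nat k A; have dob := @dC_obj k A; have d1 := @delta_oneC k A.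
have epi := @ep_iC k A; have Di := @D_iC k A; have mi := m_iC hsigma.
have psiK := @psiKC k A; have epr := e_prC (A := A); have r1 := @retract_oneC k A.
have Si := S_iC hsigma SK SVK.
have hA := mA cK cVK zl zr dn dob cov psiK epr mi.
have h1l := m1l cK cVK zl zr dn dob cov epr mi r1 d1.
have h1r := m1r cK cVK zl zr dn dob cov epr mi r1 d1.
have hDa := Dassoc zl zr dob cov Di.
have hDl := D1l zl zr dob cov epi Di.
have hDr := D1r zl zr dob cov epi Di.
have hem := epm cK cVK zl zr dn dob cov epi psiK epr mi.
have hSl := mSD cK cVK zl zr dn dob cov epi Di epr mi d1 Si.
have hSr := mDS cK cVK zl zr dn dob cov epi Di epr mi d1 Si.
have hDm := Dm cK cVK zl zr dn dob cov Di psiK epr mi.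
split.
- exact: localfin_comodule (und_localfin A).
- exact: mul_mor.
- exact: unit_mor.
- exact: comul_mor.
- exact: counit_mor.
- exact: antipode_mor.
- by move=> t; exact: (congr1 (fun f : chom (cten (cten (cund A) (cund A)) (cund A))
  (cund A) => f t) hA).
- by move=> t; exact: (congr1 (fun f : chom (cten (cone A) (cund A)) (cund A) => f t)
  h1l).
- by move=> t; exact: (congr1 (fun f : chom (cten (cund A) (cone A)) (cund A) => f t)
  h1r).
- by move=> b; exact: (congr1 (fun f : chom (cund A)
  (cten (cund A) (cten (cund A) (cund A))) => f b) hDa).
- by move=> b; exact: (congr1 (fun f : chom (cund A) (cund A) => f b) hDl).
- by move=> b; exact: (congr1 (fun f : chom (cund A) (cund A) => f b) hDr).
- by move=> t; exact: (congr1 (fun f : chom (cten (cund A) (cund A))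
  (cten (cund A) (cund A)) => f t) hDm).
- by rewrite /und_unit scale1r; exact: comul_one.
- by move=> t; exact: (congr1 (fun f : chom (cten (cund A) (cund A)) (cone A) => f t)
  hem).
- move=> a; rewrite /und_counit /und_unit linearZ /= (dqh_alpha1 (dqh_axioms A)).
  exact: mulr1.
- by move=> b; exact: (congr1 (fun f : chom (cund A) (cund A) => f b) hSl).
by move=> b; exact: (congr1 (fun f : chom (cund A) (cund A) => f b) hSr).
Qed.
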